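(* Let $\Phi^i$ be an i-Willmore surface carrying a family of i-M-circles. Suppose that the top view of the family is an elliptic pencil of circles. Then the surface $\Phi^i$ is i-M-equivalent to a piece of the surface $$z=\left(a_1(x^2+y^2)+a_2x+a_3\right)\mathrm{Arctan}\,\frac{y}{x}+\frac{b_1y^2+b_2xy}{x^2+y^2}+c_1y^2+c_2xy$$ for some $a_1,a_2,a_3,b_1,b_2,c_1,c_2\in\mathbb{R}$.
   Context: Isotropic space is $\mathbb{R}^3$ with coordinates $(x,y,z)$; the top view is the projection $(x,y,z)\mapsto(x,y,0)$. An i-M-sphere is a surface $z=\frac a2(x^2+y^2)+bx+cy+d$ with $a,b,c,d\in\mathbb{R}$; the number $a$ is its i-mean curvature. An i-M-circle is an intersection curve of two distinct i-M-spheres. Extended isotropic space is $\mathbb{R}^3\cup\ell_\infty$, where $\ell_\infty$ is an ideal line (a copy of $\mathbb{R}$), and an i-M-sphere with i-mean curvature $a$ meets $\ell_\infty$ at the point $a$. An i-M-transformation is a bijection of $\mathbb{R}^3\cup\ell_\infty$ taking i-M-spheres to i-M-spheres; the group of these is generated by $(x,y,z)\mapsto(x+1,y,z)$, rotations about the $z$-axis, $(x,y,z)\mapsto(x,y,z+ax+by)$, $(x,y,z)\mapsto(x,y,z+x^2+y^2-1)$, $(x,y,z)\mapsto(x,y,z+h)$, $(x,y,z)\mapsto(x,y,az)$ $(a\neq0)$, $(x,y,z)\mapsto(x,y,z)/(x^2+y^2)$ and $(x,y,z)\mapsto(x,y,z)/\sqrt2$. Two surfaces are i-M-equivalent if one is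 the image of the other under an i-M-transformation. An i-Willmore surface is the graph $z=F(x,y)$ of a biharmonic function ($\Delta\Delta F=0$) on a planar region, possibly analytically continued to a multi-valued one; by restriction to a smaller part one may assume it single-valued. The surface carries a family of i-M-circles if it contains an arc of each i-M-circle of the family. An elliptic pencil of circles in the plane is the set of all circles (lines allowed) passing through two fixed distinct points (one of which may be the point at infinity, up to planar Möbius transformation); a one-parametric family (parametrized by a nondegenerate segment, with distinct members) has an elliptic pencil as top view if its members' top views are circles of such a pencil. $\mathrm{Arctan}\,x=\{\arctan x+\pi k: k\in\mathbb{Z}\}$ is the multi-valued inverse of the tangent, so the displayed surface is multi-valued. *)

(* Defs.v *)
(* Library world: MathComp with MathComp-Analysis. *)
From HB Require Import structures.
From mathcomp Require Import all_boot all_order all_algebra.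
From mathcomp Require Import all_classical all_reals all_analysis.

Set Implicit Arguments.
Unset Strict Implicit.
Unset Printing Implicit Defensive.

Import Order.TTheory GRing.Theory Num.Theory.
Import numFieldNormedType.Exports.

Local Open Scope classical_set_scope.
Local Open Scope ring_scope.

(* [inr a] is the point a of the ideal line, [None] the point at infinity of
   the Moebius plane; the top view sends the whole ideal line to infinity, so
   that the top view of an i-M-circle is a full circle of the Moebius plane. *)
Definition ext_space (R : realType) : Type := ((R * R * R) + R)%type.
Definition ext_plane (R : realType) : Type := option (R * R).

Definition top_view (R : realType) (p : ext_space R) : ext_plane R :=
  match p with
  | inl (x, y, _) => Some (x, y)
  | inr _ => None
  end.

Section IsotropicMoebius.
Variable R : realType.

Definition iM_sphere_of (a b c d : R) : set (ext_space R) :=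
  [set p | match p with
           | inl (x, y, z) =>
               z = a / 2 * (x ^+ 2 + y ^+ 2) + b * x + c * y + d
           | inr t => t = a
           end].

Definition iM_sphere (S : set (ext_space R)) : Prop :=
  exists a b c d : R, S = iM_sphere_of a b c d.

(* Two distinct i-M-spheres may also be disjoint or share a single point
   (possibly ideal); otherwise they meet in a curve. *)
Definition iM_circle (C : set (ext_space R)) : Prop :=
  exists S1 S2 : set (ext_space R),
    [/\ iM_sphere S1, iM_sphere S2, S1 <> S2, C = S1 `&` S2 & infinite_set C].

(* The equivalence (rather than an implication) makes these maps a group by
   definition. *)
Definition iM_transformation (f : ext_space R -> ext_space R) : Prop :=
  bijective f /\
  forall S : set (ext_space R), iM_sphere S <-> iM_sphere (f @` S).

Definition iM_equivalent (A B : set (ext_space R)) : Prop :=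
  exists2 f : ext_space R -> ext_space R, iM_transformation f & f @` A = B.

Definition embed (A : set (R * R * R)) : set (ext_space R) := inl @` A.

Definition dir_x : R * R := (1, 0).
Definition dir_y : R * R := (0, 1).

Definition partial_x (F : R * R -> R) : R * R -> R := fun p => 'D_dir_x F p.
Definition partial_y (F : R * R -> R) : R * R -> R := fun p => 'D_dir_y F p.

Definition laplacian (F : R * R -> R) : R * R -> R :=
  fun p => partial_x (partial_x F) p + partial_y (partial_y F) p.

(* F is of class C^k on the open set U. *)
Fixpoint class_C (k : nat) (U : set (R * R)) (F : R * R -> R) : Prop :=
  match k with
  | 0 => forall p, U p -> {for p, continuous F}
  | k'.+1 =>
      [/\ forall p, U p -> {for p, continuous F},
          forall p, U p -> derivable F p dir_x /\ derivable F p dir_y,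
          class_C k' U (partial_x F) & class_C k' U (partial_y F)]
  end.

Definition biharmonic (U : set (R * R)) (F : R * R -> R) : Prop :=
  class_C 4 U F /\ forall p, U p -> laplacian (laplacian F) p = 0.

Definition region (U : set (R * R)) : Prop :=
  [/\ open U, connected U & U !=set0].

Definition graph_on (U : set (R * R)) (F : R * R -> R) : set (R * R * R) :=
  [set q | U q.1 /\ q.2 = F q.1].

(* (U', F') is a direct continuation of (U, F); as U `&` U' need not be
   connected, F and F' may still differ on another part of it, which is how
   multi-valued functions arise. *)
Definition direct_continuation
    (U : set (R * R)) (F : R * R -> R)
    (U' : set (R * R)) (F' : R * R -> R) : Prop :=
  exists V : set (R * R),
    [/\ open V, V !=set0, V `<=` U `&` U' & {in V, F =1 F'}].

(* The graph of a biharmonic function, possibly analytically continued to a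
   multi-valued one: the function is given by its elements (U n, F n), each of
   which continues an earlier one.  Countably many elements always suffice
   (Poincare-Volterra); constant sequences give the single-valued case. *)
Definition i_Willmore (Phi : set (R * R * R)) : Prop :=
  exists (U : nat -> set (R * R)) (F : nat -> R * R -> R),
    [/\ forall n, region (U n) /\ biharmonic (U n) (F n),
        forall n, exists2 m : nat, (m <= n)%N &
          direct_continuation (U m) (F m) (U n.+1) (F n.+1)
      & Phi = \bigcup_n graph_on (U n) (F n)].

Definition space_arc (A : set (R * R * R)) : Prop :=
  exists g : R -> R * R * R,
    [/\ {within `[0, 1], continuous g}, {in `[0, 1] &, injective g}
      & A = g @` `[0, 1]].

Definition contains_arc_of (Phi : set (R * R * R)) (C : set (ext_space R)) :
    Prop :=
  exists A : set (R * R * R), [/\ space_arc A, embed A `<=` C & A `<=` Phi].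

(* The family is (C t) for t in the segment [t0, t1]. *)
Definition iM_circle_family (t0 t1 : R) (C : R -> set (ext_space R)) : Prop :=
  [/\ t0 < t1, forall t, t \in `[t0, t1] -> iM_circle (C t)
    & {in `[t0, t1] &, injective C}].

Definition carries_family (Phi : set (R * R * R)) (t0 t1 : R)
    (C : R -> set (ext_space R)) : Prop :=
  forall t, t \in `[t0, t1] -> contains_arc_of Phi (C t).

Definition euclidean_circle (K : set (ext_plane R)) : Prop :=
  exists x0 y0 r : R, 0 < r /\
    K = [set p | match p with
                 | Some (x, y) => (x - x0) ^+ 2 + (y - y0) ^+ 2 = r ^+ 2
                 | None => False
                 end].

Definition extended_line (K : set (ext_plane R)) : Prop :=
  exists u v w : R, (u, v) <> (0, 0) /\
    K = [set p | match p with
                 | Some (x, y) => u * x + v * y + w = 0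
                 | None => True
                 end].

Definition planar_circle (K : set (ext_plane R)) : Prop :=
  euclidean_circle K \/ extended_line K.

Definition pencil_through (P Q : ext_plane R) : set (set (ext_plane R)) :=
  [set K | [/\ planar_circle K, K P & K Q]].

Definition elliptic_pencil (E : set (set (ext_plane R))) : Prop :=
  exists P Q : ext_plane R, P <> Q /\ E = pencil_through P Q.

Definition top_view_in (t0 t1 : R) (C : R -> set (ext_space R))
    (E : set (set (ext_plane R))) : Prop :=
  forall t, t \in `[t0, t1] -> E (@top_view R @` C t).

Definition Arctan (u : R) : set R := [set atan u + pi *~ k | k in [set: int]].

(* Arctan (y / x), continued to x = 0: the values are pi / 2 + pi * k when
   y <> 0, and every angle is a limit of values at the origin. *)
Definition Arctan_quotient (y x : R) : set R :=
  if x == 0 then [set t | y * cos t = 0] else Arctan (y / x).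

(* At the origin the fraction is 0 / 0 = 0, its continuous value in the only
   case where the right-hand side is continuous there, b1 = b2 = 0. *)
Definition canonical_surface (a1 a2 a3 b1 b2 c1 c2 : R) : set (R * R * R) :=
  [set q | let: (x, y, z) := q in
     exists2 t : R, Arctan_quotient y x t &
       z = (a1 * (x ^+ 2 + y ^+ 2) + a2 * x + a3) * t
           + (b1 * y ^+ 2 + b2 * x * y) / (x ^+ 2 + y ^+ 2)
           + c1 * y ^+ 2 + c2 * x * y].

End IsotropicMoebius.

(* Main.v *)
Require Import Defs.
From HB Require Import structures.
From mathcomp Require Import all_boot all_order all_algebra.
From mathcomp Require Import all_classical all_reals all_analysis.
From mathcomp Require Import ring lra.

Set Implicit Arguments.
Unset Strict Implicit.
Unset Printing Implicit Defensive.

Import Order.TTheory GRing.Theory Num.Theory.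
Import numFieldNormedType.Exports.

Local Open Scope classical_set_scope.
Local Open Scope ring_scope.

(** Of an elliptic pencil only the two base points matter.  A translation and
    an inversion of space move them to the origin and to infinity.  An
    i-M-circle with a point over the origin and an ideal point lies over a line
    through the origin, and on it z is a quadratic polynomial in the distance
    to the origin ([circle_over_lineP]).

    By Baire's theorem each circle of the family has a subarc on a single
    element of the multi-valued function, over a set avoiding the base points
    ([arc_sheet]).  As the family is uncountable and there are countably many
    elements and rational polar boxes, some element carries such segments over
    one box for infinitely many directions, and the directions accumulate
    ([family_canonical_at]).  After a rotation the limit is the x-axis: F is a
    quadratic polynomial in x on lines y = s x with slopes s tending to 0.  By
    Rolle's theorem x^j d^jF/dy^j (x, 0) is then a quadratic polynomial in x for
    j = 0, 1, 2, 3, which makes twelve numbers.  There is a twelve-dimensional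
    space of biharmonic functions with the same property: the right-hand side
    of the theorem plus a multiple of y Arctan (y / x) plus an i-M-sphere.  One
    of them has the same Cauchy data as F on the axis up to order three, hence
    is equal to F ([local_normal_form]).

    This uniqueness and the global conclusions rest on unique continuation for
    biharmonic functions ([biharmonic_continuation]), proved for functions of
    class C^4 without representing them by power series.  If u is harmonic and
    vanishes near the origin, the real part of z^-n (u_x - i u_y) obeys the
    maximum principle ([weighted_maximum]); letting n grow shows that the
    gradient of u vanishes.  Cauchy uniqueness follows, since a function whose
    Cauchy data vanish on the axis can be replaced by 0 on one side of it
    ([biharmonic_upper]).

    Being locally a branch of the canonical function with given parameters
    propagates to all elements, as long as the origin is removed from their
    domains ([canonical_at_sheets]).  If an element is defined over the origin,
    going around the origin once shows that the angle does not occur in the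
    formula ([monodromy], [smooth_at_origin]).  A rotation and a shear by an
    i-M-sphere bring the formula to the required form
    ([canonical_at_surface]).

    An inversion is not allowed when the surface has points over its centre.
    Either base point can serve as the centre; if the surface has points over
    both, the same analysis shows that it lies on a single i-M-sphere
    ([canonical_covered]). *)

(** * Functions of class C^k in the plane *)

Section PlaneCalculus.
Variable R : realType.
Implicit Types (F G : R * R -> R) (U V : set (R * R)) (p : R * R).
Local Notation dx := (dir_x R).
Local Notation dy := (dir_y R).

(** Derivatives along the axes are those of the restrictions to horizontal and vertical
    lines, to which the one-variable theorems apply. *)
Lemma slice_x F p d :
  is_derive p dx F d <-> is_derive p.1 (1 : R) (fun t => F (t, p.2)) d.
Proof.
have E : (fun h => h^-1 *: ((F \o shift p) (h *: dx) - F p)) =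
   (fun h : R => h^-1 *: (((fun t => F (t, p.2)) \o shift p.1) (h *: (1:R)) - F (p.1, p.2))).
  by apply/funext => h /=; rewrite /dir_x -surjective_pairing; congr (_ *: (F _ - _));
     apply: injective_projections => //=; rewrite scaler0 add0r.
by split=> -[h1 h2]; split; move: h1 h2; rewrite /derivable /derive E.
Qed.

Lemma slice_y F p d :
  is_derive p dy F d <-> is_derive p.2 (1 : R) (fun t => F (p.1, t)) d.
Proof.
have E : (fun h => h^-1 *: ((F \o shift p) (h *: dy) - F p)) =
   (fun h : R => h^-1 *: (((fun t => F (p.1, t)) \o shift p.2) (h *: (1:R)) - F (p.1, p.2))).
  by apply/funext => h /=; rewrite /dir_y -surjective_pairing; congr (_ *: (F _ - _));
     apply: injective_projections => //=; rewrite scaler0 add0r.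
by split=> -[h1 h2]; split; move: h1 h2; rewrite /derivable /derive E.
Qed.

#[local] Opaque derive derivable.

Lemma near_open U p (P : R * R -> Prop) : open U -> U p ->
  (forall q, U q -> P q) -> \forall q \near p, P q.
Proof.
move=> oU Up UP; have UN : nbhs p U by apply: open_nbhs_nbhs; split.
by apply: filterS UN.
Qed.

Lemma continuous_ext_open U F G p : open U -> U p ->
  (forall q, U q -> F q = G q) -> {for p, continuous F} -> {for p, continuous G}.
Proof.
move=> oU Up FG; rewrite /prop_for /continuous_at -FG// => Fp.
by apply: cvg_trans Fp; apply: near_eq_cvg; exact: near_open oU Up _.
Qed.

Lemma is_derive_ext_open U F G p v d : open U -> U p ->
  (forall q, U q -> F q = G q) -> is_derive p v F d -> is_derive p v G d.
Proof. by move=> oU Up FG; apply: near_eq_is_derive; exact: near_open oU Up _. Qed.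

Lemma derive_ext_open U F G p v : open U -> U p ->
  (forall q, U q -> F q = G q) -> 'D_v F p = 'D_v G p.
Proof. by move=> oU Up FG; apply: near_eq_derive; exact: near_open oU Up _. Qed.

Lemma class_C_ext k U F G : open U ->
  (forall q, U q -> F q = G q) -> class_C k U F -> class_C k U G.
Proof.
move=> oU; elim: k F G => [|k IH] F G FG /=.
  by move=> cF p Up; apply: continuous_ext_open FG (cF p Up).
move=> [cF dF CFx CFy]; split.
- by move=> p Up; apply: continuous_ext_open FG (cF p Up).
- move=> p Up; have [dFx dFy] := dF p Up.
  by split; apply: near_eq_derivable; [|exact: dFx| |exact: dFy];
    exact: near_open oU Up _.
- by apply: IH CFx => q Uq; apply: derive_ext_open FG.
- by apply: IH CFy => q Uq; apply: derive_ext_open FG.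
Qed.

(** Any formulas for the two partial derivatives on [U] may be used to climb one class. *)
Lemma class_CS k U F Fx Fy : open U ->
  (forall p, U p -> {for p, continuous F}) ->
  (forall p, U p -> is_derive p dx F (Fx p) /\ is_derive p dy F (Fy p)) ->
  class_C k U Fx -> class_C k U Fy -> class_C k.+1 U F.
Proof.
move=> oU cF dF CFx CFy; split.
- exact: cF.
- by move=> p Up; have [[dFx _] [dFy _]] := dF p Up.
- apply: (class_C_ext oU _ CFx) => p Up.
  by rewrite /partial_x; have [[_ <-] _] := dF p Up.
- apply: (class_C_ext oU _ CFy) => p Up.
  by rewrite /partial_y; have [_ [_ <-]] := dF p Up.
Qed.

Lemma class_C_cont k U F : class_C k U F ->
  forall p, U p -> {for p, continuous F}.
Proof. by case: k => [|k] //= []. Qed.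

Lemma class_C_dx k U F : class_C k.+1 U F ->
  forall p, U p -> is_derive p dx F (partial_x F p).
Proof. by move=> [_ dF _ _] p Up; have [? _] := dF p Up; split. Qed.

Lemma class_C_dy k U F : class_C k.+1 U F ->
  forall p, U p -> is_derive p dy F (partial_y F p).
Proof. by move=> [_ dF _ _] p Up; have [_ ?] := dF p Up; split. Qed.

Lemma class_C_px k U F : class_C k.+1 U F -> class_C k U (partial_x F).
Proof. by case. Qed.

Lemma class_C_py k U F : class_C k.+1 U F -> class_C k U (partial_y F).
Proof. by case. Qed.

Lemma class_C_pred k U F : class_C k.+1 U F -> class_C k U F.
Proof.
elim: k F => [|k IH] F; first by case.
by move=> [cF dF CFx CFy]; split;
  [exact: cF|exact: dF|exact: (IH _ CFx)|exact: (IH _ CFy)].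
Qed.

Lemma class_C_le k l U F : (k <= l)%N -> class_C l U F -> class_C k U F.
Proof.
elim: l => [|l IH]; first by rewrite leqn0 => /eqP ->.
by rewrite leq_eqVlt => /orP[/eqP -> CF|kl /class_C_pred]; [exact: CF|exact: IH].
Qed.

Lemma class_C_sub k U V F : V `<=` U -> class_C k U F -> class_C k V F.
Proof.
move=> VU; elim: k F => [|k IH] F /=; first by move=> cF p /VU; exact: cF.
move=> [cF dF /IH CFx /IH CFy]; split; [| |exact: CFx|exact: CFy].
  by move=> p /VU; exact: cF.
by move=> p /VU; exact: dF.
Qed.

Lemma class_C_cst k U (c : R) : open U -> class_C k U (fun=> c).
Proof.
move=> oU; elim: k c => [|k IH] c; first by move=> p _; exact: cst_continuous.
apply: (@class_CS k U (fun=> c) (fun=> 0) (fun=> 0) oU) => [p _|p _||].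
- exact: cst_continuous.
- by split; exact: is_derive_cst.
- exact: IH.
- exact: IH.
Qed.

Lemma is_derive_fst_x p : is_derive p dx (fun q : R * R => q.1) 1.
Proof. by apply/slice_x => /=; exact: is_derive_id. Qed.
Lemma is_derive_fst_y p : is_derive p dy (fun q : R * R => q.1) 0.
Proof. by apply/slice_y => /=; exact: is_derive_cst. Qed.
Lemma is_derive_snd_x p : is_derive p dx (fun q : R * R => q.2) 0.
Proof. by apply/slice_x => /=; exact: is_derive_cst. Qed.
Lemma is_derive_snd_y p : is_derive p dy (fun q : R * R => q.2) 1.
Proof. by apply/slice_y => /=; exact: is_derive_id. Qed.

Lemma class_C_fst k U : open U -> class_C k U (fun q : R * R => q.1).
Proof.
move=> oU; case: k => [|k]; first by move=> p _; exact: cvg_fst.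
apply: (@class_CS k U _ (fun=> 1) (fun=> 0) oU) => [p _|p _||].
- exact: cvg_fst.
- by split; [exact: is_derive_fst_x|exact: is_derive_fst_y].
- exact: class_C_cst.
- exact: class_C_cst.
Qed.

Lemma class_C_snd k U : open U -> class_C k U (fun q : R * R => q.2).
Proof.
move=> oU; case: k => [|k]; first by move=> p _; exact: cvg_snd.
apply: (@class_CS k U _ (fun=> 0) (fun=> 1) oU) => [p _|p _||].
- exact: cvg_snd.
- by split; [exact: is_derive_snd_x|exact: is_derive_snd_y].
- exact: class_C_cst.
- exact: class_C_cst.
Qed.

Lemma class_CD k U F G : open U -> class_C k U F -> class_C k U G ->
  class_C k U (fun p => F p + G p).
Proof.
move=> oU; elim: k F G => [|k IH] F G CF CG.
  by move=> p Up; apply: continuousD; [exact: CF|exact: CG].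
apply: (@class_CS k U _ (fun p => partial_x F p + partial_x G p)
  (fun p => partial_y F p + partial_y G p) oU) => [p Up|p Up||].
- by apply: continuousD; [exact: class_C_cont CF _ _|exact: class_C_cont CG _ _].
- split; apply: is_deriveD; [exact: class_C_dx CF _ _|exact: class_C_dx CG _ _|exact: class_C_dy CF _ _|exact: class_C_dy CG _ _].
- by apply: IH; [case: CF|case: CG].
- by apply: IH; [case: CF|case: CG].
Qed.

Lemma is_derivePM (N : normedModType R) (F G : N -> R) (p v : N) a b : is_derive p v F a -> is_derive p v G b ->
  is_derive p v (fun q => F q * G q) (a * G p + F p * b).
Proof.
move=> dF dG; have := is_deriveM dF dG; rewrite /GRing.scale /=.
by congr is_derive; rewrite addrC mulrC.
Qed.

Lemma class_CM k U F G : open U -> class_C k U F -> class_C k U G ->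
  class_C k U (fun p => F p * G p).
Proof.
move=> oU; elim: k F G => [|k IH] F G CF CG.
  by move=> p Up; apply: continuousM; [exact: CF|exact: CG].
apply: (@class_CS k U _ (fun p => partial_x F p * G p + F p * partial_x G p)
  (fun p => partial_y F p * G p + F p * partial_y G p) oU) => [p Up|p Up||].
- by apply: continuousM; [exact: class_C_cont CF _ _|exact: class_C_cont CG _ _].
- split; apply: is_derivePM; [exact: class_C_dx CF _ _|exact: class_C_dx CG _ _|exact: class_C_dy CF _ _|exact: class_C_dy CG _ _].
- by apply: (class_CD oU); apply: IH; [exact: class_C_px CF|exact: class_C_pred CG|exact: class_C_pred CF|exact: class_C_px CG].
- by apply: (class_CD oU); apply: IH; [exact: class_C_py CF|exact: class_C_pred CG|exact: class_C_pred CF|exact: class_C_py CG].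
Qed.

Lemma class_CZ k U F (c : R) : open U -> class_C k U F ->
  class_C k U (fun p => c * F p).
Proof. by move=> oU CF; apply: class_CM => //; exact: class_C_cst. Qed.

Lemma class_CN k U F : open U -> class_C k U F -> class_C k U (fun p => - F p).
Proof.
move=> oU /(class_CZ (-1) oU); apply: class_C_ext => // q _.
by rewrite mulN1r.
Qed.

Lemma class_CB k U F G : open U -> class_C k U F -> class_C k U G ->
  class_C k U (fun p => F p - G p).
Proof. by move=> oU CF CG; apply: class_CD => //; exact: class_CN. Qed.

Lemma is_derivePV (N : normedModType R) (F : N -> R) (p v : N) a : F p != 0 -> is_derive p v F a ->
  is_derive p v (fun q => (F q)^-1) (- (a * ((F p)^-1 * (F p)^-1))).
Proof.
move=> Fp0 [dF <-]; split; first exact: derivableV.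
by rewrite deriveV// /GRing.scale/= expr2 invfM mulNr mulrC.
Qed.

Lemma class_CV k U F : open U -> (forall p, U p -> F p != 0) ->
  class_C k U F -> class_C k U (fun p => (F p)^-1).
Proof.
move=> oU F0; elim: k => [|k IH] CF.
  by move=> p Up; apply: continuousV; [exact: F0|exact: CF].
have CI : class_C k U (fun p => (F p)^-1) by apply: IH; exact: class_C_pred CF.
apply: (@class_CS k U _ (fun p => - (partial_x F p * ((F p)^-1 * (F p)^-1)))
  (fun p => - (partial_y F p * ((F p)^-1 * (F p)^-1))) oU) => [p Up|p Up||].
- by apply: continuousV; [exact: F0|exact: class_C_cont CF _ _].
- split; apply: is_derivePV; [exact: F0|exact: class_C_dx CF _ _|exact: F0|exact: class_C_dy CF _ _].
- by apply: class_CN => //; apply: class_CM => //;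
    [exact: class_C_px CF|exact: class_CM].
- by apply: class_CN => //; apply: class_CM => //;
    [exact: class_C_py CF|exact: class_CM].
Qed.

End PlaneCalculus.

(** * Differentiability and the chain rule *)

#[local] Opaque derive derivable.

Section LinearForm.
Variable R : realType.

Definition lin2 (a b : R) (v : R * R) : R := a * v.1 + b * v.2.

Lemma lin2_is_linear a b : linear (lin2 a b).
Proof. by move=> k u v; rewrite /lin2 /= /GRing.scale /=; ring. Qed.

HB.instance Definition _ a b :=
  GRing.isLinear.Build R (R * R)%type R _ (lin2 a b) (lin2_is_linear a b).

Lemma lin2_continuous a b : continuous (lin2 a b).
Proof.
move=> v; suff : {for v, continuous (fun u : R * R => a * u.1 + b * u.2)} by [].
apply: continuousD; apply: continuousM.
- exact: cst_continuous.
- exact: cvg_fst.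
- exact: cst_continuous.
- exact: cvg_snd.
Qed.

End LinearForm.

Section ChainRule.
Variable R : realType.
Implicit Types (F G : R * R -> R) (U V : set (R * R)) (p : R * R).
Local Notation dx := (dir_x R).
Local Notation dy := (dir_y R).

(** The mean value theorem for increments of either sign. *)
Lemma MVT_between (f df : R -> R) (a b : R) :
  (forall x, `|x - a| <= `|b - a| -> is_derive x 1 f (df x)) ->
  exists2 c, `|c - a| <= `|b - a| & f b - f a = df c * (b - a).
Proof.
move=> dfx.
have cf x : `|x - a| <= `|b - a| -> {for x, continuous f}.
  move=> /dfx [dfx' _]; apply: differentiable_continuous.
  exact/derivable1_diffP.
case: (ltgtP a b) => [ab|ba|->]; last first.
- by exists b; rewrite ?lexx// !subrr mulr0.
- have sub x : x \in `[b, a] -> `|x - a| <= `|b - a|.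
    rewrite in_itv/= => /andP[bx xa].
    by rewrite !ler0_norm ?subr_le0// ?(ltW ba)// lerN2 lerD2r.
  have [c cab E] : exists2 c, c \in `]b, a[%R & f a - f b = df c * (a - b).
    apply: MVT => // [x xab|].
      by apply/dfx/sub/subset_itv_oo_cc.
    apply: continuous_in_subspaceT => x; rewrite inE => /sub; exact: cf.
  exists c; first exact/sub/subset_itv_oo_cc.
  by rewrite -opprB E -mulrN opprB.
- have sub x : x \in `[a, b] -> `|x - a| <= `|b - a|.
    rewrite in_itv/= => /andP[ax xb].
    by rewrite !ger0_norm ?subr_ge0// ?(ltW ab)// lerD2r.
  have [c cab E] : exists2 c, c \in `]a, b[%R & f b - f a = df c * (b - a).
    apply: MVT => // [x xab|].
      by apply/dfx/sub/subset_itv_oo_cc.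
    apply: continuous_in_subspaceT => x; rewrite inE => /sub; exact: cf.
  by exists c => //; exact/sub/subset_itv_oo_cc.
Qed.

(** The norm of the plane is the maximum norm, hence balls are squares. *)
Lemma ball_square p (e : R) q :
  ball p e q <-> `|q.1 - p.1| < e /\ `|q.2 - p.2| < e.
Proof.
split.
  by move=> [] /= ; rewrite /ball/= !(distrC p.1) !(distrC p.2).
by move=> [h1 h2]; split; rewrite /ball/= distrC.
Qed.

Lemma open_ball U p : open U -> U p -> exists2 e : R, 0 < e & ball p e `<=` U.
Proof.
move=> oU Up; have /nbhs_ballP[e e0 sub] : nbhs p U by apply: open_nbhs_nbhs.
by exists e.
Qed.

(** The increment is the sum of a horizontal and a vertical one, and the mean value
    theorem applies to each; the error is controlled by the continuity of the partial
    derivatives. *)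
Lemma C1_diff U F p : open U -> class_C 1 U F -> U p ->
  is_diff p F (lin2 (partial_x F p) (partial_y F p)).
Proof.
move=> oU CF Up; set L := lin2 _ _.
have key : F \o shift p = cst (F p) + L +o_ (0 : R * R) id.
  apply/eqaddoP => e e0.
  have e20 : 0 < e / 2 by rewrite divr_gt0.
  have cx := class_C_cont (class_C_px CF) Up.
  have cy := class_C_cont (class_C_py CF) Up.
  have /cvgrPdist_lt /(_ _ e20) /nbhs_ballP[d1 /= d10 h1] := cx.
  have /cvgrPdist_lt /(_ _ e20) /nbhs_ballP[d2 /= d20 h2] := cy.
  have [d3 d30 h3] := open_ball oU Up.
  pose d := Num.min d1 (Num.min d2 d3).
  have d0 : 0 < d by rewrite !lt_min d10 d20 d30.
  have sub q : `|q.1 - p.1| < d -> `|q.2 - p.2| < d ->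
     [/\ U q, `|partial_x F p - partial_x F q| < e / 2 &
         `|partial_y F p - partial_y F q| < e / 2].
    rewrite !lt_min => /and3P[a1 a2 a3] /and3P[b1 b2 b3]; split.
    - by apply/h3/ball_square.
    - by apply/h1/ball_square.
    - by apply/h2/ball_square.
  apply/nbhs_ballP; exists d => //= v /ball_square /=; rewrite !subr0 => -[v1 v2].
  have [x x1 Ex] : exists2 x, `|x - p.1| <= `|(v.1 + p.1) - p.1| &
      F (v.1 + p.1, v.2 + p.2) - F (p.1, v.2 + p.2) =
      partial_x F (x, v.2 + p.2) * (v.1 + p.1 - p.1).
    apply: (@MVT_between (fun t => F (t, v.2 + p.2)) (fun t => partial_x F (t, v.2 + p.2))).
    move=> t; rewrite addrK => tv.
    apply: (proj1 (slice_x _ (t, v.2 + p.2) _)); apply: class_C_dx CF _ _.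
    have /= [] // := sub (t, v.2 + p.2); first exact: le_lt_trans tv _.
    by rewrite addrK.
  have [y y1 Ey] : exists2 y, `|y - p.2| <= `|(v.2 + p.2) - p.2| &
      F (p.1, v.2 + p.2) - F (p.1, p.2) =
      partial_y F (p.1, y) * (v.2 + p.2 - p.2).
    apply: (@MVT_between (fun t => F (p.1, t)) (fun t => partial_y F (p.1, t))).
    move=> t; rewrite addrK => tv.
    apply: (proj1 (slice_y _ (p.1, t) _)); apply: class_C_dy CF _ _.
    have /= [] // := sub (p.1, t); first by rewrite subrr normr0.
    exact: le_lt_trans tv _.
  rewrite !addrK in x1 Ex y1 Ey.
  rewrite !fctE /=.
  rewrite (_ : F (v + p) - _ = (partial_x F (x, v.2 + p.2) - partial_x F p) * v.1
      + (partial_y F (p.1, y) - partial_y F p) * v.2); last first.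
    rewrite /L /lin2 !mulrBl -Ex -Ey -surjective_pairing.
    rewrite -[F (v + p)]/(F (v.1 + p.1, v.2 + p.2)); ring.
  have [_ bx _] := sub (x, v.2 + p.2) (le_lt_trans x1 v1)
    (eq_ind_r (fun z => `|z| < d) v2 (addrK _ _)).
  have [_ _ by_] := sub (p.1, y)
    (eq_ind_r (fun z => `|z| < d) (eq_ind_r (fun z => z < d) d0 (normr0 _)) (subrr _))
    (le_lt_trans y1 v2).
  have n1 : `|v.1| <= `|v| by rewrite prod_normE le_max lexx.
  have n2 : `|v.2| <= `|v| by rewrite prod_normE le_max lexx orbT.
  rewrite (le_trans (ler_normD _ _))// !normrM distrC [X in _ + X * _]distrC.
  rewrite (splitr e) mulrDl lerD// ler_pM// ltW//.
have dE : 'd F p = L :> (_ -> _).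
  by apply: diff_unique; [exact: lin2_continuous|exact: key].
split => //; apply/diff_locallyP; rewrite dE; split => //.
exact: lin2_continuous.
Qed.

Lemma is_derive_along (f : R * R -> R) p v (df : R * R -> R) : is_diff p f df -> is_derive p v f (df v).
Proof.
by move=> dfp; split; [exact: diff_derivable|rewrite deriveE// diff_val].
Qed.

Lemma chain_rule U F (a b : R * R -> R) q v (a' b' : R) : open U -> class_C 1 U F ->
  U (a q, b q) -> differentiable a q -> differentiable b q ->
  is_derive q v a a' -> is_derive q v b b' ->
  is_derive q v (fun s => F (a s, b s))
    (a' * partial_x F (a q, b q) + b' * partial_y F (a q, b q)).
Proof.
move=> oU CF Uq da db [_ <-] [_ <-].
have dF := C1_diff oU CF Uq.
have := is_derive_along v (is_diff_comp (is_diff_pair (differentiableP da) (differentiableP db)) dF).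
by rewrite /= /lin2/= -!deriveE// mulrC [X in _ + X]mulrC.
Qed.

Lemma pair_continuous (T : topologicalType) (a b : T -> R) (q : T) :
  {for q, continuous a} -> {for q, continuous b} ->
  {for q, continuous (fun s => (a s, b s))}.
Proof. by move=> ca cb; exact: (cvg_pair ca cb). Qed.

Lemma class_C_comp k U V F (a b : R * R -> R) : open U -> open V ->
  class_C k V F -> class_C k U a -> class_C k U b ->
  (forall q, U q -> V (a q, b q)) ->
  class_C k U (fun q => F (a q, b q)).
Proof.
move=> oU oV + + + UV; elim: k F => [|k IH] F CF Ca Cb.
  move=> p Up; apply: (@continuous_comp _ _ _ (fun q => (a q, b q)) F).
    by apply: pair_continuous; [exact: (Ca p Up)|exact: (Cb p Up)].
  exact: (class_C_cont CF (UV _ Up)).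
have Ca' := class_C_pred Ca; have Cb' := class_C_pred Cb.
have C1 G W : class_C k.+1 W G -> class_C 1 W G.
  by move=> CG; exact: (class_C_le (isT : (1 <= k.+1)%N) CG).
apply: (@class_CS _ k U _
  (fun q => partial_x a q * partial_x F (a q, b q) + partial_x b q * partial_y F (a q, b q))
  (fun q => partial_y a q * partial_x F (a q, b q) + partial_y b q * partial_y F (a q, b q)) oU)
   => [p Up|p Up||].
- apply: (@continuous_comp _ _ _ (fun q => (a q, b q)) F).
    by apply: pair_continuous; [exact: class_C_cont Ca _ Up|exact: class_C_cont Cb _ Up].
  exact: (class_C_cont CF (UV _ Up)).
- have [da _] := C1_diff oU (C1 _ _ Ca) Up.
  have [db _] := C1_diff oU (C1 _ _ Cb) Up.
  split; apply: (chain_rule oV (C1 _ _ CF) (UV _ Up) da db).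
  + exact: class_C_dx Ca _ Up.
  + exact: class_C_dx Cb _ Up.
  + exact: class_C_dy Ca _ Up.
  + exact: class_C_dy Cb _ Up.
- apply: (class_CD oU); apply: (class_CM oU).
  + exact: class_C_px Ca.
  + by apply: IH Ca' Cb'; exact: class_C_px CF.
  + exact: class_C_px Cb.
  + by apply: IH Ca' Cb'; exact: class_C_py CF.
- apply: (class_CD oU); apply: (class_CM oU).
  + exact: class_C_py Ca.
  + by apply: IH Ca' Cb'; exact: class_C_px CF.
  + exact: class_C_py Cb.
  + by apply: IH Ca' Cb'; exact: class_C_py CF.
Qed.

End ChainRule.

(** * Mixed derivatives and the second derivative test *)

Section Schwarz.
Variable R : realType.
Implicit Types (F : R * R -> R) (U : set (R * R)) (p : R * R).
Local Notation dx := (dir_x R).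
Local Notation dy := (dir_y R).

Lemma MVT_step (f df : R -> R) (a h : R) :
  (forall x, `|x - a| <= `|h| -> is_derive x 1 f (df x)) ->
  exists2 c, `|c - a| <= `|h| & f (a + h) - f a = df c * h.
Proof.
have E : a + h - a = h by ring.
by have := @MVT_between R f df a (a + h); rewrite E.
Qed.

(** The mean value theorem, applied in x and then in y to the mixed second difference.
    Applying it in the other order gives the other mixed derivative at another nearby point,
    and letting the step tend to 0 identifies the two in [Schwarz]. *)
Lemma second_difference_xy U F p (h : R) : class_C 2 U F ->
  (forall q, `|q.1 - p.1| <= `|h| -> `|q.2 - p.2| <= `|h| -> U q) ->
  exists q, [/\ `|q.1 - p.1| <= `|h|, `|q.2 - p.2| <= `|h| &
    F (p.1 + h, p.2 + h) - F (p.1 + h, p.2) - F (p.1, p.2 + h) + F (p.1, p.2) =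
    partial_y (partial_x F) q * h * h].
Proof.
move=> CF sub.
have [|x xp Ex] := @MVT_step (fun t => F (t, p.2 + h) - F (t, p.2))
  (fun t => partial_x F (t, p.2 + h) - partial_x F (t, p.2)) p.1 h.
  move=> t tp.
  apply: is_deriveB.
    apply: (proj1 (slice_x _ (t, p.2 + h) _)); apply: class_C_dx CF _ _.
    by apply: sub => //=; rewrite addrAC subrr add0r.
  apply: (proj1 (slice_x _ (t, p.2) _)); apply: class_C_dx CF _ _.
  by apply: sub => //=; rewrite subrr normr0.
have [|y yp Ey] := @MVT_step (fun t => partial_x F (x, t))
  (fun t => partial_y (partial_x F) (x, t)) p.2 h.
  move=> t tp.
  apply: (proj1 (slice_y _ (x, t) _)).
  by apply: class_C_dy (class_C_px CF) _ _; exact: sub.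
exists (x, y); split => //=.
by rewrite -Ey -Ex; ring.
Qed.

Lemma second_difference_yx U F p (h : R) : class_C 2 U F ->
  (forall q, `|q.1 - p.1| <= `|h| -> `|q.2 - p.2| <= `|h| -> U q) ->
  exists q, [/\ `|q.1 - p.1| <= `|h|, `|q.2 - p.2| <= `|h| &
    F (p.1 + h, p.2 + h) - F (p.1 + h, p.2) - F (p.1, p.2 + h) + F (p.1, p.2) =
    partial_x (partial_y F) q * h * h].
Proof.
move=> CF sub.
have [|y yp Ey] := @MVT_step (fun t => F (p.1 + h, t) - F (p.1, t))
  (fun t => partial_y F (p.1 + h, t) - partial_y F (p.1, t)) p.2 h.
  move=> t tp.
  apply: is_deriveB.
    apply: (proj1 (slice_y _ (p.1 + h, t) _)); apply: class_C_dy CF _ _.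
    by apply: sub => //=; rewrite addrAC subrr add0r.
  apply: (proj1 (slice_y _ (p.1, t) _)); apply: class_C_dy CF _ _.
  by apply: sub => //=; rewrite subrr normr0.
have [|x xp Ex] := @MVT_step (fun t => partial_y F (t, y))
  (fun t => partial_x (partial_y F) (t, y)) p.1 h.
  move=> t tp.
  apply: (proj1 (slice_x _ (t, y) _)).
  by apply: class_C_dx (class_C_py CF) _ _; exact: sub.
exists (x, y); split => //=.
by rewrite -Ex -Ey; ring.
Qed.

Lemma ler_dist_eps (a b : R) : (forall e, 0 < e -> `|a - b| <= e) -> a = b.
Proof.
move=> ab; apply/eqP; rewrite -subr_eq0 -normr_le0; apply/ler_addgt0Pr => e e0.
by rewrite add0r; exact: ab.
Qed.

Lemma Schwarz U F p : open U -> class_C 2 U F -> U p ->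
  partial_y (partial_x F) p = partial_x (partial_y F) p.
Proof.
move=> oU CF Up; apply: ler_dist_eps => e e0.
have e20 : 0 < e / 2 by rewrite divr_gt0.
have /cvgrPdist_lt /(_ _ e20) /nbhs_ballP[d1 /= d10 h1] :=
  class_C_cont (class_C_py (class_C_px CF)) Up.
have /cvgrPdist_lt /(_ _ e20) /nbhs_ballP[d2 /= d20 h2] :=
  class_C_cont (class_C_px (class_C_py CF)) Up.
have [d3 d30 h3] := open_ball oU Up.
pose d := Num.min d1 (Num.min d2 d3).
have d0 : 0 < d by rewrite !lt_min d10 d20 d30.
pose h := d / 2.
have h0 : 0 < h by rewrite divr_gt0.
have hd : `|h| < d by rewrite gtr0_norm// /h; lra.
have sub q : `|q.1 - p.1| <= `|h| -> `|q.2 - p.2| <= `|h| ->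
    [/\ ball p d1 q, ball p d2 q & U q].
  move=> /le_lt_trans/(_ hd) + /le_lt_trans/(_ hd).
  rewrite !lt_min => /and3P[a1 a2 a3] /and3P[b1 b2 b3].
  by split; [exact/ball_square|exact/ball_square|exact/h3/ball_square].
have subU q : `|q.1 - p.1| <= `|h| -> `|q.2 - p.2| <= `|h| -> U q.
  by move=> a b; have [] := sub q a b.
have [q [q1 q2 Eq]] := second_difference_xy CF subU.
have [r [r1 r2 Er]] := second_difference_yx CF subU.
have E : partial_y (partial_x F) q = partial_x (partial_y F) r.
  have := Er; rewrite Eq => /(mulIf (lt0r_neq0 h0)) /(mulIf (lt0r_neq0 h0)) ->//.
have [/h1/= b1 _ _] := sub q q1 q2.
have [_ /h2/= b2 _] := sub r r1 r2.
apply: le_trans (ler_distD (partial_x (partial_y F) r) _ _) _.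
rewrite (splitr e); apply: lerD; last by rewrite distrC; exact: (ltW b2).
by rewrite -{1}E; exact: (ltW b1).
Qed.

(** With a positive second derivative the first one, which vanishes at the maximum, would
    be positive just after it. *)
Lemma second_derivative_at_max (f df : R -> R) (ddf c e : R) : 0 < e ->
  (forall x, `|x - c| < e -> is_derive x 1 f (df x)) ->
  is_derive c 1 df ddf ->
  (forall x, `|x - c| < e -> f x <= f c) -> ddf <= 0.
Proof.
move=> e0 dfx ddfc fmax; rewrite leNgt; apply/negP => dd0.
have df0 : df c = 0.
  have near x : x \in `](c - e/2), (c + e/2)[ -> `|x - c| < e.
    by rewrite in_itv/= => /andP[a b]; rewrite ltr_norml; apply/andP; split; lra.
  have [_ <-] : is_derive c 1 f (df c) by apply: dfx; rewrite subrr normr0.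
  suff [_ ->] : is_derive c 1 f 0 by [].
  apply: (@derive1_at_max R f (c - e/2) (c + e/2) c).
  - lra.
  - by move=> t /near /dfx [].
  - by rewrite in_itv/=; apply/andP; split; lra.
  - by move=> t /near /fmax.
have [dfc ddfE] := ddfc.
have : h^-1 *: ((df \o shift c) (h *: 1) - df c) @[h --> 0^'] --> ddf.
  by rewrite -ddfE; exact: dfc.
move=> /cvgrPdist_lt /(_ _ dd0) /nbhs_ballP[d /= d0 hd].
pose m := Num.min d e / 2.
have m0 : 0 < m by rewrite divr_gt0// lt_min d0.
have mE : m * 2 = Num.min d e by rewrite /m divfK.
have [md me] : m < d /\ m < e.
  by split; rewrite (@lt_le_trans _ _ (m * 2))//; rewrite ?mE ?ge_min ?lexx ?orbT//; lra.
have pos x : c < x -> x <= c + m -> 0 < df x.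
  move=> cx xm; have xc0 : 0 < x - c by rewrite subr_gt0.
  have : ball 0 d (x - c) by rewrite /ball/= sub0r normrN gtr0_norm//; lra.
  move=> /hd /(_ (lt0r_neq0 xc0)); rewrite /= df0 subr0 /GRing.scale/= mulr1 subrK => H.
  have : 0 < (x - c)^-1 * df x by move: H; rewrite ltr_norml => /andP[_]; lra.
  by rewrite pmulr_rgt0// invr_gt0.
have [|||x] := @MVT R f df c (c + m).
- by lra.
- by move=> x; rewrite in_itv/= => /andP[a b]; apply: dfx; rewrite ltr_norml; apply/andP; split; lra.
- apply: continuous_in_subspaceT => x; rewrite inE/= in_itv/= => /andP[a b].
  apply: differentiable_continuous; apply/derivable1_diffP.
  have [|//] := dfx x.
  by rewrite ltr_norml; apply/andP; split; lra.
rewrite in_itv/= => /andP[a b] E.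
have cm : `|c + m - c| < e by rewrite addrAC subrr add0r gtr0_norm.
have := fmax (c + m) cm; rewrite -subr_le0 E leNgt => /negP; apply.
by rewrite mulr_gt0//; [apply: pos => //; exact: ltW|lra].
Qed.

End Schwarz.

(** * The Laplacian and the Cauchy-Riemann equations *)

Section LaplacianRules.
Variable R : realType.
Implicit Types (F G : R * R -> R) (U : set (R * R)) (p q : R * R).
Local Notation dx := (dir_x R).
Local Notation dy := (dir_y R).

Lemma partial_xE F p d : is_derive p dx F d -> partial_x F p = d.
Proof. by case. Qed.

Lemma partial_yE F p d : is_derive p dy F d -> partial_y F p = d.
Proof. by case. Qed.

Lemma partial_x_ext U F G p : open U -> U p -> (forall q, U q -> F q = G q) ->
  partial_x F p = partial_x G p.
Proof. by move=> oU Up FG; exact: derive_ext_open oU Up FG. Qed.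

Lemma partial_y_ext U F G p : open U -> U p -> (forall q, U q -> F q = G q) ->
  partial_y F p = partial_y G p.
Proof. by move=> oU Up FG; exact: derive_ext_open oU Up FG. Qed.

#[local] Transparent derive.

Lemma partial_x_tr v F p :
  partial_x (fun q => F (q.1 + v.1, q.2 + v.2)) p = partial_x F (p.1 + v.1, p.2 + v.2).
Proof.
rewrite /partial_x /derive.
set g1 := fun h => _; set g2 := fun h => _; suff -> : g1 = g2 by [].
apply/funext => h; rewrite /g1 /g2 /=.
congr (_ *: (F _ - _)).
by apply: injective_projections; rewrite /= addrA.
Qed.

Lemma partial_y_tr v F p :
  partial_y (fun q => F (q.1 + v.1, q.2 + v.2)) p = partial_y F (p.1 + v.1, p.2 + v.2).
Proof.
rewrite /partial_y /derive.
set g1 := fun h => _; set g2 := fun h => _; suff -> : g1 = g2 by [].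
apply/funext => h; rewrite /g1 /g2 /=.
congr (_ *: (F _ - _)).
by apply: injective_projections; rewrite /= addrA.
Qed.

#[local] Opaque derive.
#[local] Opaque partial_x partial_y.

Lemma laplacian_ext U F G p : open U -> U p -> (forall q, U q -> F q = G q) ->
  laplacian F p = laplacian G p.
Proof.
move=> oU Up FG; rewrite /laplacian (@partial_x_ext U _ (partial_x G) p oU Up).
  rewrite (@partial_y_ext U _ (partial_y G) p oU Up) // => q Uq.
  exact: partial_y_ext oU Uq FG.
by move=> q Uq; exact: partial_x_ext oU Uq FG.
Qed.

(** Formulas for the first derivatives near [p] reduce the Laplacian to two derivatives at
    [p]. *)
Lemma laplacian_eq U F Fx Fy p a b : open U -> U p ->
  (forall q, U q -> is_derive q dx F (Fx q) /\ is_derive q dy F (Fy q)) ->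
  is_derive p dx Fx a /\ is_derive p dy Fy b -> laplacian F p = a + b.
Proof.
move=> oU Up dF [da db]; rewrite /laplacian (@partial_x_ext U _ Fx p oU Up).
  rewrite (@partial_y_ext U _ Fy p oU Up) ?(partial_xE da) ?(partial_yE db)// => q Uq.
  by apply: partial_yE; have [] := dF q Uq.
by move=> q Uq; apply: partial_xE; have [] := dF q Uq.
Qed.

Lemma laplacianD U F G p : open U -> U p -> class_C 2 U F -> class_C 2 U G ->
  laplacian (fun q => F q + G q) p = laplacian F p + laplacian G p.
Proof.
move=> oU Up CF CG.
rewrite [RHS]addrACA.
apply: (@laplacian_eq U _ (fun q => partial_x F q + partial_x G q)
  (fun q => partial_y F q + partial_y G q) p _ _ oU Up).
- move=> q Uq; split; apply: is_deriveD; [exact: class_C_dx CF _ Uq|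
    exact: class_C_dx CG _ Uq|exact: class_C_dy CF _ Uq|exact: class_C_dy CG _ Uq].
- split; apply: is_deriveD; [exact: class_C_dx (class_C_px CF) _ Up|
    exact: class_C_dx (class_C_px CG) _ Up|exact: class_C_dy (class_C_py CF) _ Up|
    exact: class_C_dy (class_C_py CG) _ Up].
Qed.

Lemma laplacianM U F G p : open U -> U p -> class_C 2 U F -> class_C 2 U G ->
  laplacian (fun q => F q * G q) p = laplacian F p * G p +
    2 * (partial_x F p * partial_x G p + partial_y F p * partial_y G p) +
    F p * laplacian G p.
Proof.
move=> oU Up CF CG.
transitivity ((partial_x (partial_x F) p * G p + partial_x F p * partial_x G p +
   (partial_x F p * partial_x G p + F p * partial_x (partial_x G) p)) +
  (partial_y (partial_y F) p * G p + partial_y F p * partial_y G p +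
   (partial_y F p * partial_y G p + F p * partial_y (partial_y G) p))); last first.
  rewrite /laplacian.
  move: (partial_x (partial_x F) p) (partial_x (partial_x G) p)
    (partial_y (partial_y F) p) (partial_y (partial_y G) p).
  move: (partial_x F p) (partial_x G p) (partial_y F p) (partial_y G p).
  by move: (F p) (G p) => *; ring.
apply: (@laplacian_eq U _ (fun q => partial_x F q * G q + F q * partial_x G q)
  (fun q => partial_y F q * G q + F q * partial_y G q) p _ _ oU Up).
- move=> q Uq; split; apply: is_derivePM; [exact: class_C_dx CF _ Uq|
    exact: class_C_dx CG _ Uq|exact: class_C_dy CF _ Uq|exact: class_C_dy CG _ Uq].
- split; apply: is_deriveD; apply: is_derivePM.
  + exact: class_C_dx (class_C_px CF) _ Up.
  + exact: class_C_dx CG _ Up.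
  + exact: class_C_dx CF _ Up.
  + exact: class_C_dx (class_C_px CG) _ Up.
  + exact: class_C_dy (class_C_py CF) _ Up.
  + exact: class_C_dy CG _ Up.
  + exact: class_C_dy CF _ Up.
  + exact: class_C_dy (class_C_py CG) _ Up.
Qed.

Lemma partial_cst c p : partial_x (fun=> c : R) p = 0 /\ partial_y (fun=> c : R) p = 0.
Proof. by split; [apply: partial_xE|apply: partial_yE]; exact: is_derive_cst. Qed.

Lemma laplacian_cst c p : laplacian (fun=> c : R) p = 0.
Proof.
rewrite -[RHS](addr0 0).
apply: (@laplacian_eq setT _ (fun=> 0) (fun=> 0) p 0 0 openT I).
- by move=> q _; split; exact: is_derive_cst.
- by split; exact: is_derive_cst.
Qed.

Lemma laplacianZ U F c p : open U -> U p -> class_C 2 U F ->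
  laplacian (fun q => c * F q) p = c * laplacian F p.
Proof.
move=> oU Up CF; rewrite (laplacianM oU Up (class_C_cst _ _ oU) CF).
have [-> ->] := partial_cst c p.
by rewrite laplacian_cst !mul0r addr0 mulr0 !add0r.
Qed.

Lemma laplacianB U F G p : open U -> U p -> class_C 2 U F -> class_C 2 U G ->
  laplacian (fun q => F q - G q) p = laplacian F p - laplacian G p.
Proof.
move=> oU Up CF CG; rewrite (laplacianD oU Up CF (class_CN oU CG)).
have -> : (fun q => - G q) = (fun q => -1 * G q).
  by apply/funext => q; rewrite mulN1r.
by rewrite (laplacianZ _ oU Up CG) mulN1r.
Qed.

Lemma class_C_laplacian k U F : open U -> class_C k.+2 U F ->
  class_C k U (laplacian F).
Proof.
move=> oU CF; apply: (class_CD oU).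
  exact: class_C_px (class_C_px CF).
exact: class_C_py (class_C_py CF).
Qed.

(** The domain of the translate q |-> F (q + v) of a function defined on [U]. *)
Definition translate (v : R * R) (U : set (R * R)) : set (R * R) :=
  [set q | U (q.1 + v.1, q.2 + v.2)].

Lemma tr_continuous v : continuous (fun q : R * R => (q.1 + v.1, q.2 + v.2)).
Proof.
move=> q; apply: (@pair_continuous R _ (fun q : R * R => q.1 + v.1) (fun q : R * R => q.2 + v.2) q).
  by apply: continuousD; [exact: cvg_fst|exact: cst_continuous].
by apply: continuousD; [exact: cvg_snd|exact: cst_continuous].
Qed.

Lemma open_tr v U : open U -> open (translate v U).
Proof.
by move=> oU; have /continuousP := @tr_continuous v; apply.
Qed.

Lemma laplacian_tr v F p :
  laplacian (fun q => F (q.1 + v.1, q.2 + v.2)) p = laplacian F (p.1 + v.1, p.2 + v.2).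
Proof.
rewrite /laplacian -partial_x_tr -partial_y_tr.
have -> : partial_x (fun q => F (q.1 + v.1, q.2 + v.2)) =
    (fun q => partial_x F (q.1 + v.1, q.2 + v.2)).
  by apply/funext => q; rewrite partial_x_tr.
have -> // : partial_y (fun q => F (q.1 + v.1, q.2 + v.2)) =
    (fun q => partial_y F (q.1 + v.1, q.2 + v.2)).
by apply/funext => q; rewrite partial_y_tr.
Qed.

Lemma class_C_tr k v U F : open U -> class_C k U F ->
  class_C k (translate v U) (fun q => F (q.1 + v.1, q.2 + v.2)).
Proof.
move=> oU CF; have oV := @open_tr v U oU.
apply: (class_C_comp oV oU CF) => //.
  by apply: (class_CD oV); [exact: class_C_fst|exact: class_C_cst].
by apply: (class_CD oV); [exact: class_C_snd|exact: class_C_cst].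
Qed.

(** The Cauchy-Riemann equations of A + i B. *)
Definition CR U (A B : R * R -> R) := forall q, U q ->
  partial_x A q = partial_y B q /\ partial_y A q = - partial_x B q.

Lemma CR_harmonic U A B p : open U -> class_C 2 U A -> class_C 2 U B ->
  CR U A B -> U p -> laplacian A p = 0 /\ laplacian B p = 0.
Proof.
move=> oU CA CB cr Up; have dN F v d q : is_derive q v F d -> is_derive q v (fun r => - F r) (- d).
  by move=> dF; exact: is_deriveN.
split.
  rewrite /laplacian (@partial_x_ext U _ (partial_y B) p oU Up); last first.
    by move=> q /cr [].
  rewrite (@partial_y_ext U _ (fun q => - partial_x B q) p oU Up); last first.
    by move=> q /cr [].
  have -> := partial_yE (dN _ _ _ _ (class_C_dy (class_C_px CB) Up)).
  by rewrite (Schwarz oU CB Up) subrr.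
rewrite /laplacian (@partial_y_ext U _ (partial_x A) p oU Up); last first.
  by move=> q /cr [].
rewrite (@partial_x_ext U _ (fun q => - partial_y A q) p oU Up); last first.
  by move=> q /cr [_ ->]; rewrite opprK.
have -> := partial_xE (dN _ _ _ _ (class_C_dx (class_C_py CA) Up)).
by rewrite (Schwarz oU CA Up) addNr.
Qed.

Lemma MVT_x U F q (h : R) : class_C 1 U F ->
  (forall t, `|t - q.1| <= `|h| -> U (t, q.2)) ->
  exists2 t, `|t - q.1| <= `|h| & F (q.1 + h, q.2) - F q = partial_x F (t, q.2) * h.
Proof.
move=> CF sub.
have [|t tq E] := @MVT_step _ (fun t => F (t, q.2)) (fun t => partial_x F (t, q.2)) q.1 h.
  by move=> t tq; apply: (proj1 (slice_x _ (t, q.2) _)); exact: class_C_dx CF _ (sub _ tq).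
by exists t => //; rewrite -E -surjective_pairing.
Qed.

Lemma MVT_y U F q (h : R) : class_C 1 U F ->
  (forall t, `|t - q.2| <= `|h| -> U (q.1, t)) ->
  exists2 t, `|t - q.2| <= `|h| & F (q.1, q.2 + h) - F q = partial_y F (q.1, t) * h.
Proof.
move=> CF sub.
have [|t tq E] := @MVT_step _ (fun t => F (q.1, t)) (fun t => partial_y F (q.1, t)) q.2 h.
  by move=> t tq; apply: (proj1 (slice_y _ (q.1, t) _)); exact: class_C_dy CF _ (sub _ tq).
by exists t => //; rewrite -E -surjective_pairing.
Qed.

End LaplacianRules.

(** * A maximum principle for weighted gradients *)

Section WeightedMaximum.
Variable R : realType.
Implicit Types (F G : R * R -> R) (U : set (R * R)) (p q v : R * R).
Local Notation dx := (dir_x R).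
Local Notation dy := (dir_y R).

Definition incr F v q : R := F (q.1 + v.1, q.2 + v.2) - F q.

Lemma class_C_incr k U W v F : open U -> open W -> W `<=` U -> W `<=` translate v U ->
  class_C k U F -> class_C k W (incr F v).
Proof.
move=> oU oW WU WV CF; apply: (class_CB oW); last exact: class_C_sub WU CF.
exact: class_C_sub WV (@class_C_tr _ _ v _ _ oU CF).
Qed.

Lemma incr_partial k U v F q : class_C k.+1 U F -> open U -> U q -> translate v U q ->
  partial_x (incr F v) q = incr (partial_x F) v q /\
  partial_y (incr F v) q = incr (partial_y F) v q.
Proof.
move=> CF oU Uq Vq; have oV := @open_tr _ v _ oU.
have CV := @class_C_tr _ _ v _ _ oU CF.
split; [apply: partial_xE; rewrite /incr -partial_x_tr|
        apply: partial_yE; rewrite /incr -partial_y_tr];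
  apply: is_deriveB.
- exact: class_C_dx CV _ Vq.
- exact: class_C_dx CF _ Uq.
- exact: class_C_dy CV _ Vq.
- exact: class_C_dy CF _ Uq.
Qed.

Lemma laplacian_incr U W v F q : class_C 2 U F -> open U -> open W ->
  W `<=` U -> W `<=` translate v U -> W q -> laplacian (incr F v) q = incr (laplacian F) v q.
Proof.
move=> CF oU oW WU WV Wq; rewrite /incr -laplacian_tr; apply: (laplacianB oW Wq).
  exact: class_C_sub WV (@class_C_tr _ _ v _ _ oU CF).
exact: class_C_sub WU CF.
Qed.

(** If A + i B is holomorphic and u harmonic, A u_x + B u_y is the real part of the
    holomorphic function (A + i B) (u_x - i u_y).  A priori it is only of class C^1 for u
    of class C^2, so the derivatives of u are replaced by difference quotients with step h. *)
Definition wdiff A B u h : R * R -> R := fun r =>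
  A r * (h^-1 * incr u (h, 0) r) + B r * (h^-1 * incr u (0, h) r).

(** A, B and the increments of u are harmonic, so only the products of gradients are left.
    By the Cauchy-Riemann equations these combine into difference quotients of u_xx + u_yy and
    of u_xy - u_yx, which tend to 0 with h. *)
Lemma laplacian_weighted U W A B u h q : open U -> open W ->
  W `<=` U -> W `<=` translate (h, 0) U -> W `<=` translate (0, h) U -> W q ->
  class_C 2 U A -> class_C 2 U B -> CR U A B ->
  class_C 2 U u -> (forall r, U r -> laplacian u r = 0) ->
  laplacian (wdiff A B u h) q =
  2 * (partial_x A q * (h^-1 * incr (partial_x u) (h, 0) q + h^-1 * incr (partial_y u) (0, h) q)
     + partial_y A q * (h^-1 * incr (partial_y u) (h, 0) q - h^-1 * incr (partial_x u) (0, h) q)).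
Proof.
move=> oU oW WU W1 W2 Wq CA CB cr Cu harm.
have CA' := class_C_sub WU CA; have CB' := class_C_sub WU CB.
have C1 := class_C_incr oU oW WU W1 Cu; have C2 := class_C_incr oU oW WU W2 Cu.
have Z1 := class_CZ h^-1 oW C1; have Z2 := class_CZ h^-1 oW C2.
have Uq := WU _ Wq.
rewrite (laplacianD oW Wq (class_CM oW CA' Z1) (class_CM oW CB' Z2)).
rewrite (laplacianM oW Wq CA' Z1) (laplacianM oW Wq CB' Z2).
rewrite (laplacianZ _ oW Wq C1) (laplacianZ _ oW Wq C2).
rewrite (laplacian_incr Cu oU oW WU W1 Wq) (laplacian_incr Cu oU oW WU W2 Wq).
have [lA lB] := CR_harmonic oU CA CB cr Uq.
have [EA EB] := cr q Uq.
have i1 : incr (laplacian u) (h, 0) q = 0.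
  by rewrite /incr !harm ?subrr//; exact: W1.
have i2 : incr (laplacian u) (0, h) q = 0.
  by rewrite /incr !harm ?subrr//; exact: W2.
have zx v : W `<=` translate v U ->
  partial_x (fun r => h^-1 * incr u v r) q = h^-1 * incr (partial_x u) v q.
  move=> WV; rewrite -(proj1 (incr_partial Cu oU Uq (WV _ Wq))).
  apply: partial_xE; have := is_derivePM (is_derive_cst (h^-1) q dx)
    (class_C_dx (class_C_incr oU oW WU WV Cu) Wq).
  by rewrite /cst mul0r add0r.
have zy v : W `<=` translate v U ->
  partial_y (fun r => h^-1 * incr u v r) q = h^-1 * incr (partial_y u) v q.
  move=> WV; rewrite -(proj2 (incr_partial Cu oU Uq (WV _ Wq))).
  apply: partial_yE; have := is_derivePM (is_derive_cst (h^-1) q dy)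
    (class_C_dy (class_C_incr oU oW WU WV Cu) Wq).
  by rewrite /cst mul0r add0r.
rewrite (zx _ W1) (zx _ W2) (zy _ W1) (zy _ W2) lA lB i1 i2 -EA.
have {EB} -> : partial_x B q = - partial_y A q by rewrite EB opprK.
move: (incr (partial_x u) (h, 0) q) (incr (partial_y u) (h, 0) q)
  (incr (partial_x u) (0, h) q) (incr (partial_y u) (0, h) q).
by move: (partial_x A q) (partial_y A q) (incr u (h, 0) q) (incr u (0, h) q) (A q) (B q) => *; ring.
Qed.

(** Heine-Borel turns local steps into a common one. *)
Lemma uniform_step (K : set (R * R)) (P : R -> R * R -> Prop) : compact K ->
  (forall p, K p -> exists2 d : R, 0 < d & forall h q, 0 < h -> h < d -> ball p d q -> P h q) ->
  exists2 h : R, 0 < h & forall q, K q -> P h q.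
Proof.
move=> /compact_near_coveringP cK loc.
have : \forall h \near (0 : R)^'+, K `<=` P h.
  apply: cK => p /loc[d d0 Pd].
  exists (ball p d, [set h | 0 < h /\ h < d]) => /=.
    split; first exact: nbhsx_ballx.
    near=> h; split; near: h; [exact: nbhs_right_gt|exact: nbhs_right_lt].
  by move=> [q h] /= [qd [h0 hd]]; exact: Pd.
move=> near0.
have [h [h0 hK]] : exists h : R, 0 < h /\ K `<=` P h.
  apply: (@filter_ex _ (0 : R)^'+ _ (fun h => 0 < h /\ K `<=` P h)).
  near=> h; split; last by near: h.
  by near: h; exact: nbhs_right_gt.
by exists h => // q /hK.
Unshelve. all: by end_near. Qed.

Lemma ler_norm_comb (a b x y N t : R) : `|a| <= N -> `|b| <= N ->
  `|x| <= t -> `|y| <= t -> `|a * x + b * y| <= 2 * (N * t).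
Proof.
move=> aN bN xt yt; apply: le_trans (ler_normD _ _) _.
by rewrite !normrM mulrDl mul1r; apply: lerD; apply: ler_pM.
Qed.

Lemma sum_osc (a b c d e : R) : a + b = 0 -> `|a - c| < e -> `|b - d| < e ->
  `|c + d| <= e + e.
Proof.
move=> ab ac bd; have -> : c + d = - (a - c) + - (b - d) by lra.
by rewrite (le_trans (ler_normD _ _))// !normrN lerD// ltW.
Qed.

Lemma weighted_bound (x y a b c d a' b' c' d' N t e : R) :
  0 < e -> N * (t + t) = e / 8 -> `|x| <= N -> `|y| <= N ->
  a = a' -> b = b' -> c = c' -> d = d' ->
  `|a' + b'| <= t + t -> `|c' - d'| <= t + t ->
  `|2 * (x * (a + b) + y * (c - d))| < e.
Proof.
move=> e0 eE xN yN -> -> -> -> ab cd; rewrite normrM ger0_norm//.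
by have := ler_norm_comb xN yN ab cd; rewrite eE; move: `|_ + _| => z; lra.
Qed.

(** Everything is expressed by increments of the derivatives of u, which the mean value
    theorem compares with the second derivatives of u at nearby points. *)
Lemma weighted_step D A B u p e : open D -> D p ->
  class_C 2 D A -> class_C 2 D B -> CR D A B ->
  class_C 2 D u -> (forall r, D r -> laplacian u r = 0) -> 0 < e ->
  exists2 d : R, 0 < d & forall h q, 0 < h -> h < d -> ball p d q ->
   [/\ translate (h, 0) D q, translate (0, h) D q,
     `|wdiff A B u h q - (A q * partial_x u q + B q * partial_y u q)| < e &
     `|laplacian (wdiff A B u h) q| < e].
Proof.
move=> oD Dp CA CB cr Cu harm e0.
pose N := 1 + `|A p| + `|B p| + `|partial_x A p| + `|partial_y A p|.
have N0 : 0 < N.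
  by rewrite /N -!addrA ltr_wpDr// !addr_ge0.
pose eta := e / (16 * N).
have eta0 : 0 < eta by rewrite divr_gt0// mulr_gt0.
have CA1 := class_C_pred CA; have CB1 := class_C_pred CB; have Cu1 := class_C_pred Cu.
have ux := class_C_cont (class_C_px Cu) Dp.
have uy := class_C_cont (class_C_py Cu) Dp.
have uxx := class_C_cont (class_C_px (class_C_px Cu)) Dp.
have uyx := class_C_cont (class_C_px (class_C_py Cu)) Dp.
have uxy := class_C_cont (class_C_py (class_C_px Cu)) Dp.
have uyy := class_C_cont (class_C_py (class_C_py Cu)) Dp.
have cA := class_C_cont CA Dp; have cB := class_C_cont CB Dp.
have cAx := class_C_cont (class_C_px CA) Dp.
have cAy := class_C_cont (class_C_py CA) Dp.
pose small F q := `|F p - F q| < eta.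
pose small1 F q := `|F p - F q| < 1.
have nS F e' : 0 < e' -> {for p, continuous F} -> nbhs p [set q | `|F p - F q| < e'].
  by move=> e'0 /cvgrPdist_lt /(_ _ e'0).
have nD : nbhs p D by apply: open_nbhs_nbhs.
have fI X Y : nbhs p X -> nbhs p Y -> nbhs p (X `&` Y) by move=> *; exact: filterI.
have nall := fI _ _ nD (fI _ _ (fI _ _ (fI _ _ (nS _ _ eta0 ux) (nS _ _ eta0 uy))
  (fI _ _ (nS _ _ eta0 uxx) (nS _ _ eta0 uyx)))
  (fI _ _ (fI _ _ (nS _ _ eta0 uxy) (nS _ _ eta0 uyy))
  (fI _ _ (fI _ _ (nS _ _ ltr01 cA) (nS _ _ ltr01 cB))
   (fI _ _ (nS _ _ ltr01 cAx) (nS _ _ ltr01 cAy))))).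
have /nbhs_ballP[d0 /= d00 near1] := nall.
have near0 q : ball p d0 q -> [/\ D q, [/\ small (partial_x u) q, small (partial_y u) q,
   small (partial_x (partial_x u)) q & small (partial_x (partial_y u)) q],
   [/\ small (partial_y (partial_x u)) q & small (partial_y (partial_y u)) q] &
   [/\ small1 A q, small1 B q, small1 (partial_x A) q & small1 (partial_y A) q]].
  move=> /near1[n0 [[[n1 n2] [n3 n4]] [[n5 n6] [[n7 n8] [n9 n10]]]]].
  exact: (And4 n0 (And4 n1 n2 n3 n4) (conj n5 n6) (And4 n7 n8 n9 n10)).
exists (d0 / 2); first by rewrite divr_gt0.
move=> h q h0 hd qd; set P := wdiff A B u h.
have d2 : d0 / 2 + d0 / 2 = d0 by rewrite -splitr.
have hp : `|h| = h by rewrite gtr0_norm.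
have inx t : `|t - q.1| <= `|h| -> ball p d0 (t, q.2).
  move=> th; move/ball_square: qd => [q1 q2]; apply/ball_square => /=; split; last by lra.
  rewrite -d2 (le_lt_trans (ler_distD q.1 _ _))// ler_ltD//.
  by rewrite (le_trans th)// hp ltW.
have iny t : `|t - q.2| <= `|h| -> ball p d0 (q.1, t).
  move=> th; move/ball_square: qd => [q1 q2]; apply/ball_square => /=; split; first by lra.
  rewrite -d2 (le_lt_trans (ler_distD q.2 _ _))// ler_ltD//.
  by rewrite (le_trans th)// hp ltW.
have inq : ball p d0 q.
  by have := inx q.1; rewrite subrr normr0 normr_ge0 -surjective_pairing; apply.
have Dx t : `|t - q.1| <= `|h| -> D (t, q.2) by move=> /inx /near0 [].
have Dy t : `|t - q.2| <= `|h| -> D (q.1, t) by move=> /iny /near0 [].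
have Dq : D q by have [] := near0 q inq.
have hinv : h * h^-1 = 1 by rewrite divff// gt_eqF.
have qx F : class_C 1 D F -> exists2 r, ball p d0 r & h^-1 * incr F (h, 0) q = partial_x F r.
  move=> CF; have [t tq E] := MVT_x CF Dx; exists (t, q.2); first exact: inx.
  by rewrite /incr /= addr0 E mulrC -mulrA hinv mulr1.
have qy F : class_C 1 D F -> exists2 r, ball p d0 r & h^-1 * incr F (0, h) q = partial_y F r.
  move=> CF; have [t tq E] := MVT_y CF Dy; exists (q.1, t); first exact: iny.
  by rewrite /incr /= addr0 E mulrC -mulrA hinv mulr1.
have T1 : translate (h, 0) D q.
  by rewrite /translate /= addr0; apply: Dx; rewrite addrAC subrr add0r.
have T2 : translate (0, h) D q.
  by rewrite /translate /= addr0; apply: Dy; rewrite addrAC subrr add0r.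
have [_ [sx sy sxx syx] [sxy syy] [sA sB sAx sAy]] := near0 q inq.
have bnd F : small1 F q -> `|F q| <= `|F p| + 1.
  move=> sF; rewrite -[F q](subrK (F p)) addrC (le_trans (ler_normD _ _))//.
  by rewrite lerD2l distrC ltW.
have [lA lB lAx lAy] : [/\ `|A p| + 1 <= N, `|B p| + 1 <= N,
    `|partial_x A p| + 1 <= N & `|partial_y A p| + 1 <= N].
  rewrite /N; move: (normr_ge0 (A p)) (normr_ge0 (B p)) (normr_ge0 (partial_x A p))
    (normr_ge0 (partial_y A p)).
  move: `|A p| `|B p| `|partial_x A p| `|partial_y A p|; clear.
  by move=> *; split; lra.
have bA := le_trans (bnd _ sA) lA; have bB := le_trans (bnd _ sB) lB.
have bAx := le_trans (bnd _ sAx) lAx; have bAy := le_trans (bnd _ sAy) lAy.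
have eE : N * (eta + eta) = e / 8.
  by rewrite /eta; field; rewrite gt_eqF.
have osc (a b c : R) : `|a - b| < eta -> `|a - c| < eta -> `|b - c| <= eta + eta.
  by move=> ab ac; rewrite (le_trans (ler_distD a _ _))// lerD ?(ltW ac)// distrC ltW.
split; [exact: T1|exact: T2| |].
- have [r1 rb1 E1] := qx _ Cu1; have [r2 rb2 E2] := qy _ Cu1.
  have [_ [s1 _ _ _] _ _] := near0 _ rb1.
  have [_ [_ s2 _ _] _ _] := near0 _ rb2.
  have -> : P q - (A q * partial_x u q + B q * partial_y u q) =
    A q * (partial_x u r1 - partial_x u q) + B q * (partial_y u r2 - partial_y u q).
    by rewrite /P /wdiff E1 E2 opprD addrACA -!mulrBr.
  apply: le_lt_trans (ler_norm_comb bA bB (osc _ _ _ s1 sx) (osc _ _ _ s2 sy)) _.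
  by rewrite eE; move: e0; clear; lra.
- pose W := D `&` (translate (h, 0) D `&` translate (0, h) D).
  have oW : open W by apply: openI => //; apply: openI; exact: open_tr.
  have WD : W `<=` D by move=> r [].
  have W1 : W `<=` translate (h, 0) D by move=> r [_ []].
  have W2 : W `<=` translate (0, h) D by move=> r [_ []].
  have Wq : W q by split; [exact: Dq|split; [exact: T1|exact: T2]].
  rewrite /P (laplacian_weighted oD oW WD W1 W2 Wq CA CB cr Cu harm).
  have [r1 rb1 E1] := qx _ (class_C_px Cu); have [r2 rb2 E2] := qy _ (class_C_py Cu).
  have [r3 rb3 E3] := qx _ (class_C_py Cu); have [r4 rb4 E4] := qy _ (class_C_px Cu).
  have [_ [_ _ s1 _] _ _] := near0 _ rb1.
  have [_ _ [_ s2] _] := near0 _ rb2.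
  have [_ [_ _ _ s3] _ _] := near0 _ rb3.
  have [_ _ [s4 _] _] := near0 _ rb4.
  have i1 : `|partial_x (partial_x u) r1 + partial_y (partial_y u) r2| <= eta + eta.
    exact: (sum_osc (harm p Dp) s1 s2).
  have i2 : `|partial_x (partial_y u) r3 - partial_y (partial_x u) r4| <= eta + eta.
    have e3 : `|partial_y (partial_x u) p - partial_x (partial_y u) r3| < eta.
      rewrite (Schwarz oD Cu Dp); exact: s3.
    exact: osc e3 s4.
  exact: (weighted_bound e0 eE bAx bAy E1 E2 E3 E4 i1 i2).
Unshelve. all: by end_near. Qed.

(** An interior maximum of [wdiff] plus a small multiple of x^2 is impossible for a small
    step: the Laplacian of [wdiff] is close to 0 and that of the added term is positive. *)
Lemma weighted_maximum D (K : set (R * R)) A B u M : open D -> compact K -> K `<=` D ->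
  class_C 2 D A -> class_C 2 D B -> CR D A B ->
  class_C 2 D u -> (forall r, D r -> laplacian u r = 0) ->
  (forall p, K p -> ~ nbhs p K -> A p * partial_x u p + B p * partial_y u p <= M) ->
  forall p, K p -> A p * partial_x u p + B p * partial_y u p <= M.
Proof.
move=> oD cK KD CA CB cr Cu harm bd p0 Kp0; rewrite leNgt; apply/negP.
set W := fun p => A p * partial_x u p + B p * partial_y u p => WM.
have [c c0 cE] : exists2 c, 0 < c & W p0 = M + c.
  by exists (W p0 - M); [rewrite subr_gt0|rewrite addrC subrK].
have [b b0 Kb] : exists2 b : R, 0 < b & forall p, K p -> p.1 ^+ 2 <= b.
  have cq : continuous (fun p : R * R => p.1 ^+ 2).
    move=> p; apply: (@continuous_comp _ _ _ (fun q : R * R => q.1) (fun x => x ^+ 2)).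
      exact: cvg_fst.
    exact: exprn_continuous.
  have [||m mK mmax] := @compact_EVT_max _ R (fun p : R * R => p.1 ^+ 2) K _ cK.
  - by exists p0.
  - exact: continuous_subspaceT.
  exists (m.1 ^+ 2 + 1); first by rewrite ltr_wpDl// sqr_ge0.
  by move=> p Kp; rewrite (le_trans (mmax p _)) ?inE// lerDl.
pose eps := c / (8 * b); have eps0 : 0 < eps by rewrite divr_gt0// mulr_gt0.
have epsb p : K p -> eps * p.1 ^+ 2 <= c / 8.
  move=> Kp; have -> : c / 8 = eps * b by rewrite /eps; field; rewrite gt_eqF.
  by rewrite ler_pM2l//; exact: Kb.
pose e := Num.min (c / 8) eps.
have e0 : 0 < e by rewrite lt_min eps0 divr_gt0.
have [h h0 hK] := uniform_step cK (fun p Kp => weighted_step oD (KD p Kp) CA CB cr Cu harm e0).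
pose P := wdiff A B u h.
pose Q := fun r : R * R => P r + eps * (r.1 * r.1).
pose V := D `&` (translate (h, 0) D `&` translate (0, h) D).
have oV : open V by apply: openI => //; apply: openI; exact: open_tr.
have KV : K `<=` V.
  by move=> p Kp; have [t1 t2 _ _] := hK p Kp; split; [exact: KD|].
have [VD [V1 V2]] : V `<=` D /\ V `<=` translate (h, 0) D /\ V `<=` translate (0, h) D.
  by split; [|split]; move=> r [? []].
have CP : class_C 2 V P.
  apply: (class_CD oV); apply: (class_CM oV).
  - exact: class_C_sub VD CA.
  - by apply: (class_CZ _ oV); exact: class_C_incr oD oV VD V1 Cu.
  - exact: class_C_sub VD CB.
  - by apply: (class_CZ _ oV); exact: class_C_incr oD oV VD V2 Cu.
have Cf k : class_C k V (fun r : R * R => r.1) := class_C_fst k oV.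
have CQ : class_C 2 V Q.
  apply: (class_CD oV); first exact: CP.
  by apply: (class_CZ _ oV); exact: (class_CM oV (Cf 2) (Cf 2)).
have [||m mK mmax] := @compact_EVT_max _ R Q K _ cK.
- by exists p0.
- apply: continuous_in_subspaceT => p; rewrite inE => /KV Vp.
  exact: class_C_cont CQ _ Vp.
rewrite inE in mK.
have PW p : K p -> `|P p - W p| < c / 8.
  by move=> Kp; have [_ _ + _] := hK p Kp; rewrite -/(P p) lt_min => /andP[].
have epsq p : 0 <= eps * (p.1 * p.1) by rewrite mulr_ge0 ?(ltW eps0)// -expr2 sqr_ge0.
have Qm : W p0 - c / 8 < Q m.
  have := mmax p0; rewrite inE => /(_ Kp0); apply: lt_le_trans.
  have := PW p0 Kp0; rewrite ltr_norml => /andP[]; have := epsq p0.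
  by rewrite /Q; move: (eps * _) (P p0) (W p0); clear => *; lra.
have mi : nbhs m K.
  apply: contrapT => /(bd m mK); rewrite -/(W m) => Wm.
  have := PW m mK; have := epsb m mK; rewrite ltr_norml expr2 => h1 /andP[_ h2].
  move: Qm; rewrite cE /Q; move: Wm h1 h2 c0.
  by move: (eps * _) (P m) (W m); clear => *; lra.
have /nbhs_ballP[d /= d0 dK] := mi.
have Vm : V m := KV _ mK.
have inK q : `|q.1 - m.1| < d -> `|q.2 - m.2| < d -> K q.
  by move=> a b'; apply: dK; apply/ball_square.
have lx : partial_x (partial_x Q) m <= 0.
  apply: (@second_derivative_at_max R (fun t => Q (t, m.2)) (fun t => partial_x Q (t, m.2)) _ m.1 d d0).
  - move=> x xm; apply: (proj1 (slice_x _ (x, m.2) _)); apply: class_C_dx CQ _ _.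
    by apply: KV; apply: inK => //=; rewrite subrr normr0.
  - by apply: (proj1 (slice_x _ m _)); exact: class_C_dx (class_C_px CQ) _ Vm.
  - move=> x xm; rewrite -surjective_pairing; apply: mmax; rewrite inE.
    by apply: inK => //=; rewrite subrr normr0.
have ly : partial_y (partial_y Q) m <= 0.
  apply: (@second_derivative_at_max R (fun t => Q (m.1, t)) (fun t => partial_y Q (m.1, t)) _ m.2 d d0).
  - move=> x xm; apply: (proj1 (slice_y _ (m.1, x) _)); apply: class_C_dy CQ _ _.
    by apply: KV; apply: inK => //=; rewrite subrr normr0.
  - by apply: (proj1 (slice_y _ m _)); exact: class_C_dy (class_C_py CQ) _ Vm.
  - move=> x xm; rewrite -surjective_pairing; apply: mmax; rewrite inE.
    by apply: inK => //=; rewrite subrr normr0.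
have lapQ : laplacian Q m = laplacian P m + eps * 2.
  rewrite (laplacianD oV Vm CP (class_CZ eps oV (class_CM oV (Cf 2) (Cf 2)))).
  rewrite (laplacianZ _ oV Vm (class_CM oV (Cf 2) (Cf 2))).
  rewrite (laplacianM oV Vm (Cf _) (Cf _)).
  rewrite (partial_xE (is_derive_fst_x m)) (partial_yE (is_derive_fst_y m)).
  have -> : laplacian (fun q : R * R => q.1) m = 0.
    rewrite -[RHS](addr0 0).
    apply: (@laplacian_eq _ setT _ (fun=> 1) (fun=> 0) m 0 0 openT I).
      by move=> q _; split; [exact: is_derive_fst_x|exact: is_derive_fst_y].
    by split; exact: is_derive_cst.
  by rewrite !mul0r !mulr0 !addr0 mulr1 add0r mulr1.
have [_ _ _] := hK m mK; rewrite -/P lt_min => /andP[_]; rewrite ltr_norml => /andP[lP _].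
have lQ : laplacian Q m <= 0 + 0 := lerD lx ly.
by move: lQ; rewrite lapQ addr0; move: (laplacian P m) lP eps0; clear => *; lra.
Qed.

End WeightedMaximum.

(** * Decay of the gradient of a harmonic function *)

Section UniqueContinuation.
Variable R : realType.
Implicit Types (F G : R * R -> R) (U : set (R * R)) (p q v : R * R).
Local Notation dx := (dir_x R).
Local Notation dy := (dir_y R).

Lemma CR_mul U A B A' B' : open U -> class_C 1 U A -> class_C 1 U B ->
  class_C 1 U A' -> class_C 1 U B' -> CR U A B -> CR U A' B' ->
  CR U (fun q => A q * A' q - B q * B' q) (fun q => A q * B' q + B q * A' q).
Proof.
move=> oU CA CB CA' CB' cr cr' q Uq.
have [e1 e2] := cr q Uq; have [e3 e4] := cr' q Uq.
have Mx := is_derivePM (class_C_dx CA Uq) (class_C_dx CA' Uq).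
have Nx := is_derivePM (class_C_dx CB Uq) (class_C_dx CB' Uq).
have Ox := is_derivePM (class_C_dx CA Uq) (class_C_dx CB' Uq).
have Px := is_derivePM (class_C_dx CB Uq) (class_C_dx CA' Uq).
have My := is_derivePM (class_C_dy CA Uq) (class_C_dy CA' Uq).
have Ny := is_derivePM (class_C_dy CB Uq) (class_C_dy CB' Uq).
have Oy := is_derivePM (class_C_dy CA Uq) (class_C_dy CB' Uq).
have Py := is_derivePM (class_C_dy CB Uq) (class_C_dy CA' Uq).
rewrite (partial_xE (is_deriveB Mx Nx)) (partial_yE (is_deriveD Oy Py)).
rewrite (partial_xE (is_deriveD Ox Px)) (partial_yE (is_deriveB My Ny)).
rewrite e1 e2 e3 e4.
move: (partial_x B q) (partial_y B q) (partial_x B' q) (partial_y B' q).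
by move: (A q) (B q) (A' q) (B' q); clear => *; split; ring.
Qed.

Definition norm2 (q : R * R) : R := q.1 * q.1 + q.2 * q.2.

Lemma norm2_ge0 q : 0 <= norm2 q.
Proof. by rewrite /norm2 -!expr2 addr_ge0 ?sqr_ge0. Qed.

Lemma norm2_eq0 q : (norm2 q == 0) = (q == (0, 0)).
Proof.
case: q => x y; rewrite /norm2 /= -!expr2 paddr_eq0 ?sqr_ge0// !sqrf_eq0.
by apply/andP/eqP => [[/eqP -> /eqP ->]|[-> ->]].
Qed.

Lemma norm2_continuous : continuous norm2.
Proof.
move=> q; suff : {for q, continuous (fun r : R * R => r.1 * r.1 + r.2 * r.2)} by [].
by apply: continuousD; apply: continuousM; (exact: cvg_fst || exact: cvg_snd).
Qed.

Lemma open_norm2_lt (r : R) : open [set q | norm2 q < r].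
Proof.
have /continuousP h := norm2_continuous.
exact: (h [set x | x < r] (@open_lt _ r)).
Qed.

Lemma open_norm2_gt (r : R) : open [set q | r < norm2 q].
Proof.
have /continuousP h := norm2_continuous.
exact: (h [set x | r < x] (@open_gt _ r)).
Qed.

Definition punctured : set (R * R) := [set q | 0 < norm2 q].

Lemma open_punctured : open punctured.
Proof. exact: open_norm2_gt. Qed.

Lemma puncturedP q : punctured q <-> q <> (0, 0).
Proof.
rewrite /punctured /= lt0r norm2_eq0 norm2_ge0 andbT.
by split => [/eqP|/eqP].
Qed.

Lemma class_C_norm2 k U : open U -> class_C k U norm2.
Proof.
by move=> oU; apply: (class_CD oU); apply: (class_CM oU);
  (exact: class_C_fst || exact: class_C_snd).
Qed.

(** Real part of 1 / z. *)
Definition re_inv (q : R * R) : R := q.1 * (norm2 q)^-1.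
(** Imaginary part of 1 / z. *)
Definition im_inv (q : R * R) : R := - (q.2 * (norm2 q)^-1).

(** Real and imaginary part of z^-n. *)
Fixpoint inv_pow (n : nat) : (R * R -> R) * (R * R -> R) :=
  if n is n'.+1 then
    (fun q => (inv_pow n').1 q * re_inv q - (inv_pow n').2 q * im_inv q,
     fun q => (inv_pow n').1 q * im_inv q + (inv_pow n').2 q * re_inv q)
  else (fun=> 1, fun=> 0).

Lemma class_C_re_inv k : class_C k punctured re_inv.
Proof.
apply: (class_CM open_punctured); first exact: class_C_fst open_punctured.
apply: (class_CV open_punctured); last exact: class_C_norm2 open_punctured.
by move=> p; rewrite /punctured /= => /gt_eqF ->.
Qed.

Lemma class_C_im_inv k : class_C k punctured im_inv.
Proof.
apply: (class_CN open_punctured).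
apply: (class_CM open_punctured); first exact: class_C_snd open_punctured.
apply: (class_CV open_punctured); last exact: class_C_norm2 open_punctured.
by move=> p; rewrite /punctured /= => /gt_eqF ->.
Qed.

Lemma is_derive_norm2 q : is_derive q dx norm2 (2 * q.1) /\ is_derive q dy norm2 (2 * q.2).
Proof.
split.
  have := is_deriveD (is_derivePM (is_derive_fst_x q) (is_derive_fst_x q))
    (is_derivePM (is_derive_snd_x q) (is_derive_snd_x q)).
  by congr is_derive; ring.
have := is_deriveD (is_derivePM (is_derive_fst_y q) (is_derive_fst_y q))
  (is_derivePM (is_derive_snd_y q) (is_derive_snd_y q)).
by congr is_derive; ring.
Qed.

Lemma CR_inv : CR punctured re_inv im_inv.
Proof.
move=> q q0; have n0 : norm2 q != 0 by rewrite gt_eqF.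
have [nx ny] := is_derive_norm2 q.
have ix := is_derivePV n0 nx; have iy := is_derivePV n0 ny.
rewrite (partial_xE (is_derivePM (is_derive_fst_x q) ix)).
rewrite (partial_yE (is_derivePM (is_derive_fst_y q) iy)).
rewrite (partial_xE (is_deriveN (is_derivePM (is_derive_snd_x q) ix))).
rewrite (partial_yE (is_deriveN (is_derivePM (is_derive_snd_y q) iy))).
split; last by ring.
by move: n0; rewrite /norm2 => n0; field.
Qed.

Lemma inv_powP k n : [/\ class_C k punctured (inv_pow n).1,
  class_C k punctured (inv_pow n).2 & CR punctured (inv_pow n).1 (inv_pow n).2].
Proof.
have oP := open_punctured.
elim: n k => [|n IH] k /=.
  split; [exact: class_C_cst|exact: class_C_cst|].
  by move=> q _; have [-> ->] := partial_cst 1 q; have [-> ->] := partial_cst 0 q; rewrite oppr0.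
have [CA CB _] := IH k; have [CA1 CB1 cr] := IH 1.
split.
- apply: (class_CB oP); apply: (class_CM oP) => //; [exact: class_C_re_inv|exact: class_C_im_inv].
- apply: (class_CD oP); apply: (class_CM oP) => //; [exact: class_C_im_inv|exact: class_C_re_inv].
- exact: CR_mul oP CA1 CB1 (class_C_re_inv 1) (class_C_im_inv 1) cr CR_inv.
Qed.

Lemma inv_pow_norm n q : punctured q ->
  (inv_pow n).1 q ^+ 2 + (inv_pow n).2 q ^+ 2 = (norm2 q)^-1 ^+ n.
Proof.
move=> q0; have n0 : norm2 q != 0 by rewrite gt_eqF.
elim: n => [|n IH] /=; first by rewrite expr0 expr1n expr0n addr0.
rewrite [RHS]exprS -IH.
have -> : (norm2 q)^-1 = re_inv q ^+ 2 + im_inv q ^+ 2.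
  by rewrite /re_inv /im_inv; move: n0; rewrite /norm2 => n0; field.
by move: (inv_pow n) => [a b] /=; ring.
Qed.

Lemma compact_annulus (a b : R) : compact [set q | a <= norm2 q <= b].
Proof.
have cl : closed [set q | a <= norm2 q <= b].
  have /continuous_closedP h := norm2_continuous.
  have -> : [set q | a <= norm2 q <= b] = norm2 @^-1` `[a, b].
    by apply/seteqP; split => q /=; rewrite in_itv.
  by apply: h; exact: interval_closed.
pose s := b + 1.
apply: (subclosed_compact cl (compact_setX (@segment_compact _ (- s) s) (@segment_compact _ (- s) s))).
have aux (x y : R) : x * x + y * y <= b -> - s <= x <= s.
  rewrite /s => h.
  have := sqr_ge0 y; have := sqr_ge0 x; rewrite !expr2 => hx hy.
  have b0 : 0 <= b by lra.
  by apply/andP; split; nra.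
by move=> [x y] /= /andP[_ nb]; split => /=; rewrite in_itv /=; apply: aux;
  [exact: nb|rewrite addrC; exact: nb].
Qed.

Lemma geometric_le0 (g C k : R) : 0 <= k < 1 -> (forall n, g <= C * k ^+ n) -> g <= 0.
Proof.
move=> /andP[k0 k1] gC.
have ck : (fun n => C * k ^+ n) @ \oo --> C * 0.
  by apply: cvgMr; apply: cvg_expr; rewrite ger0_norm.
by rewrite -(mulr0 C); apply: (cvgr_to_ge ck); near=> n; exact: gC.
Unshelve. all: by end_near. Qed.

Lemma sqr_le_abs (x c : R) : 0 <= c -> x ^+ 2 <= c ^+ 2 -> x <= c.
Proof.
by move=> c0 xc; rewrite leNgt; apply/negP => cx; move: xc; rewrite !expr2; nra.
Qed.

(** Apply [weighted_maximum] on an annulus to u_x - i u_y multiplied by z^-n and by its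
    products with -1, i and -i.  Near the inner circle the gradient of u vanishes, and on the
    outer circle the weight has modulus rho^-n. *)
Lemma gradient_decay U u (rho d M : R) n q : open U -> 0 < rho -> 0 < d -> 0 <= M ->
  (forall p, norm2 p <= rho ^+ 2 -> U p) ->
  class_C 2 U u -> (forall p, U p -> laplacian u p = 0) ->
  (forall p, norm2 p < d ^+ 2 -> partial_x u p = 0 /\ partial_y u p = 0) ->
  (forall p, norm2 p <= rho ^+ 2 -> `|partial_x u p| <= M /\ `|partial_y u p| <= M) ->
  norm2 q < rho ^+ 2 ->
  partial_x u q ^+ 2 + partial_y u q ^+ 2 <= 8 * M ^+ 2 * (norm2 q / rho ^+ 2) ^+ n.
Proof.
move=> oU rho0 d0 M0 sub Cu harm zero bnd qr.
have n2 : 0 <= (norm2 q / rho ^+ 2) ^+ n.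
  by apply: exprn_ge0; rewrite divr_ge0 ?norm2_ge0 ?sqr_ge0.
have [qd|dq] := ltrP (norm2 q) (d ^+ 2).
  have [-> ->] := zero q qd.
  by rewrite expr0n addr0 mulr_ge0// mulr_ge0// sqr_ge0.
pose a := (d / 2) ^+ 2.
have a0 : 0 < a by rewrite exprn_gt0// divr_gt0.
have ad : a < d ^+ 2 by rewrite /a expr_div_n ltr_pdivrMr// ltr_pMr ?exprn_gt0//; lra.
pose K := [set p | a <= norm2 p <= rho ^+ 2].
have cK : compact K := @compact_annulus a (rho ^+ 2).
pose D := U `&` punctured.
have oD : open D by apply: openI => //; exact: open_punctured.
have KD : K `<=` D.
  move=> p /andP[ap pr]; split; first exact: sub.
  exact: lt_le_trans a0 ap.
have [DU DP] : D `<=` U /\ D `<=` punctured by split => p [].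
have [CA CB cr] := inv_powP 2 n.
set A := (inv_pow n).1 in CA CB cr; set B := (inv_pow n).2 in CA CB cr.
have CuD := class_C_sub DU Cu.
have harmD p : D p -> laplacian u p = 0 by move=> /DU; exact: harm.
pose c := 2 * M * rho^-1 ^+ n.
have rn0 : 0 <= rho^-1 ^+ n by rewrite exprn_ge0// invr_ge0 ltW.
have c0 : 0 <= c by rewrite mulr_ge0// mulr_ge0.
have main A' B' : class_C 2 punctured A' -> class_C 2 punctured B' -> CR punctured A' B' ->
  (forall p, punctured p -> A' p ^+ 2 + B' p ^+ 2 = (norm2 p)^-1 ^+ n) ->
  A' q * partial_x u q + B' q * partial_y u q <= c.
  move=> CA' CB' cr' nrm.
  apply: (@weighted_maximum _ D K A' B' u c oD cK KD (class_C_sub DP CA') (class_C_sub DP CB')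
    (fun p Dp => cr' p (DP p Dp)) CuD harmD); last first.
    by apply/andP; split; [exact: (le_trans (ltW ad))|exact: ltW].
  move=> p /andP[ap pr] nK.
  have [pd|dp] := ltrP (norm2 p) (d ^+ 2).
    by have [-> ->] := zero p pd; rewrite !mulr0 addr0.
  have pE : norm2 p = rho ^+ 2.
    apply/eqP; rewrite eq_le pr /= leNgt; apply/negP => pr'; apply: nK.
    have op : open ([set r | a < norm2 r] `&` [set r | norm2 r < rho ^+ 2]).
      by apply: openI; [exact: open_norm2_gt|exact: open_norm2_lt].
    apply: filterS (_ : nbhs p ([set r | a < norm2 r] `&` [set r | norm2 r < rho ^+ 2])).
      by move=> r [/= r1 r2]; apply/andP; split; exact: ltW.
    apply: open_nbhs_nbhs; split; first exact: op.
    by split => //=; exact: lt_le_trans ad dp.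
  have p0 : punctured p by exact: lt_le_trans a0 ap.
  apply: sqr_le_abs => //.
  have := nrm p p0; rewrite pE -exprVn exprAC => E.
  have [bx by_] := bnd p pr.
  have {bx by_} [bx by_] : partial_x u p ^+ 2 <= M ^+ 2 /\ partial_y u p ^+ 2 <= M ^+ 2.
    by rewrite -(real_normK (num_real (partial_x u p))) -(real_normK (num_real (partial_y u p)));
      split; apply: lerXn2r.
  have {}E : A' p ^+ 2 + B' p ^+ 2 = (rho^-1 ^+ n) ^+ 2 by [].
  rewrite /c !exprMn -E.
  move: bx by_ (sqr_ge0 (A' p * partial_y u p - B' p * partial_x u p)).
  move: (partial_x u p) (partial_y u p) (A' p) (B' p); clear => x y s t.
  move=> hx hy h.
  have h2 : (s ^+ 2 + t ^+ 2) * (x ^+ 2 + y ^+ 2) <= (s ^+ 2 + t ^+ 2) * (M ^+ 2 + M ^+ 2).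
    by apply: ler_wpM2l; [rewrite addr_ge0 ?sqr_ge0|exact: lerD].
  have h3 : 0 <= (s ^+ 2 + t ^+ 2) * M ^+ 2 by rewrite mulr_ge0 ?addr_ge0 ?sqr_ge0.
  by move: h h2 h3; clear; lra.
have Pn p : punctured p -> A p ^+ 2 + B p ^+ 2 = (norm2 p)^-1 ^+ n := @inv_pow_norm n p.
have oP := open_punctured.
have CRN X Y : class_C 2 punctured X -> class_C 2 punctured Y -> CR punctured X Y ->
    CR punctured (fun p => - X p) (fun p => - Y p).
  move=> CX CY h p p0; have [h1 h2] := h p p0.
  rewrite (partial_xE (is_deriveN (class_C_dx CX p0))) (partial_xE (is_deriveN (class_C_dx CY p0))).
  rewrite (partial_yE (is_deriveN (class_C_dy CX p0))) (partial_yE (is_deriveN (class_C_dy CY p0))).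
  by rewrite h1 h2.
have CRi X Y : class_C 2 punctured X -> class_C 2 punctured Y -> CR punctured X Y ->
    CR punctured Y (fun p => - X p).
  move=> CX CY h p p0; have [h1 h2] := h p p0.
  rewrite (partial_xE (is_deriveN (class_C_dx CX p0))) (partial_yE (is_deriveN (class_C_dy CX p0))).
  by rewrite h1 h2 !opprK.
have CNA := class_CN oP CA; have CNB := class_CN oP CB.
have m1 := main A B CA CB cr Pn.
have m2 := main _ _ CNA CNB (CRN _ _ CA CB cr)
  (fun p hp => etrans (congr2 +%R (sqrrN _) (sqrrN _)) (Pn p hp)).
have m3 := main _ _ CB CNA (CRi _ _ CA CB cr)
  (fun p hp => etrans (congr2 +%R (erefl _) (sqrrN _)) (etrans (addrC _ _) (Pn p hp))).
have m4 := main _ _ CNB (class_CN oP CNA) (CRN _ _ CB CNA (CRi _ _ CA CB cr))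
  (fun p hp => etrans (congr2 +%R (sqrrN _) (etrans (sqrrN _) (sqrrN _))) (etrans (addrC _ _) (Pn p hp))).
have q0 : punctured q by apply: lt_le_trans dq; rewrite exprn_gt0.
have n0 : norm2 q != 0 by rewrite gt_eqF.
have rho20 : rho ^+ 2 != 0 by rewrite gt_eqF// exprn_gt0.
have := Pn q q0.
have cE : c ^+ 2 = 4 * M ^+ 2 * (rho ^+ 2)^-1 ^+ n.
  have -> : (rho ^+ 2)^-1 ^+ n = (rho^-1 ^+ n) ^+ 2 by rewrite -exprVn exprAC.
  by rewrite /c; move: (rho^-1 ^+ n) => z; ring.
rewrite exprMn => E.
have nn : (norm2 q) ^+ n * (norm2 q)^-1 ^+ n = 1 by rewrite -exprMn divff// expr1n.
rewrite -[leLHS]mul1r -{1}nn -E.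
rewrite (_ : 8 * M ^+ 2 * (norm2 q ^+ n * (rho ^+ 2)^-1 ^+ n) = norm2 q ^+ n * (2 * c ^+ 2)); last first.
  by rewrite cE; ring.
rewrite -mulrA ler_wpM2l ?exprn_ge0 ?norm2_ge0//.
move: m1 m2 m3 m4 c0; move: (partial_x u q) (partial_y u q) (A q) (B q) (c); clear => x y s t c.
move=> m1 m2 m3 m4 c0.
have h1 : (s * x + t * y) ^+ 2 <= c ^+ 2 by rewrite !expr2; nra.
have h2 : (t * x - s * y) ^+ 2 <= c ^+ 2 by rewrite !expr2; nra.
have -> : (s ^+ 2 + t ^+ 2) * (x ^+ 2 + y ^+ 2) = (s * x + t * y) ^+ 2 + (t * x - s * y) ^+ 2 by ring.
by rewrite mulr2n mulrDl mul1r; exact: lerD.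
Qed.

End UniqueContinuation.

(** * Unique continuation for biharmonic functions *)

Section Continuation.
Variable R : realType.
Implicit Types (F G : R * R -> R) (U V : set (R * R)) (p q v : R * R).
Local Notation dx := (dir_x R).
Local Notation dy := (dir_y R).

Lemma norm2_continuous_abs F G U p : U p -> (forall q, U q -> {for q, continuous F}) ->
  (forall q, U q -> {for q, continuous G}) ->
  {for p, continuous (fun q => `|F q| + `|G q|)}.
Proof.
move=> Up cF cG; apply: continuousD.
  by apply: continuous_comp; [exact: cF|exact: norm_continuous].
by apply: continuous_comp; [exact: cG|exact: norm_continuous].
Qed.

(** The bound of [gradient_decay] tends to 0 as n grows; a function with zero gradient is
    constant. *)
Lemma harmonic_zero_disc U u (rho d : R) : open U -> 0 < rho -> 0 < d ->
  (forall p, norm2 p <= rho ^+ 2 -> U p) ->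
  class_C 2 U u -> (forall p, U p -> laplacian u p = 0) ->
  (forall p, norm2 p < d ^+ 2 -> u p = 0) ->
  forall q, norm2 q < rho ^+ 2 -> u q = 0.
Proof.
move=> oU rho0 d0 sub Cu harm zero.
have grad0 p : norm2 p < d ^+ 2 -> partial_x u p = 0 /\ partial_y u p = 0.
  move=> pd; have od := @open_norm2_lt R (d ^+ 2).
  split; [rewrite -[RHS](proj1 (partial_cst 0 p)) (partial_x_ext od pd zero)//|
          rewrite -[RHS](proj2 (partial_cst 0 p)) (partial_y_ext od pd zero)//].
pose K := [set p : R * R | 0 <= norm2 p <= rho ^+ 2].
have KP p : norm2 p <= rho ^+ 2 -> K p by move=> pr; rewrite /K /= norm2_ge0.
have n00 : norm2 ((0, 0) : R * R) = 0 by rewrite /norm2 /= mulr0 addr0.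
have [||m mK mmax] := @compact_EVT_max _ R (fun p => `|partial_x u p| + `|partial_y u p|) K _
    (@compact_annulus R 0 (rho ^+ 2)).
- by exists (0, 0); apply: KP; rewrite n00 sqr_ge0.
- apply: continuous_in_subspaceT => p; rewrite inE => /andP[_ /sub Up].
  apply: (norm2_continuous_abs Up); [exact: class_C_cont (class_C_px Cu)|exact: class_C_cont (class_C_py Cu)].
pose M := `|partial_x u m| + `|partial_y u m|.
have M0 : 0 <= M by rewrite addr_ge0.
have bnd p : norm2 p <= rho ^+ 2 -> `|partial_x u p| <= M /\ `|partial_y u p| <= M.
  move=> /KP pK; have := mmax p; rewrite inE => /(_ pK) H.
  split; apply: le_trans H; first exact: (eq_ind_r is_true (normr_ge0 _) (lerDl _ _)).
  exact: (eq_ind_r is_true (normr_ge0 _) (lerDr _ _)).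
have grad q : norm2 q < rho ^+ 2 -> partial_x u q = 0 /\ partial_y u q = 0.
  move=> qr.
  have le0 : partial_x u q ^+ 2 + partial_y u q ^+ 2 <= 0.
    apply: (@geometric_le0 _ _ (8 * M ^+ 2) (norm2 q / rho ^+ 2)).
      rewrite divr_ge0 ?norm2_ge0 ?sqr_ge0//= ltr_pdivrMr ?mul1r//.
      by rewrite exprn_gt0.
    by move=> n; exact: gradient_decay oU rho0 d0 M0 sub Cu harm grad0 bnd qr.
  move: le0; rewrite le_eqVlt ltNge addr_ge0 ?sqr_ge0//= orbF paddr_eq0 ?sqr_ge0//.
  by rewrite !sqrf_eq0 => /andP[/eqP -> /eqP ->].
move=> q qr; have h0 : u (0, 0) = 0 by apply: zero; rewrite n00 exprn_gt0.
have Cu1 := class_C_pred Cu.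
have sqle (t x : R) : `|t| <= `|x| -> t * t <= x * x.
  move=> tx; rewrite -!expr2 -(real_normK (num_real t)) -(real_normK (num_real x)).
  exact: lerXn2r.
have in1 t : `|t - 0| <= `|q.1| -> norm2 (t, (0 : R)) < rho ^+ 2.
  rewrite subr0 => /sqle tq; apply: le_lt_trans qr; rewrite /norm2 /= mulr0 addr0.
  by rewrite (le_trans tq)// lerDl -expr2 sqr_ge0.
have in2 t : `|t - 0| <= `|q.2| -> norm2 (q.1, t) < rho ^+ 2.
  by rewrite subr0 => /sqle tq; apply: le_lt_trans qr; rewrite /norm2 /= lerD2l.
have [t1 t1q] := @MVT_x R U u (0, 0) q.1 Cu1 (fun t h => sub _ (ltW (in1 t h))).
rewrite (proj1 (grad _ (in1 _ t1q))) mul0r /= add0r h0 subr0 => E1.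
have [t2 t2q] := @MVT_y R U u (q.1, 0) q.2 Cu1 (fun t h => sub _ (ltW (in2 t h))).
by rewrite (proj2 (grad _ (in2 _ t2q))) mul0r /= add0r E1 subr0 -surjective_pairing.
Qed.

(** The disc of radius 3 r / 2 contains the square of half-side r and is contained in the
    square of half-side 2 r. *)
Lemma harmonic_zero_ball U u q r : open U -> 0 < r -> ball q (2 * r) `<=` U ->
  class_C 2 U u -> (forall p, U p -> laplacian u p = 0) ->
  (\forall p \near q, u p = 0) -> forall p, ball q r p -> u p = 0.
Proof.
move=> oU r0 sub Cu harm /nbhs_ballP[d /= d0 zero] p qp.
pose w := fun s : R * R => u (s.1 + q.1, s.2 + q.2).
have coord (s : R * R) (c : R) : 0 < c -> norm2 s < c ^+ 2 -> ball q c (s.1 + q.1, s.2 + q.2).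
  move=> c0; rewrite /norm2 expr2 => sc; apply/ball_square => /=; rewrite !addrK.
  by split; rewrite ltr_norml; apply/andP; split; nra.
have -> : u p = w (p.1 - q.1, p.2 - q.2) by rewrite /w /= !subrK -surjective_pairing.
apply: (@harmonic_zero_disc (translate q U) w (3 / 2 * r) d (open_tr oU)) => //.
- by rewrite mulr_gt0// divr_gt0.
- move=> s sr; apply: sub; apply: coord; first by rewrite mulr_gt0.
  apply: le_lt_trans sr _; rewrite !exprMn ltr_pM2r ?exprn_gt0//; lra.
- exact: class_C_tr oU Cu.
- by move=> s Us; rewrite laplacian_tr; exact: harm.
- by move=> s sd; apply: zero; exact: coord.
- move/ball_square: qp; rewrite /norm2 /=; move: (p.1 - q.1) (p.2 - q.2) r0; clear => x y r0.
  by rewrite !ltr_norml => -[/andP[a b] /andP[c d]]; rewrite expr2; nra.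
Qed.

(** Apply the harmonic case to the Laplacian of F, and then to F itself. *)
Lemma biharmonic_zero_ball U F q r : open U -> 0 < r -> ball q (4 * r) `<=` U ->
  biharmonic U F -> (\forall p \near q, F p = 0) -> forall p, ball q r p -> F p = 0.
Proof.
move=> oU r0 sub [CF bi] zero.
have r20 : 0 < 2 * r by rewrite mulr_gt0.
have sub' : ball q (2 * (2 * r)) `<=` U by rewrite mulrA -natrM.
have lap0 : \forall p \near q, laplacian F p = 0.
  case/nbhs_ballP: zero => d /= d0 zero; apply/nbhs_ballP; exists d => //= p pd.
  by rewrite (laplacian_ext (ball_open _ _) pd zero) laplacian_cst.
have harm := harmonic_zero_ball oU r20 sub' (class_C_laplacian oU CF) bi lap0.
apply: (@harmonic_zero_ball (ball q (2 * r)) F q r (ball_open _ _) r0) => //.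
apply: class_C_sub (class_C_pred (class_C_pred CF)).
by apply: subset_trans sub; apply: le_ball; rewrite ler_pM2r// ler_nat.
Qed.

Lemma connected_clopen U Z : connected U -> open Z -> Z `<=` U -> Z !=set0 ->
  (forall p, U p -> closure Z p -> Z p) -> U `<=` Z.
Proof.
move=> cU oZ ZU Z0 cl; have -> // := cU Z Z0.
- by exists Z => //; apply/seteqP; split => [p Zp|p []//]; split => //; exact: ZU.
- exists (closure Z); first exact: closed_closure.
  apply/seteqP; split => [p Zp|p [Up /cl]]; last exact.
  by split; [exact: ZU|exact: subset_closure].
Qed.

Lemma open_near (P : R * R -> Prop) : open [set p | \forall q \near p, P q].
Proof. by rewrite openE => p Pp; exact: near_join Pp. Qed.

(** The points near which F vanishes form an open set, which is closed in U by
    [biharmonic_zero_ball]. *)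
Theorem biharmonic_continuation U F p0 : open U -> connected U -> biharmonic U F ->
  U p0 -> (\forall p \near p0, F p = 0) -> forall p, U p -> F p = 0.
Proof.
move=> oU cU bF Up0 zero0.
pose Z := U `&` [set p | \forall q \near p, F q = 0].
suff UZ : U `<=` Z by move=> p /UZ [_ /nbhs_singleton].
apply: connected_clopen => //.
- by apply: openI => //; exact: open_near.
- by move=> p [].
- by exists p0.
- move=> p Up clp; split => //.
  have [e e0 sub] := open_ball oU Up.
  have r0 : 0 < e / 8 by rewrite divr_gt0.
  have [q [[Uq zq] qp]] : (Z `&` ball p (e / 8)) !=set0.
    by apply: clp; exact: nbhsx_ballx.
  have pq : ball q (e / 8) p by exact: ball_sym.
  have sub' : ball q (4 * (e / 8)) `<=` U.
    move=> s qs; apply: sub; move/ball_square: qp => [a b]; move/ball_square: qs => [c d].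
    apply/ball_square; move: a b c d; rewrite !ltr_norml.
    move=> /andP[a1 a2] /andP[b1 b2] /andP[c1 c2] /andP[d1 d2].
    by split; apply/andP; split; lra.
  have bz := biharmonic_zero_ball oU r0 sub' bF zq.
  exact: near_open (ball_open _ _) pq bz.
Qed.

Lemma biharmonicB U F G : open U -> biharmonic U F -> biharmonic U G ->
  biharmonic U (fun p => F p - G p).
Proof.
move=> oU [CF bF] [CG bG]; split; first exact: class_CB.
have CF2 := class_C_pred (class_C_pred CF); have CG2 := class_C_pred (class_C_pred CG).
move=> p Up.
rewrite (@laplacian_ext _ U _ (fun q => laplacian F q - laplacian G q) p oU Up); last first.
  by move=> q Uq; exact: (laplacianB oU Uq CF2 CG2).
rewrite (laplacianB oU Up (class_C_laplacian oU CF) (class_C_laplacian oU CG)).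
exact: (etrans (congr2 (fun a b : R => a - b) (bF p Up) (bG p Up)) (subrr _)).
Qed.

Lemma biharmonic_sub U V F : V `<=` U -> biharmonic U F -> biharmonic V F.
Proof.
move=> VU [CF bF]; split; first exact: class_C_sub VU CF.
by move=> p /VU; exact: bF.
Qed.

Lemma biharmonic_ext U F G : open U -> (forall p, U p -> F p = G p) ->
  biharmonic U F -> biharmonic U G.
Proof.
move=> oU FG [CF bF]; split; first exact: class_C_ext oU FG CF.
move=> p Up; rewrite -(bF p Up); apply/esym.
apply: (laplacian_ext oU Up) => q Uq; exact: laplacian_ext oU Uq FG.
Qed.

Theorem biharmonic_eq U F G p0 : open U -> connected U -> biharmonic U F -> biharmonic U G ->
  U p0 -> (\forall p \near p0, F p = G p) -> forall p, U p -> F p = G p.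
Proof.
move=> oU cU bF bG Up0 FG p Up; apply/eqP; rewrite -subr_eq0; apply/eqP.
apply: (biharmonic_continuation oU cU (biharmonicB oU bF bG) Up0 _ Up).
by apply: filterS FG => q ->; rewrite subrr.
Qed.

End Continuation.

(** * Cauchy uniqueness on the x-axis *)

Section CauchyUniqueness.
Variable R : realType.
Implicit Types (F G : R * R -> R) (U V : set (R * R)) (p q v : R * R).
Local Notation dx := (dir_x R).
Local Notation dy := (dir_y R).

Definition axis_zero U F := forall p, U p -> p.2 = 0 -> F p = 0.

(** All partial derivatives of order at most k vanish on the x-axis. *)
Fixpoint flat (k : nat) U F : Prop :=
  if k is k'.+1 then
    [/\ axis_zero U F, flat k' U (partial_x F) & flat k' U (partial_y F)]
  else axis_zero U F.

Lemma flat_axis_zero k U F : flat k U F -> axis_zero U F.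
Proof. by case: k => [|k] // []. Qed.

(** Replacing F by 0 below the x-axis turns Cauchy uniqueness into unique continuation:
    flatness on the axis keeps the class and the equation. *)
Definition upper F : R * R -> R := fun p => if 0 < p.2 then F p else 0.

Lemma open_snd_gt0 : open [set p : R * R | 0 < p.2].
Proof.
have /continuousP h : continuous (fun p : R * R => p.2) by move=> p; exact: cvg_snd.
exact: (h [set x | 0 < x] (@open_gt _ 0)).
Qed.

Lemma open_snd_lt0 : open [set p : R * R | p.2 < 0].
Proof.
have /continuousP h : continuous (fun p : R * R => p.2) by move=> p; exact: cvg_snd.
exact: (h [set x | x < 0] (@open_lt _ 0)).
Qed.

Lemma upper_gt0 F p : 0 < p.2 -> F p = upper F p.
Proof. by rewrite /upper => ->. Qed.

Lemma upper_le0 F p : p.2 <= 0 -> upper F p = 0.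
Proof. by rewrite /upper leNgt => /negbTE ->. Qed.

Lemma upper_norm F p : `|upper F p| <= `|F p|.
Proof. by rewrite /upper; case: ifP => // _; rewrite normr0. Qed.

Lemma upper_continuous U F p : U p -> axis_zero U F ->
  {for p, continuous F} -> {for p, continuous (upper F)}.
Proof.
move=> Up zF cF; have [p0|p0|p0] := ltgtP p.2 0.
- apply: (continuous_ext_open (F := fun=> 0) open_snd_lt0 p0).
    by move=> q /ltW /upper_le0 ->.
  exact: cst_continuous.
- by apply: (continuous_ext_open open_snd_gt0 p0 _ cF) => q; exact: upper_gt0.
- have u0 : upper F p = 0 by rewrite upper_le0 ?p0.
  apply/cvgrPdist_lt => e e0; rewrite u0.
  have /cvgrPdist_lt /(_ _ e0) := cF; rewrite zF// => h; apply: filterS h => q.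
  by rewrite !sub0r !normrN; exact: le_lt_trans (@upper_norm F q).
Qed.

Lemma is_derive_slice0 (f g : R -> R) : f 0 = 0 -> (forall t, `|g t| <= `|f t|) ->
  is_derive (0 : R) (1 : R) f 0 -> is_derive (0 : R) (1 : R) g 0.
Proof.
move=> f0 gf [dF Ef].
have g0 : g 0 = 0.
  by apply/eqP; rewrite -normr_le0; have := gf 0; rewrite f0 normr0.
have cf : h^-1 *: ((f \o shift 0) (h *: (1 : R)) - f 0) @[h --> 0^'] --> (0 : R).
  by rewrite -[X in _ --> X]Ef; exact: dF.
have cg : h^-1 *: ((g \o shift 0) (h *: (1 : R)) - g 0) @[h --> 0^'] --> (0 : R).
  apply/cvgrPdist_lt => e e0; have /cvgrPdist_lt /(_ _ e0) H := cf.
  apply: filterS H => h; rewrite !sub0r !normrN f0 g0 !subr0 /GRing.scale /= !normrM.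
  by apply: le_lt_trans (ler_wpM2l (normr_ge0 _) (gf _)).
by split; [exact: (cvgP _ cg)|exact: (cvg_lim _ cg)].
Qed.

(** On the axis, the vertical difference quotients of [upper F] are dominated by those of F,
    which tend to 0. *)
Lemma is_derive_upper U F p : open U -> class_C 1 U F -> U p ->
  axis_zero U F -> axis_zero U (partial_y F) ->
  is_derive p dx (upper F) (upper (partial_x F) p) /\
  is_derive p dy (upper F) (upper (partial_y F) p).
Proof.
move=> oU CF Up zF zFy.
have dFx := class_C_dx CF Up; have dFy := class_C_dy CF Up.
have [p0|p0|p0] := ltgtP p.2 0.
- have e q : q.2 < 0 -> (fun=> 0 : R) q = upper F q by move=> /ltW /upper_le0 ->.
  rewrite !upper_le0 ?ltW//; split;
    by apply: (is_derive_ext_open open_snd_lt0 p0 e); exact: is_derive_cst.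
- rewrite -!upper_gt0//; split.
    by apply: (is_derive_ext_open open_snd_gt0 p0 _ dFx) => q; exact: upper_gt0.
  by apply: (is_derive_ext_open open_snd_gt0 p0 _ dFy) => q; exact: upper_gt0.
- rewrite !upper_le0 ?p0//; split.
    apply/slice_x; rewrite (_ : (fun t => _) = cst 0); first exact: is_derive_cst.
    by apply/funext => t; rewrite upper_le0 //= p0.
  move: dFy; rewrite zFy// => /slice_y; rewrite p0 => dFy; apply/slice_y; rewrite p0.
  apply: is_derive_slice0 dFy; last by move=> t; exact: upper_norm.
  have -> : (p.1, 0) = p by rewrite [RHS]surjective_pairing p0.
  exact: zF.
Qed.

Lemma class_C_upper k U F : open U -> class_C k U F -> flat k U F ->
  class_C k U (upper F).
Proof.
move=> oU; elim: k F => [|k IH] F CF fl.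
  by move=> p Up; apply: (upper_continuous Up fl); exact: (class_C_cont CF).
have [z fx fy] := fl.
apply: (@class_CS _ k U _ (upper (partial_x F)) (upper (partial_y F)) oU) => [p Up|p Up||].
- by apply: (upper_continuous Up z); exact: (class_C_cont CF).
- apply: (is_derive_upper oU _ Up z (flat_axis_zero fy)).
  exact: (class_C_le (isT : (1 <= k.+1)%N) CF).
- exact: IH (class_C_px CF) fx.
- exact: IH (class_C_py CF) fy.
Qed.

Lemma laplacian_upper U F p : open U -> class_C 2 U F -> flat 2 U F -> U p ->
  laplacian (upper F) p = upper (laplacian F) p.
Proof.
move=> oU CF [z [zx _ zxy] [zy zyx zyy]] Up.
have dF q (Uq : U q) := is_derive_upper oU (class_C_pred CF) Uq z zy.
have [dxx _] := is_derive_upper oU (class_C_px CF) Up zx zxy.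
have [_ dyy] := is_derive_upper oU (class_C_py CF) Up zy zyy.
rewrite (laplacian_eq oU Up dF (conj dxx dyy)) /upper /laplacian.
by case: (0 < p.2); [reflexivity|exact: addr0].
Qed.

Lemma flatD k U F G : open U -> class_C k U F -> class_C k U G ->
  flat k U F -> flat k U G -> flat k U (fun p => F p + G p).
Proof.
move=> oU; elim: k F G => [|k IH] F G CF CG.
  by move=> zF zG p Up p0; rewrite (zF p Up p0) (zG p Up p0) addr0.
have flat_ext l H H' : (forall q, U q -> H q = H' q) -> flat l U H -> flat l U H'.
  elim: l H H' => [|l IHl] H H' HH'.
    by move=> z p Up p0; rewrite -(HH' p Up) (z p Up p0).
  move=> [z fx fy]; split.
  - by move=> p Up p0; rewrite -(HH' p Up) (z p Up p0).
  - by apply: IHl fx => q Uq; exact: partial_x_ext oU Uq HH'.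
  - by apply: IHl fy => q Uq; exact: partial_y_ext oU Uq HH'.
move=> [zF Fx Fy] [zG Gx Gy]; split.
- by move=> p Up p0; rewrite (zF p Up p0) (zG p Up p0) addr0.
- apply: flat_ext (IH _ _ (class_C_px CF) (class_C_px CG) Fx Gx) => q Uq.
  by rewrite (partial_xE (is_deriveD (class_C_dx CF Uq) (class_C_dx CG Uq))).
- apply: flat_ext (IH _ _ (class_C_py CF) (class_C_py CG) Fy Gy) => q Uq.
  by rewrite (partial_yE (is_deriveD (class_C_dy CF Uq) (class_C_dy CG Uq))).
Qed.

Lemma biharmonic_upper U F : open U -> biharmonic U F -> flat 4 U F ->
  biharmonic U (upper F).
Proof.
move=> oU [CF bF] fl; split; first exact: class_C_upper.
move=> p Up; have flat_le k G : flat k.+1 U G -> flat k U G.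
  elim: k G => [|k IH] G; first by case.
  by move=> [z /IH fx /IH fy]; split.
have fl2 := flat_le _ _ (flat_le _ _ fl).
have CF2 := class_C_pred (class_C_pred CF).
rewrite (@laplacian_ext _ U _ (upper (laplacian F)) p oU Up); last first.
  by move=> q Uq; exact: (laplacian_upper oU CF2 fl2 Uq).
have fll : flat 2 U (laplacian F).
  have [_ [_ fxx _] [_ _ fyy]] := fl.
  exact: (flatD oU (class_C_px (class_C_px CF)) (class_C_py (class_C_py CF)) fxx fyy).
rewrite (laplacian_upper oU (class_C_laplacian oU CF) fll Up) /upper (bF p Up).
by case: (0 < p.2).
Qed.

Lemma axis_zero_dx U F : open U -> axis_zero U F -> axis_zero U (partial_x F).
Proof.
move=> oU zF p Up p0; apply: partial_xE; apply/slice_x; rewrite p0.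
have [e e0 sub] := open_ball oU Up.
have oB : open (ball p.1 e) by exact: ball_open.
apply: (@near_eq_is_derive R R R (cst (0 : R))).
have H : nbhs p.1 (ball p.1 e) by exact: nbhsx_ballx.
apply: filterS H => t; rewrite /ball /= distrC => tp; rewrite zF//.
by apply: sub; apply/ball_square; rewrite /= p0 subrr normr0.
Qed.

Lemma iter_dy_dx U F j p : open U -> class_C j.+1 U F -> U p ->
  iter j (@partial_y R) (partial_x F) p = partial_x (iter j (@partial_y R) F) p.
Proof.
move=> oU; elim: j F p => [|j IH] F p CF Up //.
rewrite !iterSr -(IH (partial_y F) p (class_C_py CF) Up).
have iter_ext l H H' q : (forall q, U q -> H q = H' q) -> U q ->
    iter l (@partial_y R) H q = iter l (@partial_y R) H' q.
  elim: l H H' q => [|l IHl] H H' q HH' Uq; first exact: HH'.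
  by rewrite !iterSr; apply: IHl => // r Ur; exact: partial_y_ext oU Ur HH'.
apply: (iter_ext j _ _ p _ Up) => q Uq.
exact: (Schwarz oU (class_C_le (isT : (2 <= j.+2)%N) CF) Uq).
Qed.

(** Horizontal derivatives of functions vanishing on the axis vanish there, and partial
    derivatives commute, so the pure y-derivatives decide. *)
Lemma flat_of_dy k U F : open U -> class_C k U F ->
  (forall j, (j <= k)%N -> axis_zero U (iter j (@partial_y R) F)) -> flat k U F.
Proof.
move=> oU; elim: k F => [|k IH] F CF z; first exact: (z 0%N).
split.
- exact: (z 0%N).
- apply: IH; first exact: class_C_px CF.
  move=> j jk p Up p0; rewrite (iter_dy_dx oU _ Up); last first.
    exact: (class_C_le (_ : (j.+1 <= k.+1)%N) CF).
  by apply: (axis_zero_dx oU _ Up p0); apply: z; exact: leqW.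
- apply: IH; first exact: class_C_py CF.
  by move=> j jk; rewrite -iterSr; exact: (z j.+1).
Qed.

Lemma add_eq0_r (a b : R) : a = 0 -> a + b = 0 -> b = 0.
Proof. by move=> ->; rewrite add0r. Qed.

(** The equation expresses the fourth y-derivative by F_xxxx and F_xxyy, so the first four
    Cauchy data decide. *)
Lemma flat4_biharmonic U F : open U -> biharmonic U F ->
  (forall j, (j <= 3)%N -> axis_zero U (iter j (@partial_y R) F)) -> flat 4 U F.
Proof.
move=> oU [CF bF] z; apply: flat_of_dy => // j; rewrite leq_eqVlt => /orP[/eqP ->|]; last exact: z.
move=> p Up p0; have z0 := z 0%N isT; have z2 := z 2%N isT.
rewrite /= in z0 z2.
have CF2 := class_C_pred (class_C_pred CF).
have zlap : axis_zero U (laplacian F).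
  move=> q Uq q0; rewrite /laplacian (z2 q Uq q0).
  by rewrite (axis_zero_dx oU (axis_zero_dx oU z0) Uq q0) addr0.
have := bF p Up; rewrite {1}/laplacian.
rewrite (axis_zero_dx oU (axis_zero_dx oU zlap) Up p0) add0r.
have CFxx := class_C_px (class_C_px CF); have CFyy := class_C_py (class_C_py CF).
rewrite (@partial_y_ext _ U _ (fun q => partial_y (partial_x (partial_x F)) q +
    partial_y (partial_y (partial_y F)) q) p oU Up); last first.
  move=> q Uq; apply: partial_yE.
  exact: (is_deriveD (class_C_dy CFxx Uq) (class_C_dy CFyy Uq)).
rewrite (partial_yE (is_deriveD (class_C_dy (class_C_py CFxx) Up)
  (class_C_dy (class_C_py CFyy) Up))).
have z22 : partial_y (partial_y (partial_x (partial_x F))) p = 0.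
  apply: (etrans (iter_dy_dx (j := 2) oU (class_C_px CF) Up)).
  apply: (etrans (@partial_x_ext _ U _ (partial_x (partial_y (partial_y F))) p oU Up _)).
    move=> q Uq; exact: (iter_dy_dx (j := 2) oU (class_C_pred CF) Uq).
  exact: (axis_zero_dx oU (axis_zero_dx oU z2) Up p0).
exact: add_eq0_r z22.
Qed.

End CauchyUniqueness.

(** * Connected sets in the plane *)

Section PlaneConnected.
Variable R : realType.
Implicit Types (U A : set (R * R)) (p q c : R * R).

Definition convex_plane A := forall p q (t : R), A p -> A q -> 0 <= t <= 1 ->
  A (p.1 + t * (q.1 - p.1), p.2 + t * (q.2 - p.2)).

(** A relatively clopen part meets every segment issued from one of its points in a clopen
    part of the segment. *)
Lemma convex_connected A : convex_plane A -> connected A.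
Proof.
move=> cA B [p Bp] [C oC BC] [D cD BD].
pose g q (t : R) : R * R := (p.1 + t * (q.1 - p.1), p.2 + t * (q.2 - p.2)).
have Ap : A p by move: Bp; rewrite BC => -[].
apply/seteqP; split => [q|q Aq]; first by rewrite BC => -[].
have cg : continuous (g q).
  have cl (a b t : R) : {for t, continuous (fun t : R => a + t * b)}.
    apply: continuousD; first exact: cst_continuous.
    by apply: continuousM; [exact: cvg_id|exact: cst_continuous].
  by move=> t; exact: (pair_continuous (cl _ _ t) (cl _ _ t)).
have cS : connected (g q @` `[0, 1]).
  apply: connected_continuous_connected; first exact: segment_connected.
  exact: continuous_subspaceT.
have SA : g q @` `[0, 1] `<=` A.
  by move=> _ [t /= + <-]; rewrite in_itv /=; exact: cA.
have gp : g q 0 = p by rewrite /g !mul0r !addr0 -surjective_pairing.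
have gq : g q 1 = q by rewrite /g !mul1r ![_ + (_ - _)]addrC !subrK -surjective_pairing.
have E : B `&` (g q @` `[0, 1]) = g q @` `[0, 1].
  apply: cS.
  - by exists p; split => //; exists 0 => //=; rewrite in_itv /= lexx ler01.
  - exists C => //; rewrite BC; apply/seteqP; split => [s [[? ?] ?]//|s [Ss Cs]].
    by split => //; split => //; exact: SA.
  - exists D => //; rewrite BD; apply/seteqP; split => [s [[? ?] ?]//|s [Ss Cs]].
    by split => //; split => //; exact: SA.
have : (g q @` `[0, 1]) q by exists 1 => //=; rewrite in_itv /= lexx ler01.
by rewrite -E => -[].
Qed.

Definition box (a b c d : R) : set (R * R) :=
  [set q | (a < q.1 < b) /\ (c < q.2 < d)].

Lemma box_convex (a b c d : R) : convex_plane (box a b c d).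
Proof.
have aux (x y l u t : R) : l < x < u -> l < y < u -> 0 <= t <= 1 -> l < x + t * (y - x) < u.
  move=> /andP[? ?] /andP[? ?] /andP[? ?].
  by have [xy|/ltW xy] := lerP x y; apply/andP; split; nra.
by move=> p q t [p1 p2] [q1 q2] t01; split => /=; exact: aux.
Qed.

Lemma box_connected (a b c d : R) : connected (box a b c d).
Proof. exact/convex_connected/box_convex. Qed.

Lemma ball_box p r : ball p r = box (p.1 - r) (p.1 + r) (p.2 - r) (p.2 + r).
Proof.
apply/seteqP; split => q.
  move=> /ball_square[]; rewrite !ltr_norml => /andP[a b] /andP[c d].
  by split; apply/andP; split; lra.
move=> [/andP[a b] /andP[c d]]; apply/ball_square; rewrite !ltr_norml.
by split; apply/andP; split; lra.
Qed.

Lemma ball_connected p r : connected (ball p r : set (R * R)).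
Proof. rewrite ball_box; exact: box_connected. Qed.

(** Four half squares around the centre cover it, each overlapping the next. *)
Lemma punctured_ball_connected c r : 0 < r -> connected (ball c r `\ c : set (R * R)).
Proof.
move=> r0.
pose B1 := box c.1 (c.1 + r) (c.2 - r) (c.2 + r).
pose B2 := box (c.1 - r) (c.1 + r) c.2 (c.2 + r).
pose B3 := box (c.1 - r) c.1 (c.2 - r) (c.2 + r).
pose B4 := box (c.1 - r) (c.1 + r) (c.2 - r) c.2.
have -> : ball c r `\ c = ((B1 `|` B2) `|` B3) `|` B4.
  rewrite ball_box; apply/seteqP; split => [[x y]|[x y]].
    move=> [[/= /andP[a1 a2] /andP[b1 b2]] /= ne].
    have [xc|xc|xc] := ltgtP x c.1.
    - by left; right; split; apply/andP; split.
    - by left; left; left; split; apply/andP; split.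
    have [yc|yc|yc] := ltgtP y c.2.
    - by right; split; apply/andP; split.
    - by left; left; right; split; apply/andP; split.
    - by exfalso; apply: ne; rewrite xc yc -surjective_pairing.
  have ne1 : x != c.1 -> (x, y) <> c by move=> + E; rewrite -E eqxx.
  have ne2 : y != c.2 -> (x, y) <> c by move=> + E; rewrite -E eqxx.
  move=> [[[|]|]|] [/= /andP[a1 a2] /andP[b1 b2]].
  - split; last by apply: ne1; rewrite gt_eqF.
    by split; apply/andP; split => //=; lra.
  - split; last by apply: ne2; rewrite gt_eqF.
    by split; apply/andP; split => //=; lra.
  - split; last by apply: ne1; rewrite lt_eqF.
    by split; apply/andP; split => //=; lra.
  - split; last by apply: ne2; rewrite lt_eqF.
    by split; apply/andP; split => //=; lra.
apply: connectedU; last exact: box_connected; last first.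
  apply: connectedU; last exact: box_connected; last first.
    apply: connectedU; [|exact: box_connected|exact: box_connected].
    exists (c.1 + r / 2, c.2 + r / 2).
    by split; split; apply/andP; split => /=; lra.
  exists (c.1 - r / 2, c.2 + r / 2); split; first right.
    by split; apply/andP; split => /=; lra.
  by split; apply/andP; split => /=; lra.
exists (c.1 - r / 2, c.2 - r / 2); split; first right.
  by split; apply/andP; split => /=; lra.
by split; apply/andP; split => /=; lra.
Qed.

(** A relatively clopen part of U minus c that meets a small punctured square around c
    contains it; adding c then gives a relatively clopen part of U.  A part that does not meet
    the punctured square is already relatively clopen in U. *)
Lemma connected_setD1 U c : open U -> connected U -> connected (U `\ c).
Proof.
move=> oU cU; have [Uc|nUc] := pselect (U c); last first.
  by rewrite (_ : U `\ c = U)//; apply/seteqP; split => [p []//|p Up]; split => //= pc;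
    apply: nUc; rewrite -pc.
have [r r0 sub] := open_ball oU Uc.
have cP := @punctured_ball_connected c r r0.
move=> B B0 [C oC BC] [D cD BD].
have PU : ball c r `\ c `<=` U `\ c by move=> p [/sub].
have BU : B `<=` U `\ c by move=> p; rewrite BC => -[].
have [meet|nomeet] := pselect ((B `&` (ball c r `\ c)) !=set0).
  have PB : ball c r `\ c `<=` B.
    suff <- : B `&` (ball c r `\ c) = ball c r `\ c by move=> p [].
    apply: cP => //.
    - exists C => //; rewrite BC; apply/seteqP; split => [s [[? ?] ?]//|s [Ps Cs]].
      by split => //; split => //; exact: PU.
    - exists D => //; rewrite BD; apply/seteqP; split => [s [[? ?] ?]//|s [Ps Cs]].
      by split => //; split => //; exact: PU.
  have E : B `|` [set c] = U.
    apply: cU.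
    - by exists c; right.
    - exists (C `|` ball c r); first by apply: openU => //; exact: ball_open.
      apply/seteqP; split => q.
        move=> [Bq|->]; last by split => //; right; exact: ballxx.
        by move: (Bq); rewrite BC => -[[? ?] ?]; split => //; left.
      have [->|qc] := pselect (q = c); first by right.
      by move=> [Uq [Cq|bq]]; left; [rewrite BC|apply: PB].
    - exists (D `|` [set c]).
        by apply: closedU => //; apply: accessible_closed_set1; exact: hausdorff_accessible.
      apply/seteqP; split => q.
        move=> [Bq|->]; last by split => //; right.
        by move: (Bq); rewrite BD => -[[? ?] ?]; split => //; left.
      have [->|qc] := pselect (q = c); first by right.
      by move=> [Uq [Dq|//]]; left; rewrite BD.
  apply/seteqP; split => // q [Uq qc]; move: Uq; rewrite -E => -[//|].
  by move=> /qc.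
exfalso; suff E : B = U by have : B c by [rewrite E]; move=> /BU[_]; exact.
apply: cU => //.
- exists (C `&` ~` [set c]).
    apply: openI => //; apply: closed_openC.
    by apply: accessible_closed_set1; exact: hausdorff_accessible.
  by rewrite BC; apply/seteqP; split => [q [[? ?] ?]|q [? [? ?]]].
- exists (D `&` ~` ball c r).
    by apply: closedI => //; apply: open_closedC; exact: ball_open.
  apply/seteqP; split => q.
    move=> Bq; move: (Bq); rewrite BD => -[[Uq qc] Dq]; split => //; split => // bq.
    by apply: nomeet; exists q.
  move=> [Uq [Dq bq]]; rewrite BD; split => //; split => //= qc.
  by apply: bq; rewrite qc; exact: ballxx.
Qed.

Lemma open_setD1 U c : open U -> open (U `\ c).
Proof.
move=> oU; apply: openI => //; apply: closed_openC.
by apply: accessible_closed_set1; exact: hausdorff_accessible.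
Qed.

End PlaneConnected.

(** * Laplacians of products and compositions *)

Section BiharmonicTransforms.
Variable R : realType.
Implicit Types (F G h : R * R -> R) (U V W : set (R * R)) (p q : R * R).
Local Notation dx := (dir_x R).
Local Notation dy := (dir_y R).

Lemma laplacian_fst q : laplacian (fun r : R * R => r.1) q = 0.
Proof.
rewrite -[RHS](addr0 0).
apply: (@laplacian_eq _ setT _ (fun=> 1) (fun=> 0) q 0 0 openT I).
  by move=> r _; split; [exact: is_derive_fst_x|exact: is_derive_fst_y].
by split; exact: is_derive_cst.
Qed.

Lemma laplacian_snd q : laplacian (fun r : R * R => r.2) q = 0.
Proof.
rewrite -[RHS](addr0 0).
apply: (@laplacian_eq _ setT _ (fun=> 0) (fun=> 1) q 0 0 openT I).
  by move=> r _; split; [exact: is_derive_snd_x|exact: is_derive_snd_y].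
by split; exact: is_derive_cst.
Qed.

Lemma laplacian_norm2 q : laplacian (@norm2 R) q = 4.
Proof.
have -> : (4 : R) = 2 + 2 by ring.
apply: (@laplacian_eq _ setT _ (fun r => 2 * r.1) (fun r => 2 * r.2) q 2 2 openT I).
  by move=> r _; exact: is_derive_norm2.
split.
  have := is_derivePM (is_derive_cst (2 : R) q dx) (is_derive_fst_x q).
  by rewrite /cst mul0r add0r mulr1.
have := is_derivePM (is_derive_cst (2 : R) q dy) (is_derive_snd_y q).
by rewrite /cst mul0r add0r mulr1.
Qed.

(** The Euler operator x d/dx + y d/dy. *)
Definition euler F : R * R -> R := fun q => q.1 * partial_x F q + q.2 * partial_y F q.

Lemma class_C_euler k U F : open U -> class_C k.+1 U F -> class_C k U (euler F).
Proof.
move=> oU CF; apply: (class_CD oU); apply: (class_CM oU).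
- exact: class_C_fst.
- exact: class_C_px CF.
- exact: class_C_snd.
- exact: class_C_py CF.
Qed.

Lemma laplacian_fstM U F p : open U -> class_C 2 U F -> U p ->
  laplacian (fun q => q.1 * F q) p = 2 * partial_x F p + p.1 * laplacian F p.
Proof.
move=> oU CF Up; rewrite (laplacianM oU Up (class_C_fst 2 oU) CF) laplacian_fst.
rewrite (partial_xE (is_derive_fst_x p)) (partial_yE (is_derive_fst_y p)).
by rewrite mul1r !mul0r add0r addr0.
Qed.

Lemma laplacian_sndM U F p : open U -> class_C 2 U F -> U p ->
  laplacian (fun q => q.2 * F q) p = 2 * partial_y F p + p.2 * laplacian F p.
Proof.
move=> oU CF Up; rewrite (laplacianM oU Up (class_C_snd 2 oU) CF) laplacian_snd.
rewrite (partial_xE (is_derive_snd_x p)) (partial_yE (is_derive_snd_y p)).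
by rewrite mul1r !mul0r !add0r.
Qed.

Lemma laplacian_norm2M U F p : open U -> class_C 2 U F -> U p ->
  laplacian (fun q => norm2 q * F q) p =
  4 * F p + 4 * euler F p + norm2 p * laplacian F p.
Proof.
move=> oU CF Up; rewrite (laplacianM oU Up (class_C_norm2 2 oU) CF) laplacian_norm2.
have [nx ny] := is_derive_norm2 p.
rewrite (partial_xE nx) (partial_yE ny) /euler.
by move: (partial_x F p) (partial_y F p) (laplacian F p) => *; ring.
Qed.

Lemma laplacian_partial U F p : open U -> class_C 3 U F -> U p ->
  laplacian (partial_x F) p = partial_x (laplacian F) p /\
  laplacian (partial_y F) p = partial_y (laplacian F) p.
Proof.
move=> oU CF Up.
have Cxx := class_C_px (class_C_px CF); have Cyy := class_C_py (class_C_py CF).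
rewrite (partial_xE (is_deriveD (class_C_dx Cxx Up) (class_C_dx Cyy Up))).
rewrite (partial_yE (is_deriveD (class_C_dy Cxx Up) (class_C_dy Cyy Up))).
have E1 := iter_dy_dx (j := 2) oU CF Up.
have E2 : partial_x (partial_x (partial_y F)) p = partial_y (partial_x (partial_x F)) p.
  apply: (etrans (@partial_x_ext _ U _ (partial_y (partial_x F)) p oU Up _)).
    by move=> q Uq; exact: (esym (Schwarz oU (class_C_pred CF) Uq)).
  exact: (esym (Schwarz oU (class_C_px CF) Up)).
by split; [exact: (congr2 +%R (erefl _) E1)|exact: (congr2 +%R E2 (erefl _))].
Qed.

Lemma laplacian_euler U F p : open U -> class_C 3 U F -> U p ->
  laplacian (euler F) p = euler (laplacian F) p + 2 * laplacian F p.
Proof.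
move=> oU CF Up; have Cx := class_C_px CF; have Cy := class_C_py CF.
rewrite (laplacianD oU Up (class_CM oU (class_C_fst 2 oU) Cx)
  (class_CM oU (class_C_snd 2 oU) Cy)).
rewrite (laplacian_fstM oU Cx Up) (laplacian_sndM oU Cy Up).
have [-> ->] := laplacian_partial oU CF Up.
rewrite /euler /laplacian.
move: (partial_x (partial_x F) p) (partial_y (partial_y F) p).
by move: (partial_x _ p) (partial_y _ p) => *; ring.
Qed.

Lemma biharmonicD U F G : open U -> biharmonic U F -> biharmonic U G ->
  biharmonic U (fun p => F p + G p).
Proof.
move=> oU [CF bF] [CG bG]; split; first exact: class_CD.
have CF2 := class_C_pred (class_C_pred CF); have CG2 := class_C_pred (class_C_pred CG).
move=> p Up.
rewrite (@laplacian_ext _ U _ (fun q => laplacian F q + laplacian G q) p oU Up); last first.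
  by move=> q Uq; exact: (laplacianD oU Uq CF2 CG2).
rewrite (laplacianD oU Up (class_C_laplacian oU CF) (class_C_laplacian oU CG)).
exact: etrans (congr2 +%R (bF p Up) (bG p Up)) (addr0 0).
Qed.

Lemma biharmonicZ U F (c : R) : open U -> biharmonic U F -> biharmonic U (fun p => c * F p).
Proof.
move=> oU [CF bF]; split; first exact: class_CZ.
have CF2 := class_C_pred (class_C_pred CF).
move=> p Up.
rewrite (@laplacian_ext _ U _ (fun q => c * laplacian F q) p oU Up); last first.
  by move=> q Uq; exact: (laplacianZ _ oU Uq CF2).
by rewrite (laplacianZ _ oU Up (class_C_laplacian oU CF)) (bF p Up) mulr0.
Qed.

(** Used in the form of Almansi: the Laplacians of x h, y h and (x^2 + y^2) h are harmonic
    when h is. *)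
Lemma laplacian_harmonic_biharmonic U F G : open U -> class_C 4 U F ->
  (forall p, U p -> laplacian F p = G p) -> (forall p, U p -> laplacian G p = 0) ->
  biharmonic U F.
Proof.
move=> oU CF FG hG; split; first exact: CF.
move=> p Up; by rewrite (laplacian_ext oU Up FG) (hG p Up).
Qed.

Section Almansi.
Variables (U : set (R * R)) (h : R * R -> R).
Hypotheses (oU : open U) (Ch : class_C 4 U h) (harm : forall p, U p -> laplacian h p = 0).

Let Ch3 := class_C_pred Ch.
Let Ch2 := class_C_pred Ch3.

Let partial_laplacian0 p : U p ->
  partial_x (laplacian h) p = 0 /\ partial_y (laplacian h) p = 0.
Proof.
move=> Up; rewrite (partial_x_ext oU Up harm) (partial_y_ext oU Up harm).
exact: partial_cst.
Qed.

Lemma harmonic_biharmonic : biharmonic U h.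
Proof.
apply: (laplacian_harmonic_biharmonic oU Ch harm) => p _; exact: laplacian_cst.
Qed.

Lemma harmonic_fstM : biharmonic U (fun q => q.1 * h q).
Proof.
apply: (@laplacian_harmonic_biharmonic _ _ (fun q => 2 * partial_x h q) oU).
- exact: (class_CM oU (class_C_fst 4 oU) Ch).
- by move=> p Up; rewrite (laplacian_fstM oU Ch2 Up) (harm Up) mulr0 addr0.
- move=> p Up; rewrite (laplacianZ _ oU Up (class_C_px Ch3)).
  rewrite (proj1 (laplacian_partial oU Ch3 Up)) (proj1 (partial_laplacian0 Up)).
  by rewrite mulr0.
Qed.

Lemma harmonic_sndM : biharmonic U (fun q => q.2 * h q).
Proof.
apply: (@laplacian_harmonic_biharmonic _ _ (fun q => 2 * partial_y h q) oU).
- exact: (class_CM oU (class_C_snd 4 oU) Ch).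
- by move=> p Up; rewrite (laplacian_sndM oU Ch2 Up) (harm Up) mulr0 addr0.
- move=> p Up; rewrite (laplacianZ _ oU Up (class_C_py Ch3)).
  rewrite (proj2 (laplacian_partial oU Ch3 Up)) (proj2 (partial_laplacian0 Up)).
  by rewrite mulr0.
Qed.

Lemma harmonic_norm2M : biharmonic U (fun q => norm2 q * h q).
Proof.
have CE := class_C_euler oU Ch3.
apply: (@laplacian_harmonic_biharmonic _ _ (fun q => 4 * h q + 4 * euler h q) oU).
- exact: (class_CM oU (class_C_norm2 4 oU) Ch).
- by move=> p Up; rewrite (laplacian_norm2M oU Ch2 Up) (harm Up) mulr0 addr0.
- move=> p Up; rewrite (laplacianD oU Up (class_CZ _ oU Ch2) (class_CZ _ oU CE)).
  rewrite (laplacianZ _ oU Up Ch2) (laplacianZ _ oU Up CE) (laplacian_euler oU Ch3 Up).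
  have [px py] := partial_laplacian0 Up.
  by rewrite /euler px py (harm Up) !(mulr0, addr0).
Qed.

End Almansi.

(** A change of variables with harmonic components whose gradients are orthogonal and of
    the same length is conformal: the Laplacian is multiplied by the square of this length. *)
Lemma laplacian_comp W V h a b mu p : open W -> open V -> class_C 2 V h ->
  class_C 2 W a -> class_C 2 W b -> (forall q, W q -> V (a q, b q)) -> W p ->
  laplacian a p = 0 -> laplacian b p = 0 ->
  partial_x a p * partial_x b p + partial_y a p * partial_y b p = 0 ->
  partial_x a p ^+ 2 + partial_y a p ^+ 2 = mu ->
  partial_x b p ^+ 2 + partial_y b p ^+ 2 = mu ->
  laplacian (fun q => h (a q, b q)) p = mu * laplacian h (a p, b p).
Proof.
move=> oW oV Ch Ca Cb WV Wp la lb ab aa bb.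
have Ca1 := class_C_pred Ca; have Cb1 := class_C_pred Cb; have Ch1 := class_C_pred Ch.
have da q (Wq : W q) := @ex_diff _ _ _ _ _ _ _ (C1_diff oW Ca1 Wq).
have db q (Wq : W q) := @ex_diff _ _ _ _ _ _ _ (C1_diff oW Cb1 Wq).
have ch F q : class_C 1 V F -> W q ->
  is_derive q dx (fun r => F (a r, b r))
    (partial_x a q * partial_x F (a q, b q) + partial_x b q * partial_y F (a q, b q)) /\
  is_derive q dy (fun r => F (a r, b r))
    (partial_y a q * partial_x F (a q, b q) + partial_y b q * partial_y F (a q, b q)).
  move=> CF Wq; split; apply: (chain_rule oV CF (WV q Wq) (da q Wq) (db q Wq)).
  - exact: class_C_dx Ca1 _ Wq.
  - exact: class_C_dx Cb1 _ Wq.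
  - exact: class_C_dy Ca1 _ Wq.
  - exact: class_C_dy Cb1 _ Wq.
have [dxx dxy] := ch _ p (class_C_px Ch) Wp.
have [dyx dyy] := ch _ p (class_C_py Ch) Wp.
have D1 := is_deriveD (is_derivePM (class_C_dx (class_C_px Ca) Wp) dxx)
  (is_derivePM (class_C_dx (class_C_px Cb) Wp) dyx).
have D2 := is_deriveD (is_derivePM (class_C_dy (class_C_py Ca) Wp) dxy)
  (is_derivePM (class_C_dy (class_C_py Cb) Wp) dyy).
rewrite (laplacian_eq oW Wp (fun q Wq => ch h q Ch1 Wq) (conj D1 D2)).
move: la lb ab aa bb; rewrite /laplacian.
rewrite (Schwarz oV Ch (WV p Wp)).
move: (partial_x (partial_x a) p) (partial_y (partial_y a) p)
  (partial_x (partial_x b) p) (partial_y (partial_y b) p)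
  (partial_x a p) (partial_y a p) (partial_x b p) (partial_y b p).
move: (partial_x (partial_x h) (a p, b p)) (partial_y (partial_y h) (a p, b p))
  (partial_x (partial_y h) (a p, b p)) (partial_x h (a p, b p)) (partial_y h (a p, b p)).
clear => hxx hyy hxy hx hy axx ayy bxx byy ax ay bx by_ la lb ab aa bb.
have -> : ayy = - axx by lra.
have -> : byy = - bxx by lra.
transitivity ((ax ^+ 2 + ay ^+ 2) * hxx + (bx ^+ 2 + by_ ^+ 2) * hyy +
  2 * (ax * bx + ay * by_) * hxy); first by ring.
by rewrite aa bb ab; ring.
Qed.

End BiharmonicTransforms.

(** * Inversion, rotation and translation of biharmonic functions *)

Section Kelvin.
Variable R : realType.
Implicit Types (F G h : R * R -> R) (U V W : set (R * R)) (p q : R * R).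
Local Notation dx := (dir_x R).
Local Notation dy := (dir_y R).

(** Inversion in the unit circle, as the complex conjugate of 1 / z. *)
Definition inv_pt q : R * R := (re_inv q, - im_inv q).

Lemma inv_ptE q : inv_pt q = (q.1 / norm2 q, q.2 / norm2 q).
Proof. by rewrite /inv_pt /re_inv /im_inv opprK. Qed.

Lemma norm2_inv_pt q : punctured q -> norm2 (inv_pt q) = (norm2 q)^-1.
Proof.
move=> q0; have n0 : norm2 q != 0 by rewrite gt_eqF.
by rewrite inv_ptE; move: n0; rewrite /norm2 /= => n0; field.
Qed.

Lemma punctured_inv_pt q : punctured q -> punctured (inv_pt q).
Proof. by move=> q0; rewrite /punctured /= norm2_inv_pt// invr_gt0. Qed.

Lemma inv_ptK q : punctured q -> inv_pt (inv_pt q) = q.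
Proof.
move=> q0; have n0 : norm2 q != 0 by rewrite gt_eqF.
rewrite [LHS]inv_ptE norm2_inv_pt// inv_ptE invrK /= !mulfVK//.
by rewrite -surjective_pairing.
Qed.

Definition inv_set U : set (R * R) := punctured (R:=R) `&` [set q | U (inv_pt q)].

Lemma inv_pt_continuous q : punctured q -> {for q, continuous inv_pt}.
Proof.
move=> q0; have CI := class_CN (@open_punctured R) (@class_C_im_inv R 0).
exact: (pair_continuous (class_C_cont (@class_C_re_inv R 0) q0) (class_C_cont CI q0)).
Qed.

Lemma open_inv_set U : open U -> open (inv_set U).
Proof.
move=> oU; rewrite openE => q [q0 Uq]; apply: filterI.
  by apply: open_nbhs_nbhs; split => //; exact: open_punctured.
apply: (inv_pt_continuous q0 (_ : nbhs (inv_pt q) U)).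
exact: open_nbhs_nbhs.
Qed.

(** The action of the spatial inversion (x, y, z) |-> (x, y, z) / (x^2 + y^2) on graphs. *)
Definition kelvin F : R * R -> R := fun q => norm2 q * F (inv_pt q).

Lemma partial_inv q : punctured q ->
  let m := (q.2 ^+ 2 - q.1 ^+ 2) / norm2 q ^+ 2 in
  let n := - (2 * q.1 * q.2) / norm2 q ^+ 2 in
  [/\ partial_x (@re_inv R) q = m, partial_y (@re_inv R) q = n,
      partial_x (fun r => - im_inv r) q = n & partial_y (fun r => - im_inv r) q = - m].
Proof.
move=> q0 m n; have n0 : norm2 q != 0 by rewrite gt_eqF.
have [nx ny] := is_derive_norm2 q.
have ix := is_derivePV n0 nx; have iy := is_derivePV n0 ny.
have dI := class_CN (@open_punctured R) (@class_C_im_inv R 1).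
have [e1 e2] := CR_inv q0.
have Em : partial_x (@re_inv R) q = m.
  rewrite (partial_xE (is_derivePM (is_derive_fst_x q) ix)) /m.
  by move: n0; rewrite /norm2 => n0; field.
have En : partial_y (@re_inv R) q = n.
  rewrite (partial_yE (is_derivePM (is_derive_fst_y q) iy)) /n.
  by move: n0; rewrite /norm2 => n0; field.
split => //.
- rewrite (partial_xE (is_deriveN (class_C_dx (@class_C_im_inv R 1) q0))).
  by rewrite -En e2.
- rewrite (partial_yE (is_deriveN (class_C_dy (@class_C_im_inv R 1) q0))).
  by rewrite -Em e1.
Qed.

Lemma class_C_inv k : class_C k (@punctured R) (@re_inv R) /\
  class_C k (@punctured R) (fun r => - im_inv r).
Proof.
split; first exact: class_C_re_inv.
exact: (class_CN (@open_punctured R) (@class_C_im_inv R k)).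
Qed.

Lemma laplacian_inv U F p : open U -> class_C 2 U F -> inv_set U p ->
  laplacian (fun q => F (inv_pt q)) p = (norm2 p ^+ 2)^-1 * laplacian F (inv_pt p).
Proof.
move=> oU CF [p0 Up]; have oW := open_inv_set oU.
have WP : inv_set U `<=` @punctured R by move=> q [].
have [Ca Cb] := class_C_inv 2.
have [e1 e2 e3 e4] := partial_inv p0.
have n0 : norm2 p != 0 by rewrite gt_eqF.
have [la lb] := CR_harmonic (@open_punctured R) Ca (@class_C_im_inv R 2) (@CR_inv R) p0.
apply: (laplacian_comp oW oU CF (class_C_sub WP Ca) (class_C_sub WP Cb) _ _ la).
- by move=> q [].
- by split.
- have oP := @open_punctured R.
  have -> : (fun q : R * R => - im_inv q) = (fun q => -1 * im_inv q).
    by apply/funext => q; rewrite mulN1r.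
  by rewrite (laplacianZ _ oP p0 (@class_C_im_inv R 2)) lb mulr0.
- by rewrite e1 e2 e3 e4; ring.
- by rewrite e1 e2; move: n0; rewrite /norm2 => n0; field.
- by rewrite e3 e4; move: n0; rewrite /norm2 => n0; field.
Qed.

Lemma euler_inv U F p : open U -> class_C 1 U F -> inv_set U p ->
  euler (fun q => F (inv_pt q)) p = - euler F (inv_pt p).
Proof.
move=> oU CF [p0 Up]; have [Ca Cb] := class_C_inv 1.
have [e1 e2 e3 e4] := partial_inv p0.
have n0 : norm2 p != 0 by rewrite gt_eqF.
have da := @ex_diff _ _ _ _ _ _ _ (C1_diff (@open_punctured R) Ca p0).
have db := @ex_diff _ _ _ _ _ _ _ (C1_diff (@open_punctured R) Cb p0).
have ch := chain_rule oU CF Up da db.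
rewrite /euler (partial_xE (ch _ _ _ (class_C_dx Ca p0) (class_C_dx Cb p0))).
rewrite (partial_yE (ch _ _ _ (class_C_dy Ca p0) (class_C_dy Cb p0))).
rewrite e1 e2 e3 e4 -[(re_inv p, - im_inv p)]/(inv_pt p).
move: (partial_x F (inv_pt p)) (partial_y F (inv_pt p)) => u w.
rewrite inv_ptE /=; move: n0; rewrite /norm2 => n0; field.
by [].
Qed.

(** The Laplacian of the transform is L composed with the inversion, where
    L = 4 F - 4 E F + r^2 Lap F with the Euler operator E.  From Lap E = E Lap + 2 Lap one finds
    that L is harmonic, and inversion is conformal. *)
Theorem biharmonic_kelvin U F : open U -> biharmonic U F ->
  biharmonic (inv_set U) (kelvin F).
Proof.
move=> oU [CF bF].
have oW := open_inv_set oU.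
have WP : inv_set U `<=` @punctured R by move=> q [].
have WU q : inv_set U q -> U (re_inv q, - im_inv q) by move=> [].
have CI k G : class_C k U G -> class_C k (inv_set U) (fun q => G (inv_pt q)).
  move=> CG; have [Ca Cb] := class_C_inv k.
  exact: (class_C_comp oW oU CG (class_C_sub WP Ca) (class_C_sub WP Cb) WU).
have CF3 := class_C_pred CF; have CF2 := class_C_pred CF3.
have CE := class_C_pred (class_C_euler oU CF).
have CL := class_C_laplacian oU CF.
have CN := class_C_norm2 2 oU.
pose L := fun q => (4 * F q - 4 * euler F q) + norm2 q * laplacian F q.
have CLL : class_C 2 U L.
  apply: (class_CD oU); first exact: (class_CB oU (class_CZ _ oU CF2) (class_CZ _ oU CE)).
  exact: (class_CM oU CN CL).
have lapL q : U q -> laplacian L q = 0.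
  move=> Uq.
  rewrite (laplacianD oU Uq (class_CB oU (class_CZ _ oU CF2) (class_CZ _ oU CE))
    (class_CM oU CN CL)).
  rewrite (laplacianB oU Uq (class_CZ _ oU CF2) (class_CZ _ oU CE)).
  rewrite (laplacianZ _ oU Uq CF2) (laplacianZ _ oU Uq CE).
  rewrite (laplacian_euler oU CF3 Uq) (laplacian_norm2M oU CL Uq) (bF q Uq).
  by move: (laplacian F q) (euler (laplacian F) q) => *; ring.
apply: (@laplacian_harmonic_biharmonic _ _ _ (fun q => L (inv_pt q)) oW).
- exact: (class_CM oW (class_C_norm2 4 oW) (CI 4 F CF)).
- move=> q Wq; rewrite /kelvin (laplacian_norm2M oW (CI 2 F CF2) Wq).
  rewrite (laplacian_inv oU CF2 Wq) (euler_inv oU (class_C_pred CF2) Wq).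
  have n0 : norm2 q != 0 by rewrite gt_eqF//; case: Wq.
  rewrite /L norm2_inv_pt; last by case: Wq.
  move: (laplacian F (inv_pt q)) (euler F (inv_pt q)) (F (inv_pt q)) => u w z.
  by field.
- by move=> q Wq; rewrite (laplacian_inv oU CLL Wq) lapL ?mulr0//; case: Wq.
Qed.

Definition rotate (c s : R) (q : R * R) : R * R := (c * q.1 + s * q.2, c * q.2 - s * q.1).

Lemma class_C_lin k U (a b : R) : open U ->
  class_C k U (fun q : R * R => a * q.1 + b * q.2).
Proof.
move=> oU; apply: (class_CD oU); apply: (class_CZ _ oU).
  exact: class_C_fst.
exact: class_C_snd.
Qed.

Lemma is_derive_lin (a b : R) q : is_derive q dx (fun q : R * R => a * q.1 + b * q.2) a /\
  is_derive q dy (fun q : R * R => a * q.1 + b * q.2) b.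
Proof.
split.
  have := is_deriveD (is_derivePM (is_derive_cst a q dx) (is_derive_fst_x q))
    (is_derivePM (is_derive_cst b q dx) (is_derive_snd_x q)).
  by rewrite /cst; congr is_derive; ring.
have := is_deriveD (is_derivePM (is_derive_cst a q dy) (is_derive_fst_y q))
  (is_derivePM (is_derive_cst b q dy) (is_derive_snd_y q)).
by rewrite /cst; congr is_derive; ring.
Qed.

Lemma laplacian_lin (a b : R) q : laplacian (fun q : R * R => a * q.1 + b * q.2) q = 0.
Proof.
rewrite -[RHS](addr0 0).
apply: (@laplacian_eq _ setT _ (fun=> a) (fun=> b) q 0 0 openT I).
  by move=> r _; exact: is_derive_lin.
by split; exact: is_derive_cst.
Qed.

Lemma rotate_continuous c s : continuous (rotate c s).
Proof.
move=> q; have e : (fun r : R * R => c * r.2 - s * r.1) = (fun r => - s * r.1 + c * r.2).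
  by apply/funext => r; ring.
have c1 := class_C_cont (class_C_lin 0 c s openT) (I : setT q).
have c2 := class_C_cont (class_C_lin 0 (- s) c openT) (I : setT q).
by rewrite -e in c2; exact: (pair_continuous c1 c2).
Qed.

Lemma open_rotate c s U : open U -> open (rotate c s @^-1` U).
Proof. by move=> oU; have /continuousP h := @rotate_continuous c s; exact: h. Qed.

Lemma biharmonic_rotate c s U F : c ^+ 2 + s ^+ 2 = 1 -> open U -> biharmonic U F ->
  biharmonic (rotate c s @^-1` U) (fun q => F (rotate c s q)).
Proof.
move=> cs oU [CF bF]; have oW := @open_rotate c s U oU; set W := rotate c s @^-1` U in oW *.
have E : (fun r : R * R => c * r.2 - s * r.1) = (fun r => - s * r.1 + c * r.2).
  by apply/funext => r; ring.
have Ca k := class_C_lin k c s oW.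
have Cb k : class_C k W (fun r : R * R => c * r.2 - s * r.1).
  by rewrite E; exact: class_C_lin.
have WU q : W q -> U (c * q.1 + s * q.2, c * q.2 - s * q.1) by [].
have lap G p : class_C 2 U G -> W p -> laplacian (fun q => G (rotate c s q)) p = laplacian G (rotate c s p).
  move=> CG Wp; have [ax ay] := is_derive_lin c s p.
  have [bx by_] := is_derive_lin (- s) c p.
  rewrite -[RHS]mul1r.
  apply: (laplacian_comp oW oU CG (Ca 2) (Cb 2) WU Wp).
  - exact: laplacian_lin.
  - by rewrite E laplacian_lin.
  - by rewrite E (partial_xE ax) (partial_yE ay) (partial_xE bx) (partial_yE by_); ring.
  - by rewrite (partial_xE ax) (partial_yE ay).
  - by rewrite E (partial_xE bx) (partial_yE by_) sqrrN addrC.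
have CF2 := class_C_pred (class_C_pred CF).
apply: (@laplacian_harmonic_biharmonic _ _ _ (fun q => laplacian F (rotate c s q)) oW).
- exact: (class_C_comp oW oU CF (Ca 4) (Cb 4) WU).
- by move=> p Wp; exact: lap CF2 Wp.
- by move=> p Wp; rewrite (lap _ _ (class_C_laplacian oU CF) Wp) bF.
Qed.

Lemma biharmonic_tr v U F : open U -> biharmonic U F ->
  biharmonic (translate v U) (fun q => F (q.1 + v.1, q.2 + v.2)).
Proof.
move=> oU [CF bF]; split; first exact: (@class_C_tr _ 4 v U F oU CF).
move=> p Up; have -> : laplacian (fun q => F (q.1 + v.1, q.2 + v.2)) =
    (fun q => laplacian F (q.1 + v.1, q.2 + v.2)).
  by apply/funext => q; rewrite laplacian_tr.
by rewrite laplacian_tr bF.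
Qed.

End Kelvin.

(** * The canonical functions *)

Section Family.
Variable R : realType.
Implicit Types (F G h T : R * R -> R) (U V W H : set (R * R)) (p q : R * R).
Local Notation dx := (dir_x R).
Local Notation dy := (dir_y R).

(** With t the polar angle and r^2 = x^2 + y^2, the parameters are the coefficients of
    r^2 t, x t, y t, t, y^2 / r^2, x y / r^2, y^2, x y, r^2, x, y and 1.  Compared with the
    canonical surface there are the extra term y t, which a rotation removes, and an
    i-M-sphere, which a shear removes. *)
Record params := Params { pa1 : R; pa2 : R; pa2' : R; pa3 : R; pb1 : R; pb2 : R;
  pc1 : R; pc2 : R; pe : R; pf : R; pg : R; ph : R }.

Definition angular_part (P : params) (q : R * R) : R :=
  pa1 P * norm2 q + pa2 P * q.1 + pa2' P * q.2 + pa3 P.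

Definition canonical_fun (P : params) (t : R) (q : R * R) : R :=
  angular_part P q * t + (pb1 P * q.2 ^+ 2 + pb2 P * q.1 * q.2) / norm2 q
  + (pc1 P * q.2 ^+ 2 + pc2 P * q.1 * q.2)
  + (pe P * norm2 q + pf P * q.1 + pg P * q.2 + ph P).

(** The gradient of the polar angle is (Im, Re) of 1 / z. *)
Definition angle_branch H T := forall q, H q ->
  is_derive q dx T (im_inv q) /\ is_derive q dy T (re_inv q).

Lemma class_C_angle k H T : open H -> H `<=` @punctured R -> angle_branch H T ->
  (forall q, H q -> {for q, continuous T}) -> class_C k H T.
Proof.
move=> oH HP aT cT; case: k => [|k]; first exact: cT.
apply: (class_CS oH cT aT).
  exact: class_C_sub HP (@class_C_im_inv R k).
exact: class_C_sub HP (@class_C_re_inv R k).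
Qed.

Lemma laplacian_angle H T p : open H -> H `<=` @punctured R -> angle_branch H T -> H p ->
  laplacian T p = 0.
Proof.
move=> oH HP aT Hp; have p0 := HP p Hp.
rewrite (laplacian_eq oH Hp aT (conj (class_C_dx (@class_C_im_inv R 1) p0)
  (class_C_dy (@class_C_re_inv R 1) p0))).
by have [_ ->] := CR_inv p0; rewrite addrN.
Qed.

Lemma CR_id : CR setT (fun q : R * R => q.1) (fun q => q.2).
Proof.
move=> q _; rewrite (partial_xE (is_derive_fst_x q)) (partial_yE (is_derive_snd_y q)).
by rewrite (partial_yE (is_derive_fst_y q)) (partial_xE (is_derive_snd_x q)) oppr0.
Qed.

Theorem biharmonic_canonical_fun H T P : open H -> H `<=` @punctured R -> angle_branch H T ->
  (forall q, H q -> {for q, continuous T}) -> biharmonic H (fun q => canonical_fun P (T q) q).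
Proof.
move=> oH HP aT cT.
have CT := class_C_angle 4 oH HP aT cT.
have lT p (Hp : H p) := laplacian_angle oH HP aT Hp.
have C1 := @class_C_cst R 4 H 1 oH.
have l1 p (Hp : H p) := laplacian_cst (1 : R) p.
have [Cw1 Cw2 _] := @inv_powP R 4 2.
have [Cw1' Cw2' crw] := @inv_powP R 2 2.
have CW1 := class_C_sub HP Cw1; have CW2 := class_C_sub HP Cw2.
have lw p (Hp : H p) := CR_harmonic (@open_punctured R) Cw1' Cw2' crw (HP p Hp).
have lw1 p (Hp : H p) := proj1 (lw p Hp); have lw2 p (Hp : H p) := proj2 (lw p Hp).
pose z1 := fun q : R * R => q.1 * q.1 - q.2 * q.2.
pose z2 := fun q : R * R => q.1 * q.2 + q.2 * q.1.
have Cf k (V : set (R * R)) (oV : open V) := class_C_fst (R := R) k oV.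
have Cs k (V : set (R * R)) (oV : open V) := class_C_snd (R := R) k oV.
have Cz1 k (V : set (R * R)) (oV : open V) : class_C k V z1 :=
  class_CB oV (class_CM oV (Cf k V oV) (Cf k V oV)) (class_CM oV (Cs k V oV) (Cs k V oV)).
have Cz2 k (V : set (R * R)) (oV : open V) : class_C k V z2 :=
  class_CD oV (class_CM oV (Cf k V oV) (Cs k V oV)) (class_CM oV (Cs k V oV) (Cf k V oV)).
have crz : CR setT z1 z2.
  exact: (CR_mul openT (Cf 1 _ openT) (Cs 1 _ openT) (Cf 1 _ openT) (Cs 1 _ openT) CR_id CR_id).
have lz p := CR_harmonic openT (Cz1 2 _ openT) (Cz2 2 _ openT) crz (I : setT p).
have lz1 p (Hp : H p) := proj1 (lz p); have lz2 p (Hp : H p) := proj2 (lz p).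
have Z c F : biharmonic H F -> biharmonic H (fun p => c * F p) := biharmonicZ c oH.
have D F G : biharmonic H F -> biharmonic H G -> biharmonic H (fun p => F p + G p) :=
  @biharmonicD R H F G oH.
have B1 := D _ _ (D _ _ (Z (pa3 P) _ (harmonic_biharmonic oH CT lT))
  (Z (pa2 P) _ (harmonic_fstM oH CT lT)))
  (D _ _ (Z (pa2' P) _ (harmonic_sndM oH CT lT)) (Z (pa1 P) _ (harmonic_norm2M oH CT lT))).
have B2 := D _ _ (D _ _ (Z (ph P + pb1 P / 2) _ (harmonic_biharmonic oH C1 l1))
  (Z (pf P) _ (harmonic_fstM oH C1 l1)))
  (D _ _ (Z (pg P) _ (harmonic_sndM oH C1 l1)) (Z (pe P + pc1 P / 2) _ (harmonic_norm2M oH C1 l1))).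
have B3 := D _ _ (D _ _ (Z (- pb1 P / 2) _ (harmonic_norm2M oH CW1 lw1))
  (Z (- pb2 P / 2) _ (harmonic_norm2M oH CW2 lw2)))
  (D _ _ (Z (- pc1 P / 2) _ (harmonic_biharmonic oH (Cz1 4 H oH) lz1))
   (Z (pc2 P / 2) _ (harmonic_biharmonic oH (Cz2 4 H oH) lz2))).
apply: (biharmonic_ext oH _ (D _ _ (D _ _ B1 B2) B3)) => q Hq.
have n0 : norm2 q != 0 by rewrite gt_eqF//; exact: HP.
rewrite /canonical_fun /angular_part /z1 /z2 /= /re_inv /im_inv.
move: (T q); move: n0; rewrite /norm2; move: q.1 q.2; clear => x y n0 t.
by field.
Qed.

(** Two angular charts cover the punctured plane, one off each axis; their angles are
    arctan (y / x) and pi / 2 - arctan (x / y). *)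
Definition Hx : set (R * R) := [set q | q.1 != 0].
Definition Hy : set (R * R) := [set q | q.2 != 0].
Definition Tx (q : R * R) : R := atan (q.2 / q.1).
Definition Ty (q : R * R) : R := pi / 2 - atan (q.1 / q.2).

Lemma norm2_gt0x q : q.1 != 0 -> 0 < norm2 q.
Proof.
move=> x0; rewrite /norm2 -!expr2 ltr_wpDr ?sqr_ge0//.
by rewrite exprn_even_gt0.
Qed.

Lemma norm2_gt0y q : q.2 != 0 -> 0 < norm2 q.
Proof.
move=> x0; rewrite /norm2 -!expr2 ltr_wpDl ?sqr_ge0//.
by rewrite exprn_even_gt0.
Qed.

Lemma Hx_punctured : Hx `<=` @punctured R. Proof. by move=> q; exact: norm2_gt0x. Qed.
Lemma Hy_punctured : Hy `<=` @punctured R. Proof. by move=> q; exact: norm2_gt0y. Qed.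

Lemma open_Hx : open Hx.
Proof.
have /continuousP h : continuous (fun p : R * R => p.1) by move=> p; exact: cvg_fst.
exact: (h [set x | x != 0] (@open_neq _ 0)).
Qed.

Lemma open_Hy : open Hy.
Proof.
have /continuousP h : continuous (fun p : R * R => p.2) by move=> p; exact: cvg_snd.
exact: (h [set x | x != 0] (@open_neq _ 0)).
Qed.

Lemma is_derive_atan_comp F q a b : is_derive q dx F a -> is_derive q dy F b ->
  is_derive q dx (fun r => atan (F r)) ((1 + F q ^+ 2)^-1 * a) /\
  is_derive q dy (fun r => atan (F r)) ((1 + F q ^+ 2)^-1 * b).
Proof.
move=> /slice_x da /slice_y db; split.
  apply/slice_x; apply: (@is_derive1_comp R (@atan R) (fun t => F (t, q.2))).
  by rewrite -surjective_pairing; exact: is_derive1_atan.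
apply/slice_y; apply: (@is_derive1_comp R (@atan R) (fun t => F (q.1, t))).
by rewrite -surjective_pairing; exact: is_derive1_atan.
Qed.

Lemma angle_branch_Tx : angle_branch Hx Tx.
Proof.
move=> q; rewrite /Hx /= => x0; have n0 : norm2 q != 0 by rewrite gt_eqF//; exact: norm2_gt0x.
have x1 := is_derivePV x0 (is_derive_fst_x q); have y1 := is_derivePV x0 (is_derive_fst_y q).
have [h1 h2] := is_derive_atan_comp (is_derivePM (is_derive_snd_x q) x1)
  (is_derivePM (is_derive_snd_y q) y1).
split; [have := h1|have := h2]; congr is_derive; rewrite /im_inv /re_inv;
  by move: n0 x0; rewrite /norm2; move: q.1 q.2; clear => x y n0 x0; field; rewrite ?x0 ?n0 //; by rewrite ?(addrC (y * y)) ?n0.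
Qed.

Lemma angle_branch_Ty : angle_branch Hy Ty.
Proof.
move=> q; rewrite /Hy /= => y0; have n0 : norm2 q != 0 by rewrite gt_eqF//; exact: norm2_gt0y.
have x1 := is_derivePV y0 (is_derive_snd_x q); have y1 := is_derivePV y0 (is_derive_snd_y q).
have [h1 h2] := is_derive_atan_comp (is_derivePM (is_derive_fst_x q) x1)
  (is_derivePM (is_derive_fst_y q) y1).
split; [have := is_deriveB (is_derive_cst (pi / 2 : R) q dx) h1
       |have := is_deriveB (is_derive_cst (pi / 2 : R) q dy) h2];
  congr is_derive; rewrite /im_inv /re_inv;
  by move: n0 y0; rewrite /norm2; move: q.1 q.2; clear => x y n0 y0; field; rewrite ?y0 ?n0 //; by rewrite ?(addrC (y * y)) ?n0.
Qed.

Lemma Tx_continuous q : Hx q -> {for q, continuous Tx}.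
Proof.
move=> x0; have oH := open_Hx.
have CV := class_CV oH (fun _ hq => hq) (class_C_fst (R := R) 0 oH).
have c := class_C_cont (class_CM oH (class_C_snd 0 oH) CV) x0.
exact: (continuous_comp c (@continuous_atan R _)).
Qed.

Lemma Ty_continuous q : Hy q -> {for q, continuous Ty}.
Proof.
move=> y0; have oH := open_Hy.
have CV := class_CV oH (fun _ hq => hq) (class_C_snd (R := R) 0 oH).
have c := class_C_cont (class_CM oH (class_C_fst 0 oH) CV) y0.
apply: continuousB; first exact: cst_continuous.
exact: (continuous_comp c (@continuous_atan R _)).
Qed.

Lemma angle_branchD H T (c : R) : angle_branch H T -> angle_branch H (fun q => T q + c).
Proof.
move=> aT q Hq; have [a b] := aT q Hq; split.
  by have := is_deriveD a (is_derive_cst c q dx); rewrite addr0.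
by have := is_deriveD b (is_derive_cst c q dy); rewrite addr0.
Qed.

Lemma biharmonic_canonical_x P c : biharmonic Hx (fun q => canonical_fun P (Tx q + c) q).
Proof.
apply: (biharmonic_canonical_fun P open_Hx Hx_punctured (angle_branchD c angle_branch_Tx)) => q Hq.
by apply: continuousD; [exact: Tx_continuous|exact: cst_continuous].
Qed.

Lemma biharmonic_canonical_y P c : biharmonic Hy (fun q => canonical_fun P (Ty q + c) q).
Proof.
apply: (biharmonic_canonical_fun P open_Hy Hy_punctured (angle_branchD c angle_branch_Ty)) => q Hq.
by apply: continuousD; [exact: Ty_continuous|exact: cst_continuous].
Qed.

End Family.

(** * Jets of functions of the slope *)

Section Jets.
Variable R : realType.
Implicit Types (f g : R -> R).

(** Third-order Taylor data at 0.  Intermediate derivatives are existentially quantified, so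
    that products and sums of jets are computed by formulas on numbers only. *)
Definition jet3 f (d0 d1 d2 d3 : R) : Prop :=
  exists f1 f2 f3 : R -> R, exists2 e : R, 0 < e &
  [/\ forall s, `|s| < e -> is_derive s (1 : R) f (f1 s),
      forall s, `|s| < e -> is_derive s (1 : R) f1 (f2 s),
      forall s, `|s| < e -> is_derive s (1 : R) f2 (f3 s),
      {for 0, continuous f3} &
      [/\ f 0 = d0, f1 0 = d1, f2 0 = d2 & f3 0 = d3]].

Lemma is_derive_continuous f x d : is_derive x (1 : R) f d -> {for x, continuous f}.
Proof. by move=> [df _]; apply: differentiable_continuous; exact/derivable1_diffP. Qed.

Lemma jet_eq f d0 d1 d2 d3 d0' d1' d2' d3' : jet3 f d0 d1 d2 d3 ->
  d0 = d0' -> d1 = d1' -> d2 = d2' -> d3 = d3' -> jet3 f d0' d1' d2' d3'.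
Proof. by move=> + <- <- <- <-. Qed.

Lemma jet_cst (c : R) : jet3 (fun=> c) c 0 0 0.
Proof.
exists (fun=> 0), (fun=> 0), (fun=> 0); exists 1 => //; split => //.
- by move=> s _; exact: is_derive_cst.
- by move=> s _; exact: is_derive_cst.
- by move=> s _; exact: is_derive_cst.
- exact: cst_continuous.
Qed.

Lemma jet_id : jet3 (fun s => s) 0 1 0 0.
Proof.
exists (fun=> 1), (fun=> 0), (fun=> 0); exists 1 => //; split => //.
- by move=> s _; exact: is_derive_id.
- by move=> s _; exact: is_derive_cst.
- by move=> s _; exact: is_derive_cst.
- exact: cst_continuous.
Qed.

Lemma jetD f g d0 d1 d2 d3 c0 c1 c2 c3 : jet3 f d0 d1 d2 d3 -> jet3 g c0 c1 c2 c3 ->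
  jet3 (fun s => f s + g s) (d0 + c0) (d1 + c1) (d2 + c2) (d3 + c3).
Proof.
move=> [f1 [f2 [f3 [e e0 [F1 F2 F3 cf [<- <- <- <-]]]]]].
move=> [g1 [g2 [g3 [e' e0' [G1 G2 G3 cg [<- <- <- <-]]]]]].
exists (fun s => f1 s + g1 s), (fun s => f2 s + g2 s), (fun s => f3 s + g3 s).
exists (Num.min e e'); first by rewrite lt_min e0.
split => //.
- by move=> s; rewrite lt_min => /andP[/F1 ? /G1 ?]; exact: is_deriveD.
- by move=> s; rewrite lt_min => /andP[/F2 ? /G2 ?]; exact: is_deriveD.
- by move=> s; rewrite lt_min => /andP[/F3 ? /G3 ?]; exact: is_deriveD.
- exact: continuousD.
Qed.

Lemma jetM f g d0 d1 d2 d3 c0 c1 c2 c3 : jet3 f d0 d1 d2 d3 -> jet3 g c0 c1 c2 c3 ->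
  jet3 (fun s => f s * g s) (d0 * c0) (d1 * c0 + d0 * c1)
    (d2 * c0 + 2 * (d1 * c1) + d0 * c2)
    (d3 * c0 + 3 * (d2 * c1) + 3 * (d1 * c2) + d0 * c3).
Proof.
move=> [f1 [f2 [f3 [e e0 [F1 F2 F3 cf [<- <- <- <-]]]]]].
move=> [g1 [g2 [g3 [e' e0' [G1 G2 G3 cg [<- <- <- <-]]]]]].
exists (fun s => f1 s * g s + f s * g1 s),
  (fun s => f2 s * g s + 2 * (f1 s * g1 s) + f s * g2 s),
  (fun s => f3 s * g s + 3 * (f2 s * g1 s) + 3 * (f1 s * g2 s) + f s * g3 s).
have z0 : `|0 : R| < e by rewrite normr0.
have z0' : `|0 : R| < e' by rewrite normr0.
exists (Num.min e e'); first by rewrite lt_min e0.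
split => //.
- by move=> s; rewrite lt_min => /andP[/F1 ? /G1 ?]; exact: is_derivePM.
- move=> s; rewrite lt_min => /andP[se se'].
  have := is_deriveD (is_derivePM (F2 s se) (G1 s se')) (is_derivePM (F1 s se) (G2 s se')).
  by congr is_derive; ring.
- move=> s; rewrite lt_min => /andP[se se'].
  have := is_deriveD (is_deriveD (is_derivePM (F3 s se) (G1 s se'))
    (is_derivePM (is_derive_cst (2 : R) s 1) (is_derivePM (F2 s se) (G2 s se'))))
    (is_derivePM (F1 s se) (G3 s se')).
  by congr is_derive; rewrite /cst; ring.
- have cf0 := is_derive_continuous (F1 0 z0).
  have cf1 := is_derive_continuous (F2 0 z0).
  have cf2 := is_derive_continuous (F3 0 z0).
  have cg0 := is_derive_continuous (G1 0 z0').
  have cg1 := is_derive_continuous (G2 0 z0').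
  have cg2 := is_derive_continuous (G3 0 z0').
  have cc3 := @cst_continuous R R (3 : R) 0.
  have M (a b : R -> R) : {for 0, continuous a} -> {for 0, continuous b} ->
    {for 0, continuous (fun s => a s * b s)} by move=> *; exact: continuousM.
  have A (a b : R -> R) : {for 0, continuous a} -> {for 0, continuous b} ->
    {for 0, continuous (fun s => a s + b s)} by move=> *; exact: continuousD.
  exact: (A _ _ (A _ _ (A _ _ (M _ _ cf cg0) (M _ _ cc3 (M _ _ cf2 cg1)))
    (M _ _ cc3 (M _ _ cf1 cg2))) (M _ _ cf0 cg)).
Qed.

Lemma jet_ext f g (e : R) d0 d1 d2 d3 : 0 < e -> (forall s, `|s| < e -> f s = g s) ->
  jet3 f d0 d1 d2 d3 -> jet3 g d0 d1 d2 d3.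
Proof.
move=> e0 fg [f1 [f2 [f3 [e' e0' [F1 F2 F3 cf [E0 E1 E2 E3]]]]]].
exists f1, f2, f3; exists (Num.min e e'); first by rewrite lt_min e0.
split => //.
- move=> s; rewrite lt_min => /andP[se /F1 dF].
  apply: (near_eq_is_derive _ dF).
  have : nbhs s (ball (0 : R) e).
    by apply: open_nbhs_nbhs; split; [exact: ball_open|rewrite /ball/= sub0r normrN].
  by apply: filterS => t; rewrite /ball/= sub0r normrN; exact: fg.
- by move=> s; rewrite lt_min => /andP[_ /F2].
- by move=> s; rewrite lt_min => /andP[_ /F3].
- by rewrite -fg ?normr0.
Qed.

Lemma jet_inv : jet3 (fun s => (1 + s * s)^-1) 1 0 (- 2) 0.
Proof.
pose g := fun s : R => (1 + s * s)^-1.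
have n0 (s : R) : 1 + s * s != 0 by rewrite gt_eqF// ltr_pwDl// -expr2 sqr_ge0.
have dn (s : R) : is_derive s (1 : R) (fun s : R => 1 + s * s) (2 * s).
  have := is_deriveD (is_derive_cst (1 : R) s 1)
    (is_derivePM (is_derive_id s (1 : R)) (is_derive_id s (1 : R))).
  by congr is_derive; ring.
have dg s : is_derive s (1 : R) g (- 2 * (s * (g s * g s))).
  by have := is_derivePV (F := fun s : R => 1 + s * s) (n0 s) (dn s); congr is_derive; rewrite /g; ring.
have dgg (s : R) := is_derivePM (dg s) (dg s).
have dsgg (s : R) := is_derivePM (is_derive_cst (- 2 : R) s 1) (is_derivePM (is_derive_id s (1 : R)) (dgg s)).
have dggg (s : R) := is_derivePM (is_derive_id s (1 : R)) (is_derivePM (is_derive_id s (1 : R))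
  (is_derivePM (dg s) (dgg s))).
have d2 (s : R) := is_deriveD (is_derivePM (is_derive_cst (- 2 : R) s 1) (dgg s))
  (is_derivePM (is_derive_cst (8 : R) s 1) (dggg s)).
have cg (s : R) := is_derive_continuous (dg s).
have M (a b : R -> R) s : {for s, continuous a} -> {for s, continuous b} ->
    {for s, continuous (fun s => a s * b s)} by move=> *; exact: continuousM.
have A (a b : R -> R) s : {for s, continuous a} -> {for s, continuous b} ->
    {for s, continuous (fun s => a s + b s)} by move=> *; exact: continuousD.
have ci (s : R) : {for s, continuous (fun s : R => s)} by exact: cvg_id.
have cc (c s : R) := @cst_continuous R R c s.
exists (fun s => - 2 * (s * (g s * g s))),
  (fun s => - 2 * (g s * g s) + 8 * (s * (s * (g s * (g s * g s))))),
  (fun s => 24 * (s * (g s * (g s * g s))) + - 48 * (s * (s * (s * (g s * (g s * (g s * g s))))))).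
exists 1 => //; split.
- by move=> s _; exact: dg.
- by move=> s _; have := dsgg s; rewrite /cst; congr is_derive; ring.
- by move=> s _; have := d2 s; rewrite /cst; congr is_derive; ring.
- exact: (A _ _ _ (M _ _ _ (cc _ _) (M _ _ _ (ci _) (M _ _ _ (cg _) (M _ _ _ (cg _) (cg _)))))
    (M _ _ _ (cc _ _) (M _ _ _ (ci _) (M _ _ _ (ci _) (M _ _ _ (ci _)
      (M _ _ _ (cg _) (M _ _ _ (cg _) (M _ _ _ (cg _) (cg _))))))))).
- by split; rewrite /g !(mulr0, mul0r, addr0) ?invr1 ?mulr1 ?addr0.
Qed.

Lemma jet_atan : jet3 (@atan R) 0 1 0 (- 2).
Proof.
have [f1 [f2 [f3 [e e0 [F1 F2 F3 cf [E0 E1 E2 E3]]]]]] := jet_inv.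
exists (fun s => (1 + s * s)^-1), f1, f2; exists e => //; split => //.
- by move=> s _; rewrite -expr2; exact: is_derive1_atan.
- by apply: (is_derive_continuous (F3 0 _)); rewrite normr0.
- by rewrite mulr0 addr0 invr1 atan0.
Qed.

Definition zeros_at0 f := forall e : R, 0 < e -> exists2 s, 0 < `|s| < e & f s = 0.

Lemma zeros_continuous f : zeros_at0 f -> {for 0, continuous f} -> f 0 = 0.
Proof.
move=> zf cf; apply/eqP; rewrite -normr_le0 leNgt; apply/negP => f0.
have /cvgrPdist_lt /(_ _ f0) /nbhs_ballP[d /= d0 hd] := cf.
have [s /andP[_ sd] fs] := zf d d0.
have : ball 0 d s by rewrite /ball/= sub0r normrN.
by move=> /hd; rewrite /= fs subr0 ltxx.
Qed.

(** Rolle's theorem between 0 and a nearby zero. *)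
Lemma zeros_derive f f1 (e : R) : 0 < e ->
  (forall s, `|s| < e -> is_derive s (1 : R) f (f1 s)) -> zeros_at0 f ->
  f 0 = 0 /\ zeros_at0 f1.
Proof.
move=> e0 df zf.
have f0 : f 0 = 0.
  apply: zeros_continuous => //; apply: (is_derive_continuous (df 0 _)).
  by rewrite normr0.
split => // d d0.
have [s /andP[s0 sd] fs] := zf (Num.min d e) (eq_ind_r is_true (introT andP (conj d0 e0)) (lt_min _ _ _)).
move: sd; rewrite lt_min => /andP[sd se].
have cont (a b : R) : (forall x, x \in `[a, b] -> `|x| < e) -> {within `[a, b], continuous f}.
  move=> ab; apply: continuous_in_subspaceT => x; rewrite inE => /ab xe.
  exact: is_derive_continuous (df x xe).
have fin c : `|c| < e -> is_derive c (1 : R) f 0 -> f1 c = 0.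
  by move=> ce [_ <-]; have [_ ->] := df c ce.
have [sneg|spos|s00] := ltgtP s 0; last by rewrite s00 normr0 ltxx in s0.
- have sN : `|s| = - s by rewrite ltr0_norm.
  have ins x : x \in `[s, 0] -> `|x| < e.
    by rewrite in_itv/= => /andP[a b]; rewrite ler0_norm//; lra.
  have [|||c] := @Rolle R f s 0 sneg.
  + by move=> x xs; have [] := df x (ins x (subset_itv_oo_cc xs)).
  + exact: cont.
  + by rewrite fs f0.
  move=> cs dc; exists c; last by apply: fin dc; exact: ins (subset_itv_oo_cc cs).
  by move: cs; rewrite in_itv/= => /andP[a b]; rewrite ltr0_norm//; apply/andP; split; lra.
- have sN : `|s| = s by rewrite gtr0_norm.
  have ins x : x \in `[0, s] -> `|x| < e.
    by rewrite in_itv/= => /andP[a b]; rewrite ger0_norm//; lra.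
  have [|||c] := @Rolle R f 0 s spos.
  + by move=> x xs; have [] := df x (ins x (subset_itv_oo_cc xs)).
  + exact: cont.
  + by rewrite fs f0.
  move=> cs dc; exists c; last by apply: fin dc; exact: ins (subset_itv_oo_cc cs).
  by move: cs; rewrite in_itv/= => /andP[a b]; rewrite gtr0_norm//; apply/andP; split; lra.
Qed.

Lemma jet_zeros f d0 d1 d2 d3 : jet3 f d0 d1 d2 d3 -> zeros_at0 f ->
  [/\ d0 = 0, d1 = 0, d2 = 0 & d3 = 0].
Proof.
move=> [f1 [f2 [f3 [e e0 [F1 F2 F3 cf [<- <- <- <-]]]]]] z.
have [-> z1] := zeros_derive e0 F1 z.
have [-> z2] := zeros_derive e0 F2 z1.
have [-> z3] := zeros_derive e0 F3 z2.
by rewrite (zeros_continuous z3 cf).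
Qed.

Lemma jetZ (c : R) f d0 d1 d2 d3 : jet3 f d0 d1 d2 d3 ->
  jet3 (fun s => c * f s) (c * d0) (c * d1) (c * d2) (c * d3).
Proof. by move=> jf; apply: (jet_eq (jetM (jet_cst c) jf)); ring. Qed.

Lemma jet_uniq f d0 d1 d2 d3 c0 c1 c2 c3 : jet3 f d0 d1 d2 d3 -> jet3 f c0 c1 c2 c3 ->
  [/\ d0 = c0, d1 = c1, d2 = c2 & d3 = c3].
Proof.
move=> jf jf'; have := jetD jf (jetZ (- 1) jf').
move=> /jet_zeros[].
  by move=> e e0; exists (e / 2); [rewrite gtr0_norm ?divr_gt0//=; lra|ring].
by move=> *; split; lra.
Qed.

End Jets.

(** * The local normal form *)

Section LocalForm.
Variable R : realType.
Implicit Types (F G : R * R -> R) (U : set (R * R)) (p q : R * R).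
Local Notation dx := (dir_x R).
Local Notation dy := (dir_y R).

Lemma is_derive_slope U G (x s : R) : open U -> class_C 1 U G -> U (x, s * x) ->
  is_derive s (1 : R) (fun s => G (x, s * x)) (x * partial_y G (x, s * x)).
Proof.
move=> oU CG Us.
have dG := proj1 (slice_y _ (x, s * x) _) (class_C_dy CG Us).
have ds : is_derive s (1 : R) (fun s => s * x) x.
  have := is_derivePM (is_derive_id s (1 : R)) (is_derive_cst x s (1 : R)).
  by rewrite /cst; congr is_derive; ring.
by have := @is_derive1_comp R (fun t => G (x, t)) (fun s => s * x) s _ _ dG ds; rewrite mulrC.
Qed.

(** By the chain rule, differentiating in the slope at 0 gives the Cauchy data of G on the
    x-axis, weighted by powers of x. *)
Lemma jet_slice U G (x : R) : open U -> class_C 3 U G -> U (x, 0) ->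
  jet3 (fun s => G (x, s * x)) (G (x, 0)) (x * partial_y G (x, 0))
    (x * (x * partial_y (partial_y G) (x, 0)))
    (x * (x * (x * partial_y (partial_y (partial_y G)) (x, 0)))).
Proof.
move=> oU CG Ux; have [d d0 sub] := open_ball oU Ux.
have x1 : 0 < `|x| + 1 by rewrite ltr_wpDl.
have inU s : `|s| < d / (`|x| + 1) -> U (x, s * x).
  move=> sd; apply: sub; apply/ball_square => /=; rewrite subrr normr0 subr0; split => //.
  move: sd; rewrite ltr_pdivlMr// normrM; apply: le_lt_trans.
  by rewrite ler_wpM2l// lerDl.
have C2 := class_C_pred CG.
have dZ s (a b c : R) (f : R -> R) : is_derive s (1 : R) f b ->
    is_derive s (1 : R) (fun s => a * f s) (a * b).
  move=> df; have := is_derivePM (is_derive_cst a s (1 : R)) df.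
  by rewrite /cst mul0r add0r.
exists (fun s => x * partial_y G (x, s * x)),
  (fun s => x * (x * partial_y (partial_y G) (x, s * x))),
  (fun s => x * (x * (x * partial_y (partial_y (partial_y G)) (x, s * x)))).
exists (d / (`|x| + 1)); first by rewrite divr_gt0.
split.
- move=> s /inU Us; exact: (is_derive_slope oU (class_C_pred C2) Us).
- move=> s /inU Us; apply: (dZ _ _ _ 0).
  exact: (is_derive_slope oU (class_C_pred (class_C_py CG)) Us).
- move=> s /inU Us; do 2 apply: (dZ _ _ _ 0).
  exact: (is_derive_slope oU (class_C_py (class_C_py CG)) Us).
- have cxs : {for (0 : R), continuous (fun s : R => (x, s * x))}.
    have cx : {for (0 : R), continuous (fun s : R => s * x)}.
      by apply: continuousM; [exact: cvg_id|exact: cst_continuous].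
    exact: (pair_continuous (@cst_continuous R R x 0) cx).
  have Ux0 : U (x, 0 * x) by rewrite mul0r.
  have cG := class_C_cont (class_C_py (class_C_py (class_C_py CG))) Ux0.
  have c1 := continuous_comp cxs cG.
  have cZ (f : R -> R) : {for 0, continuous f} -> {for 0, continuous (fun s => x * f s)}.
    by move=> cf; apply: continuousM => //; exact: cst_continuous.
  exact: (cZ _ (cZ _ (cZ _ c1))).
- by rewrite mul0r.
Qed.

(** The four data are quadratic in x, and their twelve coefficients determine the twelve
    parameters. *)
Lemma jet_canonical_fun (P : params R) (x : R) : x != 0 ->
  jet3 (fun s => canonical_fun P (Tx (x, s * x)) (x, s * x))
   (ph P + pf P * x + pe P * x ^+ 2)
   (pa3 P + pb2 P + (pa2 P + pg P) * x + (pa1 P + pc2 P) * x ^+ 2)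
   (2 * pb1 P + 2 * pa2' P * x + 2 * (pc1 P + pe P) * x ^+ 2)
   (- 2 * pa3 P - 6 * pb2 P - 2 * pa2 P * x + 4 * pa1 P * x ^+ 2).
Proof.
move=> x0.
have Jx := jet_cst x; have Js := jet_id R; have Ja := jet_atan R; have Ji := jet_inv R.
have Jc (c : R) := jet_cst c.
have Jss := jetD (Jc 1) (jetM Js Js).
have Jang := jetD (jetD (jetD (jetZ (pa1 P * x ^+ 2) Jss) (Jc (pa2 P * x)))
  (jetZ (pa2' P * x) Js)) (Jc (pa3 P)).
have J := jetD (jetD (jetD (jetM Jang Ja)
  (jetM (jetD (jetZ (pb1 P) (jetM Js Js)) (jetZ (pb2 P) Js)) Ji))
  (jetD (jetZ (pc1 P * x ^+ 2) (jetM Js Js)) (jetZ (pc2 P * x ^+ 2) Js)))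
  (jetD (jetD (jetD (jetZ (pe P * x ^+ 2) Jss) (Jc (pf P * x))) (jetZ (pg P * x) Js)) (Jc (ph P))).
apply: (jet_ext ltr01 _ (jet_eq J _ _ _ _)); [|ring|ring|ring|ring].
move=> s _; rewrite /canonical_fun /angular_part /Tx /norm2 /= mulfK//.
have n0 : 1 + s * s != 0 by rewrite gt_eqF// ltr_pwDl// -expr2 sqr_ge0.
move: (atan s) => t; field; rewrite n0 /=.
have -> : x * x + s * x * (s * x) = x * x * (1 + s * s) by ring.
by rewrite !mulf_neq0.
Qed.

Lemma comb3 (a b c d u v w : R) : a + (- b * u + - c * v + - d * w) = 0 ->
  a = b * u + c * v + d * w.
Proof. by move=> h; lra. Qed.

(** For fixed x, the interpolation error of F (x, s x) at the nodes m - d, m, m + d vanishes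
    for all slopes s with F quadratic on the line.  These accumulate at 0, so all its
    derivatives in s up to order three vanish at 0: the weighted Cauchy data
    x^j d^jF/dy^j (x, 0) are quadratic in x, as those of canonical functions.  The difference G
    from the canonical function with the same Cauchy data vanishes above the axis, because
    [upper G] is biharmonic and vanishes below. *)
Theorem local_normal_form F (m r : R) : 0 < r -> r <= `|m| ->
  biharmonic (ball (m, 0) r) F ->
  (forall e : R, 0 < e -> exists2 s, 0 < `|s| < e &
     exists a b c : R, forall x, `|x - m| < r -> F (x, s * x) = a + b * x + c * x ^+ 2) ->
  exists P, \forall q \near (m, r / 2), F q = canonical_fun P (Tx q) q.
Proof.
move=> r0 rm bF quad; set U := ball (m, 0) r in bF *.
have oU : open U by exact: ball_open.
have [CF _] := bF; have CF3 := class_C_pred CF.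
have inU x : `|x - m| < r -> U (x, 0).
  by move=> xm; apply/ball_square; rewrite /= subrr normr0.
have Ux0 q : U q -> q.1 != 0.
  move=> /ball_square[/= h _]; apply/eqP => q0; move: h; rewrite q0 sub0r normrN.
  by rewrite ltNge rm.
pose d := r / 2; have d0 : 0 < d by rewrite divr_gt0.
have d0' : d != 0 by rewrite gt_eqF.
pose D1 x := x * partial_y F (x, 0).
pose D2 x := x * (x * partial_y (partial_y F) (x, 0)).
pose D3 x := x * (x * (x * partial_y (partial_y (partial_y F)) (x, 0))).
(* Lagrange basis of the nodes m - d, m, m + d *)
pose l1 x : R := ((x - m) ^+ 2 - (x - m) * d) / (2 * d ^+ 2).
pose l2 x : R := (d ^+ 2 - (x - m) ^+ 2) / d ^+ 2.
pose l3 x : R := ((x - m) ^+ 2 + (x - m) * d) / (2 * d ^+ 2).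
have lin x (xm : `|x - m| < r) : [/\
    F (x, 0) = l1 x * F (m - d, 0) + l2 x * F (m, 0) + l3 x * F (m + d, 0),
    D1 x = l1 x * D1 (m - d) + l2 x * D1 m + l3 x * D1 (m + d),
    D2 x = l1 x * D2 (m - d) + l2 x * D2 m + l3 x * D2 (m + d) &
    D3 x = l1 x * D3 (m - d) + l2 x * D3 m + l3 x * D3 (m + d)].
  have i1 : `|(m - d) - m| < r by rewrite addrAC subrr sub0r normrN gtr0_norm// /d; lra.
  have i2 : `|m - m| < r by rewrite subrr normr0.
  have i3 : `|(m + d) - m| < r by rewrite addrAC subrr add0r gtr0_norm// /d; lra.
  have J y (ym : `|y - m| < r) := jet_slice oU CF3 (inU y ym).
  have := jetD (J x xm) (jetD (jetD (jetZ (- l1 x) (J _ i1)) (jetZ (- l2 x) (J _ i2)))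
    (jetZ (- l3 x) (J _ i3))).
  move=> /jet_zeros[].
    move=> e e0; have [s se [a [b [c abc]]]] := quad e e0; exists s => //.
    by rewrite !abc// /l1 /l2 /l3; field.
  move=> h0 h1 h2 h3; split; [exact: comb3 h0|exact: comb3 h1|exact: comb3 h2|exact: comb3 h3].
(* monomial coefficients of the interpolating polynomial with values u, v, w *)
pose qb (u w : R) : R := (w - u) / (2 * d).
pose qc (u v w : R) : R := (u + w - 2 * v) / (2 * d ^+ 2).
pose A u v w := v - m * qb u w + m ^+ 2 * qc u v w.
pose B u v w := qb u w - 2 * m * qc u v w.
have lagr u v w x : l1 x * u + l2 x * v + l3 x * w = A u v w + B u v w * x + qc u v w * x ^+ 2.
  by rewrite /A /B /qb /qc /l1 /l2 /l3; field.
have ex (D : R -> R) : (forall x, `|x - m| < r -> D x = l1 x * D (m - d) + l2 x * D m + l3 x * D (m + d)) ->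
    exists a b c, forall x, `|x - m| < r -> D x = a + b * x + c * x ^+ 2.
  move=> h; exists (A (D (m - d)) (D m) (D (m + d))), (B (D (m - d)) (D m) (D (m + d))),
    (qc (D (m - d)) (D m) (D (m + d))) => x xm.
  by rewrite h// lagr.
have [A0 [B0 [C0 e0]]] := ex (fun x => F (x, 0)) (fun x xm => let: And4 h _ _ _ := lin x xm in h).
have [A1 [B1 [C1 e1]]] := ex D1 (fun x xm => let: And4 _ h _ _ := lin x xm in h).
have [A2 [B2 [C2 e2]]] := ex D2 (fun x xm => let: And4 _ _ h _ := lin x xm in h).
have [A3 [B3 [C3 e3]]] := ex D3 (fun x xm => let: And4 _ _ _ h := lin x xm in h).
(* inverse of the linear system given by [jet_canonical_fun] *)
pose b2 := - (A3 + 2 * A1) / 4.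
pose a2 := - B3 / 2.
pose a1 := C3 / 4.
pose P := Params a1 a2 (B2 / 2) (A1 - b2) (A2 / 2) b2
  (C2 / 2 - C0) (C1 - a1) C0 B0 (B1 - a2) A0.
exists P.
pose G := fun q => F q - canonical_fun P (Tx q) q.
have UH : U `<=` @Hx R by exact: Ux0.
have bK : biharmonic U (fun q => canonical_fun P (Tx q) q).
  apply: biharmonic_sub UH _.
  apply: (biharmonic_ext (@open_Hx R) _ (biharmonic_canonical_x P 0)) => q _.
  by rewrite addr0.
have bG : biharmonic U G := biharmonicB oU bF bK.
have CG3 : class_C 3 U G by case: bG => /class_C_pred.
have GZ x : `|x - m| < r -> [/\ G (x, 0) = 0, partial_y G (x, 0) = 0,
    partial_y (partial_y G) (x, 0) = 0 & partial_y (partial_y (partial_y G)) (x, 0) = 0].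
  move=> xm; have x0 : x != 0 by exact: (Ux0 _ (inU x xm)).
  have JG := jet_slice oU CG3 (inU x xm).
  have JF := jetD (jet_slice oU CF3 (inU x xm)) (jetZ (- 1) (jet_canonical_fun P x0)).
  have JF' := jet_ext (g := fun s => G (x, s * x)) ltr01 (fun s _ => congr2 +%R (erefl _) (mulN1r _)) JF.
  have [k0 k1 k2 k3] := jet_uniq JG JF'.
  have {}k0 : G (x, 0) = 0.
    apply: (etrans k0); apply: (etrans (congr2 +%R (e0 x xm) (erefl _))).
    by clear; rewrite /P /=; ring.
  have {}k1 : x * partial_y G (x, 0) = 0.
    apply: (etrans k1); apply: (etrans (congr2 +%R (e1 x xm) (erefl _))).
    by clear; rewrite /P /=; ring.
  have {}k2 : x * (x * partial_y (partial_y G) (x, 0)) = 0.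
    apply: (etrans k2); apply: (etrans (congr2 +%R (e2 x xm) (erefl _))).
    by clear; rewrite /P /=; field.
  have {}k3 : x * (x * (x * partial_y (partial_y (partial_y G)) (x, 0))) = 0.
    apply: (etrans k3); apply: (etrans (congr2 +%R (e3 x xm) (erefl _))).
    by clear; rewrite /P /= /b2 /a2 /a1; field.
  have c (y : R) : x * y = 0 -> y = 0 by move=> /eqP; rewrite mulf_eq0 (negbTE x0) => /eqP.
  by split; [exact: k0|exact: c k1|exact: c (c _ k2)|exact: c (c _ (c _ k3))].
have fl : flat 4 U G.
  apply: (flat4_biharmonic oU bG) => j j3 p Up p0.
  have pE : p = (p.1, 0) by rewrite [LHS]surjective_pairing p0.
  have [k0 k1 k2 k3] : [/\ G (p.1, 0) = 0, partial_y G (p.1, 0) = 0,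
    partial_y (partial_y G) (p.1, 0) = 0 & partial_y (partial_y (partial_y G)) (p.1, 0) = 0].
    by apply: GZ; move/ball_square: Up => [].
  rewrite pE; case: j j3 => [|[|[|[|j]]]] j3.
  - exact: k0.
  - exact: k1.
  - exact: k2.
  - exact: k3.
  - exact: (False_ind _ (notF j3)).
have bU := biharmonic_upper oU bG fl.
have cU : connected U by exact: ball_connected.
have lowU : U (m, - (r / 2)).
  by apply/ball_square; rewrite /= subrr normr0 subr0 normrN gtr0_norm//; split; lra.
have zero := biharmonic_continuation oU cU bU lowU.
have {}zero : forall p, U p -> upper G p = 0.
  apply: zero; apply: (near_open (@open_snd_lt0 R)); first by rewrite /=; lra.
  by move=> q /ltW; exact: upper_le0.
have inm : (U `&` [set p : R * R | 0 < p.2]) (m, r / 2).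
  split; last by [].
  by apply/ball_square; rewrite /= subrr normr0 subr0 gtr0_norm//; split; lra.
apply: (near_open _ inm); first by apply: openI => //; exact: open_snd_gt0.
move=> q [Uq q0]; have := zero q Uq; rewrite /upper q0 /G => /eqP.
by rewrite subr_eq0 => /eqP.
Qed.

End LocalForm.

(** * Branches of a canonical function *)

Section Angles.
Variable R : realType.
Implicit Types (F G T : R * R -> R) (U V H : set (R * R)) (p q : R * R) (P : params R).

(** [t] is one of the values of Arctan (y / x), written so that x = 0 is not exceptional. *)
Definition is_angle (q : R * R) (t : R) : Prop := q.2 * cos t = q.1 * sin t.

Lemma sincosDpiz (t : R) (k : int) : exists2 e : R, (e = 1 \/ e = -1) &
  sin (t + pi *~ k) = e * sin t /\ cos (t + pi *~ k) = e * cos t.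
Proof.
have N (n : nat) : exists2 e : R, (e = 1 \/ e = -1) &
    forall s, sin (s + pi *+ n) = e * sin s /\ cos (s + pi *+ n) = e * cos s.
  elim: n => [|n [e e1 IH]].
    by exists 1 => [|s]; [left|rewrite mulr0n addr0 !mul1r].
  exists (- e); first by case: e1 => ->; [right|left; rewrite opprK].
  by move=> s; rewrite mulrSr addrA sinDpi cosDpi !(proj1 (IH s)) !(proj2 (IH s)) !mulNr.
case: k => n.
  by have [e e1 h] := N n; exists e.
rewrite NegzE mulrNz; have [e e1 h] := N n.+1; exists e => //.
have := h (t - pi *+ n.+1); rewrite subrK => -[-> ->].
by case: e1 => ->; rewrite ?mul1r// !mulN1r !opprK.
Qed.

Lemma sin_eq0_piz (u : R) : sin u = 0 -> exists k : int, u = pi *~ k.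
Proof.
move=> su; pose k := Num.floor (u / pi); exists k.
have pi0 := pi_gt0 R.
pose v := u - pi *~ k.
have /andP[f1 f2] := floor_itv (u / pi).
have uE : u = u / pi * pi by rewrite mulfVK// gt_eqF.
have v0 : 0 <= v.
  by rewrite /v subr_ge0 [leRHS]uE -mulrzr mulrC ler_pM2r.
have v1 : v < pi.
  have kE : pi + pi *~ k = (k + 1)%:~R * pi :> R by rewrite intrD -mulrzr; ring.
  by rewrite /v ltrBlDr kE [ltLHS]uE ltr_pM2r.
have sv : sin v = 0.
  have [e _ [+ _]] := sincosDpiz u (- k); rewrite mulrNz -/v su mulr0 //.
have : v = 0.
  apply/eqP; rewrite eq_le v0 andbT leNgt; apply/negP => v0'.
  by have := @sin_gt0_pi R v; rewrite v0' v1 sv ltxx => /(_ isT).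
by move/eqP; rewrite subr_eq0 => /eqP.
Qed.

Lemma is_angleDpiz q t k : is_angle q t -> is_angle q (t + pi *~ k).
Proof.
by rewrite /is_angle => h; have [e _ [-> ->]] := sincosDpiz t k; rewrite !(mulrCA _ e) h.
Qed.

Lemma is_angle_diff q t t' : punctured q -> is_angle q t -> is_angle q t' ->
  exists k : int, t' = t + pi *~ k.
Proof.
move=> q0 h h'.
have s0 : sin (t' - t) = 0.
  rewrite sinB; have [x0|x0] := eqVneq q.1 0.
    have y0 : q.2 != 0.
      by apply/eqP => y0; move: q0; rewrite /punctured /norm2 /= x0 y0 !mulr0 addr0 ltxx.
    have c (a : R) : is_angle q a -> cos a = 0.
      by rewrite /is_angle x0 mul0r => /eqP; rewrite mulf_eq0 (negbTE y0) => /eqP.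
    by rewrite (c _ h) (c _ h') mulr0 mul0r subrr.
  apply: (mulfI x0); rewrite mulr0.
  transitivity ((q.1 * sin t') * cos t - cos t' * (q.1 * sin t)); first by ring.
  by rewrite -h -h'; ring.
have [k kE] := sin_eq0_piz s0; exists k.
by rewrite -kE addrC subrK.
Qed.

Lemma is_angle_Tx q : Hx q -> is_angle q (Tx q).
Proof.
move=> x0; rewrite /is_angle /Tx; set a := atan (q.2 / q.1).
have c0 : cos a != 0 by rewrite gt_eqF// cos_gt0_pihalf// atan_gtNpi2 atan_ltpi2.
have h := atanK (q.2 / q.1); rewrite -/a /tan in h.
have -> : sin a = q.2 / q.1 * cos a by rewrite -h mulfVK.
by rewrite mulrA (mulrC q.1) mulfVK.
Qed.

Lemma is_angle_Ty q : Hy q -> is_angle q (Ty q).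
Proof.
move=> y0; rewrite /is_angle /Ty; set a := atan (q.1 / q.2).
have c0 : cos a != 0 by rewrite gt_eqF// cos_gt0_pihalf// atan_gtNpi2 atan_ltpi2.
have h := atanK (q.1 / q.2); rewrite -/a /tan in h.
rewrite cosB sinB cos_pihalf sin_pihalf !mul0r !mul1r add0r subr0.
have -> : sin a = q.1 / q.2 * cos a by rewrite -h mulfVK.
by rewrite mulrA (mulrC q.2) mulfVK.
Qed.

Lemma piz_small (k : int) : `|pi *~ k| < pi :> R -> k = 0.
Proof.
rewrite -mulrzr normrM gtr0_norm ?pi_gt0// -{2}[pi]mulr1 ltr_pM2l ?pi_gt0//.
rewrite -intr_norm -[1]/(1%:~R) ltr_int => k1.
by apply/eqP; rewrite -absz_eq0; move: k1; case: k => [[|n]|n].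
Qed.

(** The quotient of the difference by pi is an integer depending continuously on the
    point. *)
Lemma is_angle_locally T T' p : punctured p -> {for p, continuous T} -> {for p, continuous T'} ->
  (\forall q \near p, is_angle q (T q)) -> (\forall q \near p, is_angle q (T' q)) ->
  exists k : int, \forall q \near p, T' q = T q + pi *~ k.
Proof.
move=> p0 cT cT' aT aT'.
have [k kE] := is_angle_diff p0 (nbhs_singleton aT) (nbhs_singleton aT').
exists k; have pi2 : 0 < pi / 2 :> R by rewrite divr_gt0 ?pi_gt0.
have /cvgrPdist_lt /(_ _ pi2) n1 := cT.
have /cvgrPdist_lt /(_ _ pi2) n2 := cT'.
have n3 : \forall q \near p, punctured q.
  by apply: open_nbhs_nbhs; split => //; exact: open_punctured.
have fI X Y : nbhs p X -> nbhs p Y -> nbhs p (X `&` Y) by move=> *; exact: filterI.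
have n := fI _ _ n3 (fI _ _ (fI _ _ n1 n2) (fI _ _ aT aT')).
apply: filterS n => q [q0 [[/= d1 d2] [/= a1 a2]]].
have [l lE] := is_angle_diff q0 a1 a2.
have kl : pi *~ (l - k) = (T p - T q) - (T' p - T' q) :> R.
  by rewrite lE kE mulrzBr; ring.
have : `|pi *~ (l - k)| < pi :> R.
  by rewrite kl (le_lt_trans (ler_normB _ _))// [ltRHS]splitr ltrD.
by move=> /piz_small /eqP; rewrite subr_eq0 lE => /eqP ->.
Qed.

(** A single-valued angle on an open set, suited to unique continuation: adding a constant to
    it keeps canonical functions biharmonic. *)
Record std_branch H T : Prop := StdBranch {
  std_open : open H;
  std_punctured : H `<=` @punctured R;
  std_cont : forall q, H q -> {for q, continuous T};
  std_is_angle : forall q, H q -> is_angle q (T q);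
  std_biharmonic : forall P c, biharmonic H (fun q => canonical_fun P (T q + c) q) }.

Lemma std_x : std_branch (@Hx R) (@Tx R).
Proof.
split; [exact: open_Hx|exact: Hx_punctured|exact: Tx_continuous|exact: is_angle_Tx|].
exact: biharmonic_canonical_x.
Qed.

Lemma std_y : std_branch (@Hy R) (@Ty R).
Proof.
split; [exact: open_Hy|exact: Hy_punctured|exact: Ty_continuous|exact: is_angle_Ty|].
exact: biharmonic_canonical_y.
Qed.

Lemma std_exists p : punctured p -> exists H T, H p /\ std_branch H T.
Proof.
move=> p0; have [x0|x0] := eqVneq p.1 0.
  exists (@Hy R), (@Ty R); split; last exact: std_y.
  by apply/eqP => y0; move: p0; rewrite /punctured /norm2 /= x0 y0 !mulr0 addr0 ltxx.
by exists (@Hx R), (@Tx R); split; last exact: std_x.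
Qed.

(** Near [p], the graph of [F] is a branch of the multi-valued canonical function with
    parameters [P]. *)
Definition canonical_at P F p : Prop := exists2 T, {for p, continuous T} &
  \forall q \near p, is_angle q (T q) /\ F q = canonical_fun P (T q) q.

Lemma canonical_at_std P F H T p : std_branch H T -> H p -> canonical_at P F p ->
  exists k : int, \forall q \near p, F q = canonical_fun P (T q + pi *~ k) q.
Proof.
move=> st Hp [T' cT' aT'].
have n1 : \forall q \near p, is_angle q (T q).
  by apply: (near_open (std_open st) Hp); exact: std_is_angle st.
have n2 : \forall q \near p, is_angle q (T' q) by apply: filterS aT' => q [].
have [k kE] := is_angle_locally (std_punctured st Hp) (std_cont st Hp) cT' n1 n2.
exists k; have fI X Y : nbhs p X -> nbhs p Y -> nbhs p (X `&` Y) by move=> *; exact: filterI.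
by apply: filterS (fI _ _ kE aT') => q [/= -> [_ ->]].
Qed.

Lemma std_canonical_at P F H T p (c : int) : std_branch H T -> H p ->
  (\forall q \near p, F q = canonical_fun P (T q + pi *~ c) q) -> canonical_at P F p.
Proof.
move=> st Hp h; exists (fun q => T q + pi *~ c).
  by apply: continuousD; [exact: std_cont st _ Hp|exact: cst_continuous].
have n1 : \forall q \near p, is_angle q (T q + pi *~ c).
  by apply: (near_open (std_open st) Hp) => q Hq; exact/is_angleDpiz/(std_is_angle st).
have fI X Y : nbhs p X -> nbhs p Y -> nbhs p (X `&` Y) by move=> *; exact: filterI.
by apply: filterS (fI _ _ n1 h) => q [/= ? ?].
Qed.

Lemma open_canonical_at P F : open [set p | punctured p /\ canonical_at P F p].
Proof.
rewrite openE => p [p0 gp]; have [H [T [Hp st]]] := std_exists p0.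
have [k kE] := canonical_at_std st Hp gp.
have nH : nbhs p H by apply: open_nbhs_nbhs; split => //; exact: std_open st.
have fI X Y : nbhs p X -> nbhs p Y -> nbhs p (X `&` Y) by move=> *; exact: filterI.
apply: filterS (fI _ _ nH (near_join kE)) => q [/= Hq hq].
by split; [exact: std_punctured st _ Hq|exact: std_canonical_at st Hq hq].
Qed.

(** F and the sheet on which it starts are both biharmonic. *)
Lemma canonical_at_connected P F H T U p0 : std_branch H T -> open U -> connected U -> U `<=` H ->
  biharmonic U F -> U p0 -> canonical_at P F p0 ->
  exists k : int, forall q, U q -> F q = canonical_fun P (T q + pi *~ k) q.
Proof.
move=> st oU cU UH bF Up gp; have [k kE] := canonical_at_std st (UH _ Up) gp.
exists k; apply: (biharmonic_eq oU cU bF _ Up kE).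
exact: biharmonic_sub UH (std_biharmonic st P _).
Qed.

(** Openness is clear, and [canonical_at_connected] on a small ball gives closedness. *)
Theorem canonical_at_propagate P F U p0 : open U -> connected U -> U `<=` @punctured R ->
  biharmonic U F -> U p0 -> canonical_at P F p0 -> forall p, U p -> canonical_at P F p.
Proof.
move=> oU cU UP bF Up0 gp0.
pose Z := U `&` [set p | punctured p /\ canonical_at P F p].
suff UZ : U `<=` Z by move=> p /UZ [_ []].
apply: connected_clopen => //.
- by apply: openI => //; exact: open_canonical_at.
- by move=> p [].
- by exists p0; split => //; split => //; exact: UP.
move=> p Up clp; split => //; split; first exact: UP.
have [H [T [Hp st]]] := std_exists (UP _ Up).
have [e e0 sub] := open_ball (openI oU (std_open st)) (conj Up Hp).
have [q [[Uq [_ gq]] pq]] : (Z `&` ball p e) !=set0.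
  by apply: clp; exact: nbhsx_ballx.
have bsub : biharmonic (ball p e) F by apply: biharmonic_sub bF => r /sub[].
have BH : ball p e `<=` H by move=> r /sub[].
have [k kE] := canonical_at_connected st (ball_open _ _) (@ball_connected _ _ _) BH bsub pq gq.
apply: (std_canonical_at st Hp (c := k)).
by apply: (near_open (ball_open _ _) _ kE); exact: ballxx.
Qed.

Lemma canonical_at_ext P F G p : (\forall q \near p, F q = G q) -> canonical_at P F p -> canonical_at P G p.
Proof.
move=> FG [T cT aT]; exists T => //.
have fI X Y : nbhs p X -> nbhs p Y -> nbhs p (X `&` Y) by move=> *; exact: filterI.
by apply: filterS (fI _ _ FG aT) => q [/= -> ?].
Qed.

Definition sheets (U : nat -> set (R * R)) (F : nat -> R * R -> R) : Prop :=
  (forall n, region (U n) /\ biharmonic (U n) (F n)) /\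
  (forall n, exists2 m : nat, (m <= n)%N &
          direct_continuation (U m) (F m) (U n.+1) (F n.+1)).

(** Every element is linked to the first one by direct continuations, so the property
    descends from the index N to 0 and then climbs to all indices. *)
Theorem canonical_at_sheets P (U : nat -> set (R * R)) (F : nat -> R * R -> R) (N : nat) p0 : sheets U F -> (forall n, U n `<=` @punctured R) ->
  U N p0 -> canonical_at P (F N) p0 -> forall n p, U n p -> canonical_at P (F n) p.
Proof.
move=> [reg cont] UP Up0 gp0.
pose allgood n := forall p, U n p -> canonical_at P (F n) p.
have prop n p : U n p -> canonical_at P (F n) p -> allgood n.
  have [[oU cU _] bF] := reg n.
  by move=> Up gp; exact: canonical_at_propagate oU cU (UP n) bF Up gp.
have link m n : direct_continuation (U m) (F m) (U n) (F n) -> allgood m <-> allgood n.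
  move=> [V [oV [q Vq] VU FV]]; have [Um Un] := VU q Vq.
  have e : \forall r \near q, F m r = F n r.
    by apply: (near_open oV Vq) => r Vr; apply: FV; rewrite inE.
  have e' : \forall r \near q, F n r = F m r by apply: filterS e.
  split=> g; first exact: (prop n q Un (canonical_at_ext e (g q Um))).
  exact: (prop m q Um (canonical_at_ext e' (g q Un))).
have g0 : allgood 0%N.
  have : allgood N by exact: prop Up0 gp0.
  elim/ltn_ind: N {Up0 gp0} => -[|N] IH // gN.
  by have [m mN dc] := cont N; apply: (IH m) => //; apply/(link _ _ dc).
elim/ltn_ind => -[|n] IH //.
by have [m mn dc] := cont n; apply/(link _ _ dc)/IH.
Qed.

End Angles.

(** * Rotation of the parameters and monodromy *)

Section Monodromy.
Variable R : realType.
Implicit Types (F G T : R * R -> R) (U V H : set (R * R)) (p q : R * R) (P : params R).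

Lemma angle_exists (c s : R) : c ^+ 2 + s ^+ 2 = 1 -> exists a : R, cos a = c /\ sin a = s.
Proof.
move=> cs; have s2 := sqr_ge0 s; have c2 := sqr_ge0 c.
have cI : -1 <= c <= 1.
  by apply/andP; split; rewrite leNgt; apply/negP => h; nra.
have ca : cos (acos c) = c by rewrite acosK// in_itv.
have sa : sin (acos c) = `|s|.
  by rewrite sin_acos// (_ : 1 - c ^+ 2 = s ^+ 2) ?sqrtr_sqr//; lra.
have [s0|s0] := lerP 0 s.
  by exists (acos c); rewrite ca sa ger0_norm.
by exists (- acos c); rewrite cosN sinN ca sa ltr0_norm// opprK.
Qed.

Lemma is_angle_rotate c s a q t : cos a = c -> sin a = s ->
  is_angle (rotate c s q) t -> is_angle q (t + a).
Proof. by move=> <- <-; rewrite /is_angle /rotate /= cosD sinD => h; lra. Qed.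

(** Parameters after a rotation by the angle a with cosine c and sine s.  Rotating
    b1 y^2 + b2 x y produces a multiple of r^2 = x^2 + y^2 besides a form of the same shape;
    divided by r^2, it is absorbed by the constant term.  For c1 y^2 + c2 x y it is absorbed by
    the coefficient of r^2.  The angle itself shifts by a. *)
Definition rotate_params (c s a : R) P : params R :=
  let b0 := pb1 P * s ^+ 2 - pb2 P * c * s in
  let c0 := pc1 P * s ^+ 2 - pc2 P * c * s in
  let a2 := pa2 P * c - pa2' P * s in
  let a2' := pa2 P * s + pa2' P * c in
  Params (pa1 P) a2 a2' (pa3 P)
    (pb1 P * c ^+ 2 + pb2 P * c * s - b0) (pb2 P * (c ^+ 2 - s ^+ 2) - 2 * pb1 P * c * s)
    (pc1 P * c ^+ 2 + pc2 P * c * s - c0) (pc2 P * (c ^+ 2 - s ^+ 2) - 2 * pc1 P * c * s)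
    (pe P + c0 - a * pa1 P) (pf P * c - pg P * s - a * a2) (pf P * s + pg P * c - a * a2')
    (ph P + b0 - a * pa3 P).

Lemma norm2_rot c s q : c ^+ 2 + s ^+ 2 = 1 -> norm2 (rotate c s q) = norm2 q.
Proof.
move=> cs; rewrite /norm2 /rotate /=.
transitivity ((c ^+ 2 + s ^+ 2) * (q.1 * q.1 + q.2 * q.2)); first by ring.
by rewrite cs mul1r.
Qed.

Lemma canonical_fun_rotate c s a P t q : c ^+ 2 + s ^+ 2 = 1 ->
  punctured q \/ (pb1 P = 0 /\ pb2 P = 0) ->
  canonical_fun P t (rotate c s q) = canonical_fun (rotate_params c s a P) (t + a) q.
Proof.
move=> cs hb.
have key : (pb1 P * (rotate c s q).2 ^+ 2 + pb2 P * (rotate c s q).1 * (rotate c s q).2) / norm2 q =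
  (pb1 (rotate_params c s a P) * q.2 ^+ 2 + pb2 (rotate_params c s a P) * q.1 * q.2) / norm2 q
   + (pb1 P * s ^+ 2 - pb2 P * c * s).
  case: hb => [q0|[b1 b2]]; last by rewrite /rotate_params /= b1 b2; ring.
  have n0 : norm2 q != 0 by rewrite gt_eqF.
  have -> : pb1 P * s ^+ 2 - pb2 P * c * s =
    (pb1 P * s ^+ 2 - pb2 P * c * s) * norm2 q / norm2 q by rewrite mulfK.
  by rewrite -mulrDl; congr (_ / _); rewrite /rotate_params /rotate /norm2 /=; ring.
rewrite /canonical_fun norm2_rot// key /angular_part norm2_rot// /rotate_params /=.
have E : norm2 q = q.1 ^+ 2 + q.2 ^+ 2 by rewrite /norm2 -!expr2.
move: (_ / norm2 q) => B; rewrite E; clear.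
by move: q.1 q.2 => x y; rewrite /rotate /=; ring.
Qed.

Lemma canonical_at_rotate c s P F p : c ^+ 2 + s ^+ 2 = 1 -> punctured p ->
  canonical_at P (fun q => F (rotate c (- s) q)) (rotate c s p) -> exists P', canonical_at P' F p.
Proof.
move=> cs p0 [T cT aT]; have [a [ca sa]] := angle_exists cs.
exists (rotate_params c s a P), (fun q => T (rotate c s q) + a).
  apply: continuousD; last exact: cst_continuous.
  by apply: (continuous_comp (@rotate_continuous R c s p) cT).
have cr := @rotate_continuous R c s p.
have n1 : \forall q \near p, is_angle (rotate c s q) (T (rotate c s q)) /\
   F (rotate c (- s) (rotate c s q)) = canonical_fun P (T (rotate c s q)) (rotate c s q).
  exact: (cr _ aT).
have n2 : \forall q \near p, punctured q.
  by apply: open_nbhs_nbhs; split => //; exact: open_punctured.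
have fI X Y : nbhs p X -> nbhs p Y -> nbhs p (X `&` Y) by move=> *; exact: filterI.
apply: filterS (fI _ _ n1 n2) => q [/= [h1 h2] q0]; split.
  exact: is_angle_rotate ca sa h1.
rewrite -(canonical_fun_rotate a _ cs (or_introl q0)) -h2; congr F.
rewrite /rotate /= [LHS]surjective_pairing; congr pair => /=.
  transitivity ((c ^+ 2 + s ^+ 2) * q.1); last by ring.
  by rewrite cs mul1r.
transitivity ((c ^+ 2 + s ^+ 2) * q.2); last by ring.
by rewrite cs mul1r.
Qed.

Lemma Ty_Tx_pos q : 0 < q.1 * q.2 -> Ty q = Tx q.
Proof.
move=> xy.
have x0 : q.1 != 0 by apply/eqP => h; move: xy; rewrite h mul0r ltxx.
have y0 : q.2 != 0 by apply/eqP => h; move: xy; rewrite h mulr0 ltxx.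
have [k kE] := is_angle_diff (norm2_gt0x x0) (is_angle_Tx x0) (is_angle_Ty y0).
have p1 : 0 < q.2 / q.1.
  by rewrite -(pmulr_lgt0 _ (_ : 0 < q.1 ^+ 2)) ?exprn_even_gt0// expr2 mulrA mulfVK// mulrC.
have p2 : 0 < q.1 / q.2.
  by rewrite -(pmulr_lgt0 _ (_ : 0 < q.2 ^+ 2)) ?exprn_even_gt0// expr2 mulrA mulfVK.
have := lt_atan p1; have := lt_atan p2; rewrite atan0 => a1 a2.
have := @atan_ltpi2 R (q.2 / q.1); have := @atan_ltpi2 R (q.1 / q.2) => a3 a4.
have k0 : k = 0.
  apply: (@piz_small R); have -> : pi *~ k = Ty q - Tx q :> R by rewrite kE; ring.
  by rewrite /Ty /Tx ltr_norml; apply/andP; split; lra.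
by rewrite kE k0 mulr0z addr0.
Qed.

Lemma Ty_Tx_neg q : q.1 * q.2 < 0 -> Ty q = Tx q + pi.
Proof.
move=> xy.
have x0 : q.1 != 0 by apply/eqP => h; move: xy; rewrite h mul0r ltxx.
have y0 : q.2 != 0 by apply/eqP => h; move: xy; rewrite h mulr0 ltxx.
have [k kE] := is_angle_diff (norm2_gt0x x0) (is_angle_Tx x0) (is_angle_Ty y0).
have p1 : q.2 / q.1 < 0.
  by rewrite -(pmulr_llt0 _ (_ : 0 < q.1 ^+ 2)) ?exprn_even_gt0// expr2 mulrA mulfVK// mulrC.
have p2 : q.1 / q.2 < 0.
  by rewrite -(pmulr_llt0 _ (_ : 0 < q.2 ^+ 2)) ?exprn_even_gt0// expr2 mulrA mulfVK.
have := lt_atan p1; have := lt_atan p2; rewrite atan0 => a1 a2.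
have := @atan_gtNpi2 R (q.2 / q.1); have := @atan_gtNpi2 R (q.1 / q.2) => a3 a4.
have k0 : k - 1 = 0.
  apply: (@piz_small R).
  have -> : pi *~ (k - 1) = Ty q - Tx q - pi :> R by rewrite kE mulrzBr mulr1z; ring.
  by rewrite /Ty /Tx ltr_norml; apply/andP; split; lra.
by rewrite kE; move/eqP: k0; rewrite subr_eq0 => /eqP ->; rewrite mulr1z.
Qed.

Lemma canonical_fun_sheets P t t' q : canonical_fun P t q = canonical_fun P t' q -> angular_part P q * (t - t') = 0.
Proof. by rewrite /canonical_fun => h; move: (_ / norm2 q) h => B; move: (angular_part P q) => A h; lra. Qed.

(** Four points of the quadrant already suffice. *)
Lemma angular_part_zero P (r u v : R) : 0 < r -> u ^+ 2 = 1 -> v ^+ 2 = 1 ->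
  (forall x y, 0 < x < r -> 0 < y < r -> angular_part P (u * x, v * y) = 0) ->
  [/\ pa1 P = 0, pa2 P = 0, pa2' P = 0 & pa3 P = 0].
Proof.
move=> r0 u1 v1 h; pose d := r / 4.
have d0 : 0 < d by rewrite divr_gt0.
have I1 : 0 < d < r by rewrite /d; apply/andP; split; lra.
have I2 : 0 < 2 * d < r by rewrite /d; apply/andP; split; lra.
have I3 : 0 < 3 * d < r by rewrite /d; apply/andP; split; lra.
clearbody d.
have k11 := h _ _ I1 I1; have k21 := h _ _ I2 I1; have k31 := h _ _ I3 I1.
have k12 := h _ _ I1 I2.
have E x y : angular_part P (u * x, v * y) = pa1 P * (x ^+ 2 + y ^+ 2) + pa2 P * (u * x) + pa2' P * (v * y) + pa3 P.
  rewrite /angular_part /norm2 /=; congr (_ * _ + _ + _ + _).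
  transitivity (u ^+ 2 * x ^+ 2 + v ^+ 2 * y ^+ 2); first by ring.
  by rewrite u1 v1 !mul1r.
rewrite !E in k11 k21 k31 k12.
have u0 : u != 0 by apply/eqP => z; move: u1; rewrite z expr0n /= => /eqP; rewrite eq_sym oner_eq0.
have v0 : v != 0 by apply/eqP => z; move: v1; rewrite z expr0n /= => /eqP; rewrite eq_sym oner_eq0.
have dd : d ^+ 2 != 0 by rewrite expf_neq0// gt_eqF.
have A1 : pa1 P = 0.
  have : 2 * (pa1 P * d ^+ 2) = 0 by lra.
  by move/eqP; rewrite mulf_eq0 pnatr_eq0 /= mulf_eq0 (negbTE dd) orbF => /eqP.
rewrite A1 !mul0r !add0r in k11 k21 k31 k12.
have A2 : pa2 P = 0.
  have : pa2 P * (u * d) = 0 by lra.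
  by move/eqP; rewrite !mulf_eq0 (negbTE u0) (gt_eqF d0) !orbF => /eqP.
have A2' : pa2' P = 0.
  have : pa2' P * (v * d) = 0 by lra.
  by move/eqP; rewrite !mulf_eq0 (negbTE v0) (gt_eqF d0) !orbF => /eqP.
by split => //; move: k11; rewrite A2 A2' !mul0r !add0r.
Qed.

(** Going around the origin once changes the angle by 2 pi.  F lies on one sheet over each of
    the four half squares of the ball.  Two adjacent ones share a quadrant, where the equality
    of the two expressions for F either kills the angular part or relates the sheet numbers;
    the four relations so obtained contradict each other. *)
Theorem monodromy P F (r : R) : 0 < r -> biharmonic (ball ((0, 0) : R * R) r) F ->
  (forall q, ball ((0, 0) : R * R) r q -> punctured q -> canonical_at P F q) ->
  [/\ pa1 P = 0, pa2 P = 0, pa2' P = 0 & pa3 P = 0].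
Proof.
move=> r0 bF gF; set B := ball _ r in bF gF.
have BE : B = box (- r) r (- r) r by rewrite /B ball_box /= !sub0r !add0r.
have bx (a b c d : R) : - r <= a -> b <= r -> - r <= c -> d <= r -> box a b c d `<=` B.
  move=> h1 h2 h3 h4 q [/andP[q1 q2] /andP[q3 q4]]; rewrite BE.
  by split; apply/andP; split; lra.
have ob (a b c d : R) : open (box a b c d).
  have /continuousP h1 : continuous (fun p : R * R => p.1) by move=> p; exact: cvg_fst.
  have /continuousP h2 : continuous (fun p : R * R => p.2) by move=> p; exact: cvg_snd.
  have -> : box a b c d = ((fun p : R * R => p.1) @^-1` `]a, b[) `&` ((fun p : R * R => p.2) @^-1` `]c, d[).
    by apply/seteqP; split => q /=; rewrite !in_itv.
  by apply: openI; [apply: h1|apply: h2]; exact: interval_open.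
have sheet (H : set (R * R)) T a b c d p : std_branch H T -> box a b c d `<=` H -> box a b c d `<=` B ->
    box a b c d p -> exists k : int, forall q, box a b c d q -> F q = canonical_fun P (T q + pi *~ k) q.
  move=> st bH bB bp.
  apply: (canonical_at_connected st (ob _ _ _ _) (@box_connected _ _ _ _ _) bH (biharmonic_sub bB bF) bp).
  by apply: gF; [exact: bB|exact: std_punctured st _ (bH _ bp)].
have rr : - r <= r by lra.
have [k1 s1] : exists k : int, forall q, box 0 r (- r) r q -> F q = canonical_fun P (Tx q + pi *~ k) q.
  apply: (@sheet _ _ 0 r (- r) r (r / 2, 0) (std_x R)).
  - by move=> q [/andP[q0 _] _]; rewrite /Hx /= gt_eqF.
  - by apply: bx; lra.
  - by split => /=; apply/andP; split; lra.
have [k2 s2] : exists k : int, forall q, box (- r) r 0 r q -> F q = canonical_fun P (Ty q + pi *~ k) q.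
  apply: (@sheet _ _ (- r) r 0 r (0, r / 2) (std_y R)).
  - by move=> q [_ /andP[q0 _]]; rewrite /Hy /= gt_eqF.
  - by apply: bx; lra.
  - by split => /=; apply/andP; split; lra.
have [k3 s3] : exists k : int, forall q, box (- r) 0 (- r) r q -> F q = canonical_fun P (Tx q + pi *~ k) q.
  apply: (@sheet _ _ (- r) 0 (- r) r (- r / 2, 0) (std_x R)).
  - by move=> q [/andP[_ q0] _]; rewrite /Hx /= lt_eqF.
  - by apply: bx; lra.
  - by split => /=; apply/andP; split; lra.
have [k4 s4] : exists k : int, forall q, box (- r) r (- r) 0 q -> F q = canonical_fun P (Ty q + pi *~ k) q.
  apply: (@sheet _ _ (- r) r (- r) 0 (0, - r / 2) (std_y R)).
  - by move=> q [_ /andP[_ q0]]; rewrite /Hy /= lt_eqF.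
  - by apply: bx; lra.
  - by split => /=; apply/andP; split; lra.
have alt (u v : R) (j k l : int) : u ^+ 2 = 1 -> v ^+ 2 = 1 ->
  (forall x y, 0 < x < r -> 0 < y < r -> let q := (u * x, v * y) in
     canonical_fun P (Tx q + pi *~ k) q = canonical_fun P (Tx q + pi *~ j + pi *~ l) q) ->
  [/\ pa1 P = 0, pa2 P = 0, pa2' P = 0 & pa3 P = 0] \/ k = j + l.
  move=> u1 v1 h; have [->|kl] := eqVneq k (j + l); first by right.
  left; apply: (angular_part_zero r0 u1 v1) => x y xr yr.
  have /canonical_fun_sheets := h x y xr yr.
  have -> : Tx (u * x, v * y) + pi *~ k - (Tx (u * x, v * y) + pi *~ j + pi *~ l) =
    pi *~ (k - (j + l)) :> R by rewrite mulrzBr mulrzDr; ring.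
  move/eqP; rewrite mulf_eq0 => /orP[/eqP //|].
  by rewrite mulrz_eq0 (gt_eqF (pi_gt0 R)) orbF subr_eq0 (negbTE kl).
have n1 : (-1 : R) ^+ 2 = 1 by rewrite sqrrN expr1n.
have o1 : (1 : R) ^+ 2 = 1 by rewrite expr1n.
have [//|e1] : [/\ pa1 P = 0, pa2 P = 0, pa2' P = 0 & pa3 P = 0] \/ k1 = 0 + k2.
  apply: (alt 1 1 0 k1 k2 o1 o1) => x y /andP[x0 xr] /andP[y0 yr] q.
  rewrite mulr0z addr0 -(@Ty_Tx_pos q) ?mulr_gt0 ?mul1r// -s2 ?(@Ty_Tx_pos q) ?mulr_gt0 ?mul1r// -?s1 //;
    by split => /=; rewrite mul1r; apply/andP; split; lra.
have [//|e2] : [/\ pa1 P = 0, pa2 P = 0, pa2' P = 0 & pa3 P = 0] \/ k3 = 1 + k2.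
  apply: (alt (-1) 1 1 k3 k2 n1 o1) => x y /andP[x0 xr] /andP[y0 yr] q.
  have qn : q.1 * q.2 < 0 by rewrite /q /= mul1r mulN1r mulNr oppr_lt0 mulr_gt0.
  rewrite mulr1z -(Ty_Tx_neg qn) -s2 -?s3//;
    by split => /=; rewrite ?mul1r ?mulN1r; apply/andP; split; lra.
have [//|e3] : [/\ pa1 P = 0, pa2 P = 0, pa2' P = 0 & pa3 P = 0] \/ k3 = 0 + k4.
  apply: (alt (-1) (-1) 0 k3 k4 n1 n1) => x y /andP[x0 xr] /andP[y0 yr] q.
  have qp : 0 < q.1 * q.2 by rewrite /q /= !mulN1r mulrNN mulr_gt0.
  rewrite mulr0z addr0 -{2}(Ty_Tx_pos qp) -s4 -?s3//;
    by split => /=; rewrite ?mul1r ?mulN1r; apply/andP; split; lra.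
have [//|e4] : [/\ pa1 P = 0, pa2 P = 0, pa2' P = 0 & pa3 P = 0] \/ k1 = 1 + k4.
  apply: (alt 1 (-1) 1 k1 k4 o1 n1) => x y /andP[x0 xr] /andP[y0 yr] q.
  have qn : q.1 * q.2 < 0 by rewrite /q /= mul1r mulN1r mulrN oppr_lt0 mulr_gt0.
  rewrite mulr1z -(Ty_Tx_neg qn) -s4 -?s1//;
    by split => /=; rewrite ?mul1r ?mulN1r; apply/andP; split; lra.
exfalso; move: e4; rewrite e1 add0r => e4; move: e3; rewrite e2 e4 add0r addrA => /eqP.
by rewrite -subr_eq0 addrK.
Qed.

End Monodromy.

(** * Moving multi-valued surfaces *)

Section Moves.
Variable R : realType.
Implicit Types (F G H : R * R -> R) (U V D : set (R * R)) (p q : R * R) (P : params R).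

Definition surface (U : nat -> set (R * R)) (F : nat -> R * R -> R) : set (R * R * R) :=
  \bigcup_n graph_on (U n) (F n).

(** A change of coordinates of space, seen on graphs over D: [f] acts on points of space,
    [phi] on their top views, with inverse [psi], and [act] on the functions. *)
Record move (D D' : set (R * R)) (phi psi : R * R -> R * R)
    (act : (R * R -> R) -> R * R -> R) (f : ext_space R -> ext_space R) : Prop := Move {
  mv_open : open D';
  mv_fwd : forall p, D p -> D' (phi p) /\ psi (phi p) = p;
  mv_bwd : forall q, D' q -> D (psi q) /\ phi (psi q) = q;
  mv_cfwd : forall p, D p -> {for p, continuous phi};
  mv_cbwd : forall q, D' q -> {for q, continuous psi};
  mv_biharmonic : forall V H, open V -> V `<=` D -> biharmonic V H ->
    biharmonic (D' `&` psi @^-1` V) (act H);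
  mv_ext : forall p H, D p -> f (inl (p, H p)) = inl (phi p, act H (phi p));
  mv_iM : iM_transformation f }.

Section Transport.
Variables (D D' : set (R * R)) (phi psi : R * R -> R * R).
Variables (act : (R * R -> R) -> R * R -> R) (f : ext_space R -> ext_space R).
Hypothesis mv : move D D' phi psi act f.

Lemma move_image V : V `<=` D -> D' `&` psi @^-1` V = phi @` V.
Proof.
move=> VD; apply/seteqP; split => [q [D'q Vq]|_ [p Vp <-]].
  by exists (psi q) => //; have [] := mv_bwd mv D'q.
have [D'p e] := mv_fwd mv (VD _ Vp).
by split => //=; rewrite e.
Qed.

Lemma move_open V : open V -> open (D' `&` psi @^-1` V).
Proof.
move=> oV; rewrite openE => q [D'q Vq]; apply: filterI.
  by apply: open_nbhs_nbhs; split => //; exact: mv_open mv.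
apply: (mv_cbwd mv D'q (_ : nbhs (psi q) V)).
by apply: open_nbhs_nbhs.
Qed.

Lemma move_eq H H' p : D p -> H p = H' p -> act H (phi p) = act H' (phi p).
Proof.
move=> Dp e; have := mv_ext mv H Dp; rewrite e (mv_ext mv H' Dp) => h.
by case: h.
Qed.

Lemma move_sheets (U : nat -> set (R * R)) (F : nat -> R * R -> R) : sheets U F -> (forall n, U n `<=` D) ->
  sheets (fun n => D' `&` psi @^-1` (U n)) (fun n => act (F n)).
Proof.
move=> [reg cont] UD; split=> n.
  have [[oU cU U0] bF] := reg n; split; last exact: mv_biharmonic mv _ _ oU (UD n) bF.
  split; first exact: move_open.
    rewrite move_image//; apply: connected_continuous_connected => //.
    apply: continuous_in_subspaceT => p; rewrite inE => /UD Dp.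
    exact: mv_cfwd mv p Dp.
  by rewrite move_image//; have [p Up] := U0; exists (phi p), p.
have [m mn [V [oV V0 VU FV]]] := cont n; exists m => //.
have VD : V `<=` D by move=> p /VU [/UD].
exists (D' `&` psi @^-1` V); split; first exact: move_open.
- by rewrite move_image//; have [p Up] := V0; exists (phi p), p.
- by move=> q [D'q /VU [Um Un]].
- move=> q; rewrite inE => -[D'q Vq]; have [Dp <-] := mv_bwd mv D'q.
  by apply: move_eq => //; apply: FV; rewrite inE.
Qed.

Lemma move_surface (U : nat -> set (R * R)) (F : nat -> R * R -> R) : (forall n, U n `<=` D) ->
  f @` embed (surface U F) = embed (surface (fun n => D' `&` psi @^-1` (U n)) (fun n => act (F n))).
Proof.
move=> UD; apply/seteqP; split.
  move=> _ [_ [[p z] [n _ [/= Up ->]] <-] <-]; have Dp := UD n p Up.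
  rewrite (mv_ext mv (F n) Dp); exists (phi p, act (F n) (phi p)) => //.
  exists n => //; split => //=; have [? e] := mv_fwd mv Dp.
  by rewrite e.
move=> _ [[q z] [n _ [/= [D'q Uq] ->]] <-]; have [Dp e] := mv_bwd mv D'q.
exists (inl (psi q, F n (psi q))); last by rewrite (mv_ext mv (F n) Dp) e.
by exists (psi q, F n (psi q)) => //; exists n.
Qed.

End Transport.

Lemma sheets_setD1 (U : nat -> set (R * R)) (F : nat -> R * R -> R) p : sheets U F -> sheets (fun n => U n `\ p) F.
Proof.
have ne V : open V -> V !=set0 -> (V `\ p) !=set0.
  move=> oV [q Vq]; have [qp|qp] := eqVneq q p; last by exists q; split => //; apply/eqP.
  have [e e0 sub] := open_ball oV Vq.
  exists (q.1 + e / 2, q.2); split.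
    apply: sub; apply/ball_square => /=; rewrite subrr normr0 addrC addKr gtr0_norm ?divr_gt0//.
    by split => //; rewrite ltr_pdivrMr// ltr_pMr// ltr1n.
  rewrite -qp => /= h; have : q.1 + e / 2 = q.1 by rewrite -[in RHS]h.
  by move/eqP; rewrite -subr_eq0 addrC addKr gt_eqF// divr_gt0.
move=> [reg cont]; split=> n.
  have [[oU cU U0] bF] := reg n; split; last by apply: biharmonic_sub bF => q [].
  by split; [exact: open_setD1|exact: connected_setD1|exact: ne].
have [m mn [V [oV V0 VU FV]]] := cont n; exists m => //.
exists (V `\ p); split; [exact: open_setD1|exact: ne| |].
  by move=> q [/VU [? ?] qp].
by move=> q; rewrite inE => -[Vq _]; apply: FV; rewrite inE.
Qed.

Lemma ray_limit F (u v a b c r : R) : {for (0, 0), continuous F} -> 0 < r ->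
  (forall s, 0 < s < r -> F (s * u, s * v) = c + a * s + b * s ^+ 2) -> F (0, 0) = c.
Proof.
move=> cF r0 h; pose f s : R := F (s * u, s * v) - (c + a * s + b * s ^+ 2).
have : f 0 = 0.
  apply: zeros_continuous.
    move=> e e0; pose d := Num.min e r / 2.
    have m0 : 0 < Num.min e r by rewrite lt_min e0.
    have d0 : 0 < d by rewrite divr_gt0.
    have dm : d < Num.min e r by rewrite ltr_pdivrMr// ltr_pMr// ltr1n.
    move: dm; rewrite lt_min => /andP[de dr].
    exists d; first by rewrite gtr0_norm// d0.
    by rewrite /f h ?d0// subrr.
  apply: continuousB.
    have c1 : {for (0 : R), continuous (fun s : R => (s * u, s * v) : R * R)}.
      apply: (@pair_continuous R _ (fun s : R => s * u) (fun s : R => s * v) 0); exact: mulrr_continuous.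
    by apply: (continuous_comp c1); rewrite /= !mul0r.
  apply: continuousD; last first.
    by apply: continuousM; [exact: cst_continuous|exact: exprn_continuous].
  by apply: continuousD; [exact: cst_continuous|exact: mulrl_continuous].
by rewrite /f !mul0r mulr0 expr0n /= mulr0 !addr0 => /eqP; rewrite subr_eq0 => /eqP.
Qed.

(** Without its angular part, which [monodromy] excludes, a canonical function has at the
    origin the limit ph + (b1 v^2 + b2 u v) / (u^2 + v^2) along the ray of direction (u, v), and
    continuity makes it independent of the direction. *)
Theorem smooth_at_origin P U F : open U -> biharmonic U F -> U (0, 0) ->
  (forall q, U q -> punctured q -> canonical_at P F q) ->
  [/\ [/\ pa1 P = 0, pa2 P = 0, pa2' P = 0 & pa3 P = 0],
     pb1 P = 0, pb2 P = 0 & F (0, 0) = ph P].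
Proof.
move=> oU bF U0 gF; have [r r0 sub] := open_ball oU U0.
have gB q : ball ((0, 0) : R * R) r q -> punctured q -> canonical_at P F q by move=> /sub; exact: gF.
have [a1 a2 a2' a3] := monodromy r0 (biharmonic_sub sub bF) gB.
have cF : {for (0, 0), continuous F} by case: bF => CF _; exact: (class_C_cont CF U0).
have ray (u v : R) : `|u| <= 1 -> `|v| <= 1 -> 0 < u ^+ 2 + v ^+ 2 ->
    F (0, 0) = (pb1 P * v ^+ 2 + pb2 P * u * v) / (u ^+ 2 + v ^+ 2) + ph P.
  move=> u1 v1 uv; apply: (@ray_limit F u v (pf P * u + pg P * v)
    (pc1 P * v ^+ 2 + pc2 P * u * v + pe P * (u ^+ 2 + v ^+ 2)) _ r cF r0) => s /andP[s0 sr].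
  have n0 : norm2 (s * u, s * v) = s ^+ 2 * (u ^+ 2 + v ^+ 2) by rewrite /norm2 /=; ring.
  have bs : ball ((0, 0) : R * R) r (s * u, s * v).
    by apply/ball_square; rewrite /= !subr0 !normrM gtr0_norm//; split;
      apply: le_lt_trans sr; rewrite ger_pMr.
  have ps : punctured (s * u, s * v) by rewrite /punctured /= n0 mulr_gt0// exprn_gt0.
  have [T _ /nbhs_singleton [_ ->]] := gB _ bs ps.
  have s1 : s != 0 by rewrite gt_eqF.
  have n1 : u ^+ 2 + v ^+ 2 != 0 by rewrite gt_eqF.
  rewrite /canonical_fun /angular_part a1 a2 a2' a3 n0 /=; clear -s1 n1.
  by field; rewrite n1 s1.
have N0 : `|0 : R| <= 1 by rewrite normr0.
have N1 : `|1 : R| <= 1 by rewrite normr1.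
have := ray 1 0 N1 N0; have := ray 0 1 N0 N1; have := ray 1 1 N1 N1.
rewrite !expr0n !expr1n /= !(mulr1, mulr0, mul0r, addr0, add0r, divr1).
move=> /(_ (ltr0Sn _ 1)) h3 /(_ ltr01) h2 /(_ ltr01) h1.
have b1 : pb1 P = 0 by lra.
rewrite (_ : 1 + 1 = 2 :> R)// in h3.
by split => //; lra.
Qed.

End Moves.

(** * Explicit i-M-transformations *)

Section Transformations.
Variable R : realType.
Implicit Types (F G H : R * R -> R) (p q v w : R * R) (S : set (ext_space R)).

(** Equations of preimages are obtained by substitution. *)
Lemma iM_transformation_of_inverse (f g : ext_space R -> ext_space R) :
  cancel f g -> cancel g f ->
  (forall a b c d, iM_sphere (f @^-1` iM_sphere_of a b c d)) ->
  (forall a b c d, iM_sphere (g @^-1` iM_sphere_of a b c d)) ->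
  iM_transformation f.
Proof.
move=> fK gK sf sg; split; first by exists g.
have fS S : f @` S = g @^-1` S.
  apply/seteqP; split => [_ [p Sp <-]|p Sp]; first by rewrite /= fK.
  by exists (g p).
move=> S; split=> [[a [b [c [d ->]]]]|[a [b [c [d e]]]]]; first by rewrite fS; exact: sg.
have -> : S = f @^-1` (f @` S).
  by apply/seteqP; split => [p Sp|p [q Sq /(can_inj fK) <-]//]; exists p.
by rewrite e; exact: sf.
Qed.

Lemma iM_equivalent_trans (A B D : set (ext_space R)) :
  iM_equivalent A B -> iM_equivalent B D -> iM_equivalent A D.
Proof.
move=> [f [bf sf] <-] [g [bg sg] <-]; exists (g \o f); last by rewrite -image_comp.
split; first exact: bij_comp.
by move=> S; rewrite -image_comp -sg.
Qed.

Definition translation v (p : ext_space R) : ext_space R :=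
  match p with inl (q, z) => inl ((q.1 - v.1, q.2 - v.2), z) | inr t => inr t end.

Lemma translationK v w : v.1 + w.1 = 0 -> v.2 + w.2 = 0 -> cancel (translation v) (translation w).
Proof.
move=> e1 e2 [[[x y] z]|t] //=; rewrite -!addrA -!opprD e1 e2 subr0 subr0 //.
Qed.

Lemma translation_sphere v a b c d : translation v @^-1` iM_sphere_of a b c d =
  iM_sphere_of a (b - a * v.1) (c - a * v.2)
    (d + a / 2 * (v.1 ^+ 2 + v.2 ^+ 2) - b * v.1 - c * v.2).
Proof. by apply/seteqP; split => -[[[x y] z]|t] //= ->; field. Qed.

Lemma iM_translation v : iM_transformation (translation v).
Proof.
apply: (@iM_transformation_of_inverse _ (translation (- v.1, - v.2))).
- by apply: translationK; rewrite /= subrr.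
- by apply: translationK; rewrite /= addNr.
- by move=> a b c d; rewrite translation_sphere; do 4 eexists.
- by move=> a b c d; rewrite translation_sphere; do 4 eexists.
Qed.

Definition rotation (c s : R) (p : ext_space R) : ext_space R :=
  match p with inl (q, z) => inl (rotate c s q, z) | inr t => inr t end.

Lemma rotateK (c s : R) : c ^+ 2 + s ^+ 2 = 1 -> cancel (rotate c s) (rotate c (- s)).
Proof.
move=> cs [x y]; rewrite /rotate /=; congr pair.
  by transitivity ((c ^+ 2 + s ^+ 2) * x); [ring|rewrite cs mul1r].
by transitivity ((c ^+ 2 + s ^+ 2) * y); [ring|rewrite cs mul1r].
Qed.

Lemma rotation_sphere (c s a b b' d : R) : c ^+ 2 + s ^+ 2 = 1 ->
  rotation c s @^-1` iM_sphere_of a b b' d = iM_sphere_of a (b * c - b' * s) (b * s + b' * c) d.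
Proof.
move=> cs.
have E x y : a / 2 * ((c * x + s * y) ^+ 2 + (c * y - s * x) ^+ 2) + b * (c * x + s * y)
   + b' * (c * y - s * x) + d =
   a / 2 * ((c ^+ 2 + s ^+ 2) * (x ^+ 2 + y ^+ 2)) + (b * c - b' * s) * x + (b * s + b' * c) * y + d.
  by ring.
apply/seteqP; split => -[[[x y] z]|t] //=; by rewrite E cs mul1r.
Qed.

Lemma iM_rotation (c s : R) : c ^+ 2 + s ^+ 2 = 1 -> iM_transformation (rotation c s).
Proof.
move=> cs; have csN : c ^+ 2 + (- s) ^+ 2 = 1 by rewrite sqrrN.
apply: (@iM_transformation_of_inverse _ (rotation c (- s))).
- by move=> [[q z]|t] //=; rewrite rotateK.
- by move=> [[q z]|t] //=; rewrite -{1}[s]opprK rotateK.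
- by move=> a b b' d; rewrite rotation_sphere//; do 4 eexists.
- by move=> a b b' d; rewrite rotation_sphere//; do 4 eexists.
Qed.

Definition shear (a b c d : R) (p : ext_space R) : ext_space R :=
  match p with
  | inl (q, z) => inl (q, z - (a / 2 * (q.1 ^+ 2 + q.2 ^+ 2) + b * q.1 + c * q.2 + d))
  | inr t => inr (t - a) end.

Lemma shearK a b c d : cancel (shear a b c d) (shear (- a) (- b) (- c) (- d)).
Proof.
move=> [[[x y] z]|t] /=; last by rewrite opprK subrK.
by congr (inl (_, _)); field.
Qed.

Lemma shear_sphere a b c d a' b' c' d' : shear a b c d @^-1` iM_sphere_of a' b' c' d' =
  iM_sphere_of (a' + a) (b' + b) (c' + c) (d' + d).
Proof.
apply/seteqP; split => -[[[x y] z]|t] /=.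
- by move=> /eqP; rewrite subr_eq => /eqP ->; field.
- by move=> <-; rewrite subrK.
- by move=> ->; field.
- by move=> ->; rewrite addrK.
Qed.

Lemma iM_shear a b c d : iM_transformation (shear a b c d).
Proof.
apply: (@iM_transformation_of_inverse _ (shear (- a) (- b) (- c) (- d))).
- exact: shearK.
- by move=> p; rewrite -{1}[a]opprK -{1}[b]opprK -{1}[c]opprK -{1}[d]opprK shearK.
- by move=> a' b' c' d'; rewrite shear_sphere; do 4 eexists.
- by move=> a' b' c' d'; rewrite shear_sphere; do 4 eexists.
Qed.

(** The map p |-> p / (x^2 + y^2), which exchanges the vertical axis with the ideal line.
    The factor 2 comes from the coefficient a / 2 in the equation of an i-M-sphere. *)
Definition inversion (p : ext_space R) : ext_space R :=
  match p with
  | inl (q, z) => if q == (0, 0) then inr (2 * z) else inl (inv_pt q, z / norm2 q)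
  | inr t => inl ((0, 0), t / 2) end.

Lemma inversionK : involutive inversion.
Proof.
have two : (2 : R) != 0 by rewrite pnatr_eq0.
move=> [[q z]|t] /=; last by rewrite eqxx mulrCA divff// mulr1.
case: eqP => [->|/puncturedP q0] /=; first by rewrite mulrAC divff// mul1r.
have /puncturedP/eqP/negbTE -> := punctured_inv_pt q0.
by rewrite inv_ptK// norm2_inv_pt// invrK mulfVK// gt_eqF.
Qed.

Lemma inversion_sphere a b c d : inversion @^-1` iM_sphere_of a b c d =
  iM_sphere_of (2 * d) b c (a / 2).
Proof.
have two : (2 : R) != 0 by rewrite pnatr_eq0.
have E q z : punctured q ->
  z / norm2 q = a / 2 * ((q.1 / norm2 q) ^+ 2 + (q.2 / norm2 q) ^+ 2) + b * (q.1 / norm2 q) + c * (q.2 / norm2 q) + d <->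
  z = 2 * d / 2 * (q.1 ^+ 2 + q.2 ^+ 2) + b * q.1 + c * q.2 + a / 2.
  move=> q0; have n0 : norm2 q != 0 by rewrite gt_eqF.
  have e : a / 2 * ((q.1 / norm2 q) ^+ 2 + (q.2 / norm2 q) ^+ 2) + b * (q.1 / norm2 q) + c * (q.2 / norm2 q) + d =
    (2 * d / 2 * (q.1 ^+ 2 + q.2 ^+ 2) + b * q.1 + c * q.2 + a / 2) / norm2 q.
    by move: n0; rewrite /norm2 => n0; field.
  by rewrite e; split => [|-> //]; apply: mulIf; rewrite invr_eq0.
apply/seteqP; split => -[[[x y] z]|t] /=.
- case: eqP => [[-> ->]|/puncturedP q0] /=.
    by move=> <-; field.
  by rewrite /im_inv opprK => h; exact: (proj1 (E (x, y) z q0)).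
- by rewrite !expr0n /= => h; have -> : t = 2 * d by lra.
- case: eqP => [[-> ->]|/puncturedP q0] /=; first by move=> ->; field.
  by rewrite /im_inv opprK => h; exact: (proj2 (E (x, y) z q0)).
- by move=> ->; rewrite !expr0n /=; field.
Qed.

Lemma iM_inversion : iM_transformation inversion.
Proof.
apply: (@iM_transformation_of_inverse _ inversion); [exact: inversionK|exact: inversionK|..].
  by move=> a b c d; rewrite inversion_sphere; do 4 eexists.
by move=> a b c d; rewrite inversion_sphere; do 4 eexists.
Qed.

Lemma move_translation v : move setT setT (fun p => (p.1 - v.1, p.2 - v.2))
  (fun q => (q.1 + v.1, q.2 + v.2)) (fun H q => H (q.1 + v.1, q.2 + v.2)) (translation v).
Proof.
split.
- exact: openT.
- by move=> [x y] _ /=; rewrite !subrK.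
- by move=> [x y] _ /=; rewrite !addrK.
- by move=> p _; exact: (@tr_continuous R (- v.1, - v.2)).
- by move=> p _; exact: tr_continuous.
- by move=> V H oV _ bH; rewrite setTI; exact: biharmonic_tr.
- by move=> [x y] H _ /=; rewrite !subrK.
- exact: iM_translation.
Qed.

Lemma move_inversion : move (@punctured R) (@punctured R) (@inv_pt R) (@inv_pt R)
  (@kelvin R) inversion.
Proof.
have h p : punctured p -> punctured (inv_pt p) /\ inv_pt (inv_pt p) = p.
  by move=> p0; split; [exact: punctured_inv_pt|exact: inv_ptK].
split => //.
- exact: open_punctured.
- exact: inv_pt_continuous.
- exact: inv_pt_continuous.
- by move=> V H oV _ bH; exact: biharmonic_kelvin.
- move=> p H p0 /=; have /puncturedP/eqP/negbTE -> := p0.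
  by rewrite /kelvin inv_ptK// norm2_inv_pt// mulrC.
- exact: iM_inversion.
Qed.

End Transformations.

(** * Arcs on a countable union of graphs *)

Section Arcs.
Variable R : realType.
Implicit Types (p q : R * R) (D : set (R * R)) (C : set (ext_space R)).

(** An arc of C on the graph of F over D, parametrised by its top view. *)
Definition arc_in D (F : R * R -> R) C : Prop :=
  exists (gam : R -> R * R) (a b : R), [/\ a < b,
    forall t, a <= t <= b -> {for t, continuous gam},
    forall t u, a <= t <= b -> a <= u <= b -> gam t = gam u -> t = u &
    forall t, a <= t <= b -> D (gam t) /\ C (inl (gam t, F (gam t)))].

(** Three points have three distinct images. *)
Lemma avoid_two (h : R -> R * R) (t d : R) (P Q : R * R) : 0 < d ->
  (forall u v, `|u - t| < d -> `|v - t| < d -> h u = h v -> u = v) ->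
  exists u, [/\ `|u - t| < d, h u <> P & h u <> Q].
Proof.
move=> d0 inj.
have i0 : `|t - t| < d by rewrite subrr normr0.
have i1 : `|t + d / 3 - t| < d by rewrite addrC addKr gtr0_norm; lra.
have i2 : `|t + d / 2 - t| < d by rewrite addrC addKr gtr0_norm; lra.
apply: contrapT => no.
have alt u : `|u - t| < d -> h u = P \/ h u = Q.
  move=> ud; apply: contrapT => /not_orP[h1 h2]; apply: no.
  by exists u.
have e01 : h t = h (t + d / 3) -> False by move=> /(inj _ _ i0 i1); lra.
have e02 : h t = h (t + d / 2) -> False by move=> /(inj _ _ i0 i2); lra.
have e12 : h (t + d / 3) = h (t + d / 2) -> False by move=> /(inj _ _ i1 i2); lra.
case: (alt _ i0) => E0; case: (alt _ i1) => E1; case: (alt _ i2) => E2;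
  by move: e01 e02 e12; rewrite E0 E1 E2 //; move=> a b c; solve [exact: a|exact: b|exact: c].
Qed.

(** Baire: countably many sets of parameters, one for each element, cover the parameter
    interval of the arc, so one of them is dense in some open interval.  Where the element is
    defined and continuous, density implies that the whole subarc lies on its graph.  The top
    view is injective there, so a smaller interval avoids P and Q. *)
Theorem arc_sheet (U : nat -> set (R * R)) (F : nat -> R * R -> R) (P Q : R * R)
    (Phi : set (R * R * R)) C :
  (forall n, open (U n)) -> (forall n p, U n p -> {for p, continuous (F n)}) ->
  Phi = surface U F -> contains_arc_of Phi C ->
  exists n, arc_in (U n `\ P `\ Q) (F n) C.
Proof.
move=> oU cF -> [_ [[g [cg ig ->]] gC gPhi]].
have cgt t : 0 < t < 1 -> {for t, continuous g}.
  by move=> t01; apply: (within_continuous_continuous ltr01 cg); rewrite in_itv.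
have in01 (t : R) : 0 < t < 1 -> `[0, 1]%classic t.
  by move=> /andP[t0 t1]; rewrite /= in_itv /= !ltW.
pose h t := (g t).1.
have ch t : 0 < t < 1 -> {for t, continuous h}.
  by move=> t01; apply: (continuous_comp (cgt t t01)); exact: cvg_fst.
pose E n := [set t : R | 0 < t < 1 /\ graph_on (U n) (F n) (g t)].
have [n nd] : exists n, ~ dense (~` closure (E n)).
  apply/existsNP => dE.
  have := @Baire R R^o (fun n => ~` closure (E n)) => /(_ _) B.
  have {B} B : dense (\bigcap_n ~` closure (E n)).
    by apply: B => n; split; [apply: closed_openC; exact: closed_closure|exact: dE].
  have [||t [t01 tE]] := B `]0, 1[%classic.
  - by exists (1 / 2) => /=; rewrite in_itv /=; apply/andP; split; lra.
  - exact: interval_open.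
  move: t01; rewrite /= in_itv /= => t01.
  have [n _ gn] : surface U F (g t) by apply: gPhi; exists t => //; exact: in01.
  by apply: (tE n I); apply: subset_closure; split.
have [W [[x Ox] oW OE]] : exists W, [/\ W !=set0, open W & W `<=` closure (E n)].
  move: nd => /existsNP[W] /not_implyP[W0] /not_implyP[oW] no.
  exists W; split => // x Ox; apply: contrapT => nE; apply: no.
  by exists x; split.
have [t0 [[t01 [/= Ut0 _]] Ot0]] : E n `&` W !=set0.
  by apply: (OE x Ox); apply: open_nbhs_nbhs.
have fI t X Y : nbhs (t : R) X -> nbhs t Y -> nbhs t (X `&` Y) by move=> *; exact: filterI.
have I01 t : 0 < t < 1 -> nbhs (t : R) [set u : R | 0 < u < 1].
  move=> tt; have -> : [set u : R | 0 < u < 1] = `]0, 1[%classic.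
    by apply/seteqP; split => u /=; rewrite in_itv.
  by apply: open_nbhs_nbhs; split; [exact: interval_open|rewrite /= in_itv].
have nO t : W t -> nbhs t W by move=> Ot; apply: open_nbhs_nbhs.
have pre t (V : set (R * R)) : 0 < t < 1 -> nbhs (h t) V -> nbhs t (h @^-1` V).
  by move=> tt; exact: (ch t tt V).
have nU t : 0 < t < 1 -> U n (h t) -> nbhs t (h @^-1` U n).
  by move=> tt Ut; apply: pre => //; apply: open_nbhs_nbhs.
have [d /= d0 dsub] : exists2 d, 0 < d & ball t0 d `<=` W `&` ([set u : R | 0 < u < 1] `&` (h @^-1` U n)).
  have /nbhs_ballP[d d0 s] := fI _ _ _ (nO t0 Ot0) (fI _ _ _ (I01 _ t01) (nU _ t01 Ut0)).
  by exists d.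
have eqd t : ball t0 d t -> (g t).2 = F n (h t).
  move=> /dsub[Ot [tt Ut]]; apply: contrapT => ne.
  pose e u := (g u).2 - F n (h u).
  have ce : {for t, continuous e}.
    apply: continuousB.
      by apply: (continuous_comp (cgt t tt)); exact: cvg_snd.
    by apply: (continuous_comp (ch t tt)); exact: cF.
  have e0 : 0 < `|e t| by rewrite normr_gt0 subr_eq0; apply/eqP.
  have /cvgrPdist_lt /(_ _ e0) nt := ce.
  have [u [[_ [_ /= eu]] hu]] := OE t Ot _ nt.
  by move: hu; rewrite /= /e eu -/(h u) subrr subr0 ltxx.
have injh u v : `|u - t0| < d -> `|v - t0| < d -> h u = h v -> u = v.
  move=> ud vd huv.
  have bu : ball t0 d u by rewrite /ball /= distrC.
  have bv : ball t0 d v by rewrite /ball /= distrC.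
  have [_ [tu _]] := dsub u bu; have [_ [tv _]] := dsub v bv.
  apply: ig; [by rewrite inE; exact: in01|by rewrite inE; exact: in01|].
  by rewrite [LHS]surjective_pairing [RHS]surjective_pairing (eqd u bu) (eqd v bv) -/(h u) -/(h v) huv.
have [u [ud uP uQ]] := avoid_two P Q d0 injh.
have bu : ball t0 d u by rewrite /ball /= distrC.
have [Ou [uu Uu]] := dsub u bu.
have nPQ p : h u <> p -> nbhs u (h @^-1` [set q | q <> p]).
  move=> up; apply: pre => //.
  have := @open_setD1 R setT p openT; rewrite setTD => oC.
  by apply: open_nbhs_nbhs; split.
have nb : nbhs u (ball t0 d) by apply: open_nbhs_nbhs; split => //; exact: ball_open.
have /nbhs_ballP[r /= r0 rsub] := fI _ _ _ nb (fI _ _ _ (nPQ P uP) (nPQ Q uQ)).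
have key t : u <= t <= u + r / 2 -> ball t0 d t /\ (h t <> P /\ h t <> Q).
  move=> /andP[t1 t2]; apply: rsub; rewrite /ball /= distrC ger0_norm; lra.
exists n, h, u, (u + r / 2); split.
- by rewrite ltrDl divr_gt0.
- by move=> t /key[/dsub[_ [tt _]] _]; exact: ch.
- move=> t v /key[bt _] /key[bv _]; apply: injh; rewrite distrC; assumption.
- move=> t /key[bt [tP tQ]]; have [_ [tt Ut]] := dsub t bt; split; first by split.
  rewrite -(eqd t bt); apply: gC; exists (g t); first by exists t => //; exact: in01.
  by rewrite /h -surjective_pairing.
Qed.

Section Transport.
Variables (D D' : set (R * R)) (phi psi : R * R -> R * R).
Variables (act : (R * R -> R) -> R * R -> R) (f : ext_space R -> ext_space R).
Hypothesis mv : move D D' phi psi act f.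

Lemma move_arc V V' H C : V `<=` D -> (forall p, V p -> V' (phi p)) -> arc_in V H C ->
  arc_in V' (act H) (f @` C).
Proof.
move=> VD VV' [gam [a [b [ab cg ig gV]]]]; exists (phi \o gam), a, b; split => //.
- move=> t tab; apply: continuous_comp; first exact: cg.
  by apply: (mv_cfwd mv); apply: VD; exact: (proj1 (gV t tab)).
- move=> t u tab uab /= /(congr1 psi).
  have [[Vt _] [Vu _]] := (gV t tab, gV u uab).
  rewrite (proj2 (mv_fwd mv (VD _ Vt))) (proj2 (mv_fwd mv (VD _ Vu))).
  exact: ig.
- move=> t tab /=; have [Vt Ct] := gV t tab; split; first exact: VV'.
  by rewrite -(mv_ext mv H (VD _ Vt)); exists (inl (gam t, H (gam t))).
Qed.

End Transport.

Lemma arc_sub D D' F C : D `<=` D' -> arc_in D F C -> arc_in D' F C.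
Proof.
move=> DD' [gam [a [b [ab cg ig gV]]]]; exists gam, a, b; split => // t /gV[/DD' ? ?].
by split.
Qed.

End Arcs.

(** * Circles over lines through the origin *)

Section Pigeonhole.
Variable R : realType.
Implicit Types (p q : R * R) (D : set (R * R)) (C : set (ext_space R)).

Definition polar (q : R * R) : R * R := (q.1 * cos q.2, q.1 * sin q.2).

(** The circle over the line of direction th, where the height is a polynomial in the signed
    distance to the origin.  Its ideal point is the i-mean curvature 2 a. *)
Definition circle_over_line (th a b c : R) : set (ext_space R) :=
  [set p | match p with
           | inl (q, z) => exists2 r : R, q = polar (r, th) & z = a * r ^+ 2 + b * r + c
           | inr t => t = 2 * a end].

(** A common ideal point of two spheres means equal quadratic terms, and a common point over
    the origin equal constant terms.  Subtracting their equations leaves the equation of a line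
    through the origin. *)
Lemma circle_over_lineP C : iM_circle C -> (exists t, C (inr t)) ->
  (exists z, C (inl ((0, 0), z))) -> exists th a b c, C = circle_over_line th a b c.
Proof.
move=> [_ [_ [[A [b1 [c1 [d1 ->]]]] [A' [b2 [c2 [d2 ->]]]] ne -> _]]].
move=> [t [/= tA tA']] [z [/= z1 z2]]; subst A A'.
rewrite !expr0n /= !(addr0, add0r, mulr0) in z1 z2; subst d1 d2.
pose be := b1 - b2; pose ga := c1 - c2; pose N := Num.sqrt (be ^+ 2 + ga ^+ 2).
have n2 : 0 < be ^+ 2 + ga ^+ 2.
  rewrite lt0r addr_ge0 ?sqr_ge0// andbT paddr_eq0 ?sqr_ge0// !sqrf_eq0.
  apply/negP => /andP[/eqP e1 /eqP e2]; apply: ne.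
  by have -> : b1 = b2 by [move/eqP: e1; rewrite subr_eq0 => /eqP]; have -> : c1 = c2 by [move/eqP: e2; rewrite subr_eq0 => /eqP].
have N0 : 0 < N by rewrite sqrtr_gt0.
have NN : N ^+ 2 = be ^+ 2 + ga ^+ 2 by rewrite sqr_sqrtr// ltW.
have N1 : N != 0 by rewrite gt_eqF.
have [|th [cth sth]] := @angle_exists R (ga / N) (- be / N).
  by rewrite !expr_div_n -mulrDl sqrrN NN addrC divff// gt_eqF.
have cs := cos2Dsin2 th.
exists th, (t / 2), (b1 * cos th + c1 * sin th), z.
have line x y : be * x + ga * y = 0 <-> exists r, (x, y) = polar (r, th).
  split=> [e|[r [-> ->]]]; last by rewrite cth sth; field.
  exists (x * cos th + y * sin th); rewrite /polar /=.
  have e' : y * cos th = x * sin th.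
    rewrite cth sth; apply: (mulIf N1); rewrite !mulrA !mulfVK//; lra.
  congr pair.
    transitivity (x * (cos th ^+ 2 + sin th ^+ 2)); first by rewrite cs mulr1.
    by transitivity (x * cos th ^+ 2 + (x * sin th) * sin th); [ring|rewrite -e'; ring].
  transitivity (y * (cos th ^+ 2 + sin th ^+ 2)); first by rewrite cs mulr1.
  by transitivity ((y * cos th) * cos th + y * sin th ^+ 2); [ring|rewrite e'; ring].
have val r : t / 2 * ((r * cos th) ^+ 2 + (r * sin th) ^+ 2) = t / 2 * r ^+ 2.
  by transitivity (t / 2 * (r ^+ 2 * (cos th ^+ 2 + sin th ^+ 2))); [ring|rewrite cs mulr1].
apply/seteqP; split => -[[[x y] w]|u] /=.
- move=> [e1 e2]; have [|r xy] := (proj1 (line x y)); first by rewrite /be /ga; lra.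
  exists r => //; rewrite e1; case: xy => -> ->; rewrite /= val; ring.
- by move=> [e _]; rewrite e mulrC divfK // pnatr_eq0.
- move=> [r xy ->]; have /line l : exists r, (x, y) = polar (r, th) by exists r.
  case: xy l => -> -> /= l; rewrite val; split; first by ring.
  by move: l; rewrite /be /ga => l; lra.
- by move=> e; rewrite e mulrC divfK ?pnatr_eq0.
Qed.

Lemma polar_continuous : continuous polar.
Proof.
move=> q.
have c2 : {for q, continuous (fun r : R * R => r.2)} by exact: cvg_snd.
apply: (@pair_continuous R _ (fun r : R * R => r.1 * cos r.2) (fun r : R * R => r.1 * sin r.2)).
  apply: continuousM; first exact: cvg_fst.
  by apply: (continuous_comp c2); exact: continuous_cos.
apply: continuousM; first exact: cvg_fst.
by apply: (continuous_comp c2); exact: continuous_sin.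
Qed.

Lemma polar_box D (r th : R) : open D -> D (polar (r, th)) -> exists2 d, 0 < d &
  forall u v, `|u - r| < d -> `|v - th| < d -> D (polar (u, v)).
Proof.
move=> oD Dp; have oP : open (polar @^-1` D).
  by have /continuousP h := polar_continuous; exact: h.
have [d d0 sub] := open_ball oP Dp; exists d => // u v h1 h2.
by apply: (sub (u, v)); apply/ball_square.
Qed.

(** On a line the top view of the arc is a continuous injective real function, so it covers
    the segment between its end points. *)
Lemma arc_over_line D F (th a b c : R) : arc_in D F (circle_over_line th a b c) ->
  exists l u : R, l < u /\ forall r, l < r < u ->
    D (polar (r, th)) /\ F (polar (r, th)) = a * r ^+ 2 + b * r + c.
Proof.
move=> [g [t0 [t1 [t01 cg ig gD]]]].
pose h t := (g t).1 * cos th + (g t).2 * sin th.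
have gh t : t0 <= t <= t1 -> g t = polar (h t, th).
  move=> /gD[_ [r gr _]]; rewrite /h gr /polar /=; have cs := cos2Dsin2 th.
  have -> // : r * cos th * cos th + r * sin th * sin th = r.
  by transitivity (r * (cos th ^+ 2 + sin th ^+ 2)); [ring|rewrite cs mulr1].
have e0 : t0 <= t0 <= t1 by rewrite lexx ltW.
have e1 : t0 <= t1 <= t1 by rewrite lexx ltW.
have ne : h t0 <> h t1.
  move=> e; have := ig _ _ e0 e1; rewrite (gh _ e0) (gh _ e1) e => /(_ erefl) e'.
  by rewrite e' ltxx in t01.
have ch : {within `[t0, t1], continuous h}.
  apply: continuous_in_subspaceT => t; rewrite inE /= in_itv /= => tt.
  have c1 : {for t, continuous (fun t => (g t).1)} by apply: (continuous_comp (cg t tt)); exact: cvg_fst.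
  have c2 : {for t, continuous (fun t => (g t).2)} by apply: (continuous_comp (cg t tt)); exact: cvg_snd.
  have c3 (k : R) : {for t, continuous (fun=> k : R)} by exact: cst_continuous.
  exact: (continuousD (continuousM c1 (c3 (cos th))) (continuousM c2 (c3 (sin th)))).
exists (Num.min (h t0) (h t1)), (Num.max (h t0) (h t1)); split.
  by rewrite gt_min !lt_max !ltxx /= orbF -neq_lt; apply/eqP.
move=> r /andP[r1 r2]; have [|t] := @IVT R h t0 t1 r (ltW t01) ch; first by rewrite !ltW.
rewrite in_itv /= => tt <-; have [Dt [r' gr Fr]] := gD t tt.
rewrite -(gh t tt); split => //; rewrite Fr.
have -> // : h t = r'.
rewrite /h gr /polar /=; have cs := cos2Dsin2 th.
by transitivity (r' * (cos th ^+ 2 + sin th ^+ 2)); [ring|rewrite cs mulr1].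
Qed.

Lemma quadratic_uniq (l u a b c a' b' c' : R) : l < u ->
  (forall r, l < r < u -> a * r ^+ 2 + b * r + c = a' * r ^+ 2 + b' * r + c') ->
  [/\ a = a', b = b' & c = c'].
Proof.
move=> lu h; pose m := (l + u) / 2; pose d := (u - l) / 4.
have d0 : 0 < d by rewrite /d; lra.
have h0 : l < m < u by rewrite /m; apply/andP; split; lra.
have h1 : l < m + d < u by rewrite /m /d; apply/andP; split; lra.
have h2 : l < m - d < u by rewrite /m /d; apply/andP; split; lra.
move: (h _ h0) (h _ h1) (h _ h2); clearbody m d => k0 k1 k2.
have dd : d ^+ 2 != 0 by rewrite expf_neq0// gt_eqF.
have ea : a = a'.
  have : 2 * ((a - a') * d ^+ 2) = 0 by lra.
  by move/eqP; rewrite mulf_eq0 pnatr_eq0 /= mulf_eq0 (negbTE dd) orbF subr_eq0 => /eqP.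
subst a'; have eb : b = b'.
  have : (b - b') * d = 0 by lra.
  by move/eqP; rewrite mulf_eq0 (gt_eqF d0) orbF subr_eq0 => /eqP.
by subst b'; split => //; lra.
Qed.

(** Otherwise the segment would be countable, hence of measure zero. *)
Lemma segment_pigeonhole (I : countType) (A : I -> set R) (t0 t1 : R) : t0 < t1 ->
  `[t0, t1]%classic `<=` \bigcup_i A i -> exists i, infinite_set (A i).
Proof.
move=> t01 sub; apply: contrapT => /forallNP no.
have cA : countable (\bigcup_i A i).
  apply: bigcup_countable => // i _; apply: finite_set_countable.
  exact: contrapT (no i).
have /countable_lebesgue_measure0 := sub_countable (subset_card_le sub) cA.
rewrite lebesgue_measure_itv /= lte_fin t01 => /eqP.
by rewrite -EFinB eqe subr_eq0 gt_eqF.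
Qed.

End Pigeonhole.

(** * Infinitely many circles on one element *)

Section FamilyOnElement.
Variable R : realType.
Implicit Types (p q : R * R) (D : set (R * R)).

(** Bolzano-Weierstrass. *)
Lemma infinite_in_segment (E : set R) (a b : R) : infinite_set E ->
  (forall x, E x -> a <= x <= b) -> exists2 l, a <= l <= b &
  forall e : R, 0 < e -> exists x, [/\ E x, x != l & `|x - l| < e].
Proof.
move=> iE Eab.
have bE : bounded_set E.
  exists (Num.max `|a| `|b|); split; first exact: num_real.
  move=> M /= hM x /Eab /andP[ax xb]; apply/ltW/(le_lt_trans _ hM).
  have h1 := ler_norm (- a); rewrite normrN in h1; have h2 := ler_norm b.
  have m1 : `|a| <= Num.max `|a| `|b| by rewrite le_max lexx.
  have m2 : `|b| <= Num.max `|a| `|b| by rewrite le_max lexx orbT.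
  by rewrite ler_norml; apply/andP; split; lra.
have [l El] := infinite_bounded_limit_point_nonempty iE bE.
have near e : 0 < e -> exists x, [/\ E x, x != l & `|x - l| < e].
  move=> e0; have [|x [xl Ex bx]] := El (ball l e); first exact: nbhsx_ballx.
  by exists x; split => //; move: bx; rewrite /ball /= distrC.
exists l => //; apply/andP; split; rewrite leNgt; apply/negP => h.
  have [|x [/Eab/andP[x1 x2] _]] := near (a - l); first by rewrite subr_gt0.
  by rewrite ltr_norml => /andP[_ ?]; lra.
have [|x [/Eab/andP[x1 x2] _]] := near (l - b); first by rewrite subr_gt0.
by rewrite ltr_norml => /andP[? _]; lra.
Qed.

Lemma small_tan (w : R) : 0 < w -> exists2 d : R, 0 < d & forall x, 0 < `|x| < d ->
  [/\ cos x != 0, 0 < `|tan x| < w & `|(cos x)^-1 - 1| < w].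
Proof.
move=> w0.
have c00 : cos (0 : R) != 0 by rewrite cos0 oner_eq0.
have ct := continuous_tan c00.
have ci : {for (0 : R), continuous (fun x => (cos x)^-1)}.
  by apply: continuousV => //; exact: continuous_cos.
have /cvgrPdist_lt /(_ _ w0) n1 := ct.
have /cvgrPdist_lt /(_ _ w0) n2 := ci.
have n3 : nbhs (0 : R) [set x | cos x != 0].
  exact: (cvgr_neq0 (cos 0) (@continuous_cos R 0) c00).
have fI X Y : nbhs (0 : R) X -> nbhs (0 : R) Y -> nbhs (0 : R) (X `&` Y) by move=> *; exact: filterI.
have /nbhs_ballP[d /= d0 sub] := fI _ _ n1 (fI _ _ n2 n3).
have pi0 := pi_gt0 R.
exists (Num.min d pi); first by rewrite lt_min d0.
move=> x /andP[x0]; rewrite lt_min => /andP[xd xpi].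
have [|/= h1 [/= h2 h3]] := sub x; first by rewrite /ball /= sub0r normrN.
split => //; last by rewrite distrC; move: h2; rewrite cos0 invr1.
rewrite normr_gt0; apply/andP; split; last by move: h1; rewrite tan0 sub0r normrN.
rewrite /tan mulf_neq0 ?invr_eq0//; apply/eqP => /sin_eq0_piz[k xk].
move: xpi x0; rewrite xk => /piz_small ->.
by rewrite mulr0z normr0 ltxx.
Qed.

(** Polar boxes instead of boxes in x and y: all lines through the origin with directions in
    [s1, s2], the limiting ones included, cross such a box in segments of the same shape. *)
Definition strip (U : set (R * R)) (F : R * R -> R) (q1 q2 s1 s2 th : R)
    (C : set (ext_space R)) : Prop :=
  [/\ s1 <= th <= s2, forall r v, q1 <= r <= q2 -> s1 <= v <= s2 -> U (polar (r, v)) &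
    exists a b c, C = circle_over_line th a b c /\
      forall r, q1 < r < q2 -> F (polar (r, th)) = a * r ^+ 2 + b * r + c].

Lemma rat_below (x e : R) : 0 < e -> exists q : rat, x - e < ratr q < x.
Proof.
move=> e0; have [|q] := @rat_in_itvoo R (x - e) x; first by rewrite ltrBlDr ltrDl.
by rewrite in_itv; exists q.
Qed.

Lemma rat_above (x e : R) : 0 < e -> exists q : rat, x < ratr q < x + e.
Proof.
move=> e0; have [|q] := @rat_in_itvoo R x (x + e); first by rewrite ltrDl.
by rewrite in_itv; exists q.
Qed.

Lemma strip_exists U F C : open U -> (exists th a b c, C = circle_over_line th a b c) ->
  arc_in U F C -> exists (q1 q2 s1 s2 : rat) (th : R),
    ratr q1 < ratr q2 :> R /\ strip U F (ratr q1) (ratr q2) (ratr s1) (ratr s2) th C.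
Proof.
move=> oU [th [a [b [c CE]]]]; rewrite CE => /arc_over_line[l [u [lu h]]].
pose m := (l + u) / 2.
have lm : l < m < u by rewrite /m; apply/andP; split; lra.
have [d d0 box] := polar_box oU (proj1 (h m lm)).
pose e := Num.min d ((u - l) / 2).
have e0 : 0 < e by rewrite lt_min d0; lra.
have ed : e <= d by rewrite ge_min lexx.
have el : e <= (u - l) / 2 by rewrite ge_min lexx orbT.
have [q1 /andP[q1a q1b]] := rat_below m e0; have [q2 /andP[q2a q2b]] := rat_above m e0.
have [s1 /andP[s1a s1b]] := rat_below th e0; have [s2 /andP[s2a s2b]] := rat_above th e0.
exists q1, q2, s1, s2, th; split; first exact: lt_trans q1b q2a.
split; first by rewrite !ltW.
- move=> r v /andP[r1 r2] /andP[v1 v2]; apply: box; rewrite ltr_norml; apply/andP; split; lra.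
- exists a, b, c; split => // r /andP[r1 r2]; apply: (proj2 (h r _)).
  by rewrite /m in q1a q2b; apply/andP; split; lra.
Qed.

(** Countably many elements and rational polar boxes share uncountably many circles, so one
    box over one element carries infinitely many of them.  On a fixed box the direction
    determines the polynomial, hence the circle; so infinitely many directions occur and
    accumulate at some th.  Turning th to the x-axis gives slopes accumulating at 0, as required
    by [local_normal_form]. *)
Theorem family_canonical_at (U : nat -> set (R * R)) (F : nat -> R * R -> R) (t0 t1 : R)
    (C : R -> set (ext_space R)) :
  t0 < t1 -> {in `[t0, t1] &, injective C} ->
  (forall n, open (U n)) -> (forall n, biharmonic (U n) (F n)) ->
  (forall n, U n `<=` @punctured R) ->
  (forall t, t \in `[t0, t1] -> exists th a b c, C t = circle_over_line th a b c) ->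
  (forall t, t \in `[t0, t1] -> exists n, arc_in (U n) (F n) (C t)) ->
  exists P n p, U n p /\ canonical_at P (F n) p.
Proof.
move=> t01 injC oU bF UP line arcs.
pose I := (nat * ((rat * rat) * (rat * rat)))%type.
pose st (i : I) th t := t \in `[t0, t1] /\ ratr i.2.1.1 < ratr i.2.1.2 :> R /\
  strip (U i.1) (F i.1) (ratr i.2.1.1) (ratr i.2.1.2) (ratr i.2.2.1) (ratr i.2.2.2) th (C t).
have [[n [[q1' q2'] [s1' s2']]] iA] : exists i : I, infinite_set [set t | exists th, st i th t].
  apply: (segment_pigeonhole t01) => t tt.
  have [n an] := arcs t tt.
  have [q1 [q2 [s1 [s2 [th [q12 S]]]]]] := strip_exists (oU n) (line t tt) an.
  by exists (n, ((q1, q2), (s1, s2))) => //; exists th.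
rewrite /st /= in iA; move: (ratr q1' : R) (ratr q2' : R) (ratr s1' : R) (ratr s2' : R) iA.
move=> q1 q2 s1 s2 iA.
pose S th t := t \in `[t0, t1] /\ q1 < q2 /\ strip (U n) (F n) q1 q2 s1 s2 th (C t).
have Suniq th t t' : S th t -> S th t' -> t = t'.
  move=> [tt [q12 [_ _ [a [b [c [Ct h]]]]]]] [tt' [_ [_ _ [a' [b' [c' [Ct' h']]]]]]].
  apply: injC => //; rewrite Ct Ct'.
  have [|-> -> -> //] := @quadratic_uniq R q1 q2 a b c a' b' c' q12.
  by move=> r rr; rewrite -h// -h'.
pose Th := [set th | exists t, S th t].
have iTh : infinite_set Th.
  move=> fTh; apply: iA; apply: (sub_finite_set _ (finite_image (fun th => xget 0 [set t | S th t]) fTh)).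
  move=> t [th Sth]; exists th; first by exists t.
  by have := @xgetPex _ 0 [set t | S th t] (ex_intro _ t Sth) => /= h; exact: Suniq h Sth.
have [th thI lim] : exists2 l, s1 <= l <= s2 &
  forall e : R, 0 < e -> exists x, [/\ Th x, x != l & `|x - l| < e].
  by apply: infinite_in_segment iTh _ => x [t [_ [_ []]]].
have [x0 [[u0 [_ [q12 [_ Ubox _]]]] _ _]] := lim 1 ltr01.
pose m := (q1 + q2) / 2.
have mI : q1 <= m <= q2 by rewrite /m; apply/andP; split; lra.
have Um : U n (polar (m, th)) := Ubox m th mI thI.
have m0 : m != 0.
  apply/eqP => mz; have /puncturedP := UP n _ Um; apply.
  by rewrite mz /polar /= !mul0r.
pose c := cos th; pose s := sin th.
have cs : c ^+ 2 + s ^+ 2 = 1 by exact: cos2Dsin2.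
have csN : c ^+ 2 + (- s) ^+ 2 = 1 by rewrite sqrrN.
pose G q := F n (rotate c (- s) q).
have oW := @open_rotate R c (- s) _ (oU n).
have bG : biharmonic (rotate c (- s) @^-1` U n) G by exact: biharmonic_rotate csN (oU n) (bF n).
have mE : rotate c (- s) (m, 0) = polar (m, th).
  by rewrite /rotate /polar /c /s /=; congr pair; ring.
have [r0 r00 r0sub] : exists2 e : R, 0 < e & ball ((m, 0) : R * R) e `<=` rotate c (- s) @^-1` U n.
  by apply: open_ball oW _; rewrite /= mE.
pose k := (q2 - q1) / 4.
have k0 : 0 < k by rewrite /k; lra.
have mm : 0 < `|m| by rewrite normr_gt0.
pose r := Num.min r0 (Num.min k `|m|).
have r_gt0 : 0 < r by rewrite !lt_min r00 k0.
have rm : r <= `|m| by rewrite !ge_min lexx !orbT.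
have rk : r <= k by rewrite !ge_min lexx !orbT.
have rr0 : r <= r0 by rewrite ge_min lexx.
have Bsub : ball ((m, 0) : R * R) r `<=` rotate c (- s) @^-1` U n.
  by move=> q bq; apply: r0sub; exact: le_ball bq.
have [P nP] : exists P, \forall q \near (m, r / 2), G q = canonical_fun P (Tx q) q.
  apply: (local_normal_form r_gt0 rm (biharmonic_sub Bsub bG)) => e e0.
  (* for angles this small, a point of the line with abscissa within r of m has
     polar radius in (q1, q2), because |x| < 2 |m| *)
  pose w := Num.min e (k / (2 * `|m|)).
  have w0 : 0 < w by rewrite lt_min e0 divr_gt0// mulr_gt0.
  have [d d0 hd] := small_tan w0.
  have [x [[t [_ [_ [_ _ [a [b [g [_ hx]]]]]]]] xth xd]] := lim d d0.
  have xth0 : 0 < `|x - th| by rewrite normr_gt0 subr_eq0.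
  have [|c0 /andP[tn0 tnw] ci] := hd (x - th); first by rewrite xth0.
  pose z := x - th.
  exists (tan z); first by rewrite tn0 (lt_le_trans tnw)// ge_min lexx.
  exists g, (b / cos z), (a / cos z ^+ 2) => y ym.
  have -> : G (y, tan z * y) = F n (polar (y / cos z, x)).
    have xE : x = th + z by rewrite /z; ring.
    rewrite -/z in c0; rewrite /G; congr (F n _); rewrite /rotate /polar /c /s /tan /= xE cosD sinD.
    by clear -c0; clearbody z; congr pair; field.
  rewrite hx; first by rewrite -/z in c0; field.
  have ylt : `|y| < 2 * `|m|.
    have -> : y = (y - m) + m by rewrite subrK.
    rewrite (le_lt_trans (ler_normD _ _))//; have := lt_le_trans ym rm; lra.
  have : `|y / cos z - m| < 2 * k.
    have -> : y / cos z - m = y * ((cos z)^-1 - 1) + (y - m) by ring.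
    rewrite (le_lt_trans (ler_normD _ _))// normrM.
    have : `|y| * `|(cos z)^-1 - 1| <= k.
      apply: (@le_trans _ _ (2 * `|m| * (k / (2 * `|m|)))).
        by rewrite ler_pM// ?ltW// (lt_le_trans ci)// ge_min lexx orbT.
      by rewrite mulrC divfK// mulf_neq0 ?normr_eq0// pnatr_eq0.
    have := lt_le_trans ym rk; lra.
  by rewrite ltr_norml /k /m => /andP[h1 h2]; apply/andP; split; lra.
have gG : canonical_at P G (m, r / 2).
  apply: (std_canonical_at (c := 0) (std_x R)); first exact: m0.
  by apply: filterS nP => q ->; rewrite mulr0z addr0.
pose p := rotate c (- s) (m, r / 2).
have Up : U n p.
  apply: (Bsub (m, r / 2)); apply/ball_square => /=; rewrite subrr normr0 subr0.
  by rewrite gtr0_norm ?divr_gt0//; split => //; lra.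
have pE : rotate c s p = (m, r / 2).
  by have := rotateK csN (m, r / 2); rewrite opprK.
have [|P' gP] := @canonical_at_rotate R c s P (F n) p cs (UP n p Up); first by rewrite pE.
by exists P', n, p.
Qed.

End FamilyOnElement.

(** * Pencils with a base point at infinity *)

Section Assembly.
Variable R : realType.
Implicit Types (p q v w : R * R) (A B : ext_plane R) (Phi : set (R * R * R)).
Implicit Types (U : nat -> set (R * R)) (F : nat -> R * R -> R).

Definition canonical_up_to_iM Phi : Prop :=
  exists (a1 a2 a3 b1 b2 c1 c2 : R) (Psi : set (R * R * R)),
    Psi `<=` canonical_surface a1 a2 a3 b1 b2 c1 c2 /\
    iM_equivalent (embed Phi) (embed Psi).

Lemma Arctan_quotientP (x y t : R) : is_angle (x, y) t -> Arctan_quotient y x t.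
Proof.
rewrite /is_angle /Arctan_quotient /=; case: eqP => [->|/eqP x0 h]; first by rewrite mul0r.
have [k ->] := is_angle_diff (@norm2_gt0x R (x, y) x0) (@is_angle_Tx R (x, y) x0) h.
by exists k.
Qed.

Lemma canonical_image Phi (g : R * R * R -> R * R * R) (f : ext_space R -> ext_space R) a1 a2 a3 b1 b2 c1 c2 :
  iM_transformation f -> (forall x, f (inl x) = inl (g x)) ->
  (forall x, Phi x -> canonical_surface a1 a2 a3 b1 b2 c1 c2 (g x)) -> canonical_up_to_iM Phi.
Proof.
move=> iMf fg can; exists a1, a2, a3, b1, b2, c1, c2, (g @` Phi); split.
  by move=> _ [x Phix <-]; exact: can.
exists f => //; apply/seteqP; split.
  by move=> _ [_ [x Phix <-] <-]; rewrite fg; exists (g x) => //; exists x.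
by move=> _ [_ [x Phix <-] <-]; exists (inl x) => //; exists x.
Qed.

Lemma iM_transformation_comp (f g : ext_space R -> ext_space R) :
  iM_transformation f -> iM_transformation g -> iM_transformation (g \o f).
Proof.
move=> [bf sf] [bg sg]; split; first exact: bij_comp.
by move=> S; rewrite -image_comp -sg.
Qed.

(** The rotation that turns the linear form a x + b y into a multiple of x. *)
Lemma align_direction (a b : R) : exists c s : R, c ^+ 2 + s ^+ 2 = 1 /\ a * s + b * c = 0.
Proof.
have [/eqP|n0] := eqVneq (a ^+ 2 + b ^+ 2) 0.
  rewrite paddr_eq0 ?sqr_ge0// !sqrf_eq0 => /andP[/eqP -> /eqP ->].
  by exists 1, 0; rewrite expr1n expr0n /= addr0; split => //; ring.
have n1 : 0 < a ^+ 2 + b ^+ 2 by rewrite lt0r n0 addr_ge0 ?sqr_ge0.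
pose N := Num.sqrt (a ^+ 2 + b ^+ 2).
have NN : N ^+ 2 = a ^+ 2 + b ^+ 2 by rewrite sqr_sqrtr// ltW.
have N0 : N != 0 by rewrite gt_eqF// sqrtr_gt0.
exists (a / N), (- b / N); split; last by field.
by rewrite !expr_div_n -mulrDl sqrrN NN divff.
Qed.

(** The rotation of [align_direction] removes the term y t and a shear the last four
    parameters.  At the origin the value of F is that of the canonical function with angular
    part and fraction equal to zero. *)
Theorem canonical_at_surface (P : params R) U F : sheets U F ->
  (forall n p, U n p -> punctured p -> canonical_at P (F n) p) -> canonical_up_to_iM (surface U F).
Proof.
move=> [reg _] gF.
have value n p : U n p -> (exists2 t, is_angle p t & F n p = canonical_fun P t p) /\
    (punctured p \/ (pb1 P = 0 /\ pb2 P = 0)).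
  move=> Up; have [p0|/eqP p0] := eqVneq p (0, 0); last first.
    have pp : punctured p by apply/puncturedP.
    have [T _ /nbhs_singleton [? ?]] := gF n p Up pp.
    by split; [exists (T p)|left].
  rewrite p0 in Up *; have [[oU _ _] bF] := reg n.
  have [[a1 a2 a2' a3] b1 b2 F0] := smooth_at_origin oU bF Up (gF n).
  split; last by right.
  exists 0; first by rewrite /is_angle /= !mul0r.
  by rewrite F0 /canonical_fun /angular_part a1 a2 a2' a3 b1 b2 /norm2 /=; ring.
have [c [s [cs cs0]]] := align_direction (pa2 P) (pa2' P).
have [a [ca sa]] := angle_exists cs.
pose P' := rotate_params c s a P.
have csN : c ^+ 2 + (- s) ^+ 2 = 1 by rewrite sqrrN.
pose sub (x : R * R * R) : R * R * R := (x.1, x.2 - (2 * pe P' / 2 * (x.1.1 ^+ 2 + x.1.2 ^+ 2) + pf P' * x.1.1 + pg P' * x.1.2 + ph P')).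
apply: (@canonical_image _ (fun x => sub (rotate c (- s) x.1, x.2))
  (shear (2 * pe P') (pf P') (pg P') (ph P') \o rotation c (- s))
  (pa1 P') (pa2 P') (pa3 P') (pb1 P') (pb2 P') (pc1 P') (pc2 P')).
- by apply: iM_transformation_comp; [exact: iM_rotation|exact: iM_shear].
- by move=> [q z].
move=> [p z] [n _ [/= Up ->]]; have [[t pt ->] hb] := value n p Up.
pose q := rotate c (- s) p.
have pE : p = rotate c s q by have := rotateK csN p; rewrite opprK.
have n2 : norm2 q = norm2 p by rewrite [in RHS]pE norm2_rot.
have hb' : punctured q \/ (pb1 P = 0 /\ pb2 P = 0) by rewrite /punctured /= n2.
suff : canonical_surface (pa1 P') (pa2 P') (pa3 P') (pb1 P') (pb2 P') (pc1 P') (pc2 P')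
  (sub (q, canonical_fun P t p)) by [].
rewrite [in canonical_fun P t p]pE (canonical_fun_rotate a t cs hb') -/P'.
rewrite pE in pt; move: (is_angle_rotate ca sa pt) => {pt}.
have a2'0 : pa2' P' = 0 by rewrite /P' /rotate_params.
clearbody q; clear pE n2 hb hb'; case: q => x y h; have h' := Arctan_quotientP h; rewrite /canonical_surface /=.
exists (t + a); first exact: h'.
by rewrite /canonical_fun /angular_part a2'0 /norm2 /= -!expr2; move: (_ / (_ + _)) => X; field.
Qed.

Lemma canonical_move (D D' : set (R * R)) phi psi act f U F :
  move D D' phi psi act f -> (forall n, U n `<=` D) ->
  canonical_up_to_iM (surface (fun n => D' `&` psi @^-1` (U n)) (fun n => act (F n))) ->
  canonical_up_to_iM (surface U F).
Proof.
move=> mv UD [a1 [a2 [a3 [b1 [b2 [c1 [c2 [Psi [sub eqv]]]]]]]]].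
exists a1, a2, a3, b1, b2, c1, c2, Psi; split => //; apply: iM_equivalent_trans eqv.
by exists f; [exact: mv_iM mv|exact: (move_surface mv _ UD)].
Qed.

Definition off A B : set (R * R) := [set p | Some p <> A /\ Some p <> B].

Definition meets (C : set (ext_space R)) A : Prop := exists2 x, C x & top_view x = A.

(** From the elliptic pencil, only the points of the circles over its base points are kept. *)
Definition pencil_family (t0 t1 : R) (C : R -> set (ext_space R)) A B U F : Prop :=
  [/\ iM_circle_family t0 t1 C,
      forall t, t \in `[t0, t1] -> meets (C t) A /\ meets (C t) B &
      forall t, t \in `[t0, t1] -> exists n, arc_in (U n `&` off A B) (F n) (C t)].

Lemma pencil_familyC t0 t1 C A B U F :
  pencil_family t0 t1 C A B U F -> pencil_family t0 t1 C B A U F.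
Proof.
move=> [fam mt arc]; split => // t tt; first by have [? ?] := mt t tt.
have [n an] := arc t tt; exists n; apply: arc_sub an => p [Up [? ?]].
by split.
Qed.

Lemma pencil_family_sub t0 t1 C A B U U' F : (forall n, U n `&` off A B `<=` U' n) ->
  pencil_family t0 t1 C A B U F -> pencil_family t0 t1 C A B U' F.
Proof.
move=> sub [fam mt arc]; split => // t tt.
have [n an] := arc t tt; exists n; apply: arc_sub an => p Up; split; first exact: sub.
by case: Up.
Qed.

Lemma cancel_image (T T' : Type) (f : T -> T') g : cancel f g -> forall X : set T, g @` (f @` X) = X.
Proof.
move=> fK X; rewrite image_comp.
by apply/seteqP; split => [_ [x Xx <-]|x Xx]; [rewrite /= fK|exists x; rewrite //= fK].
Qed.

Lemma iM_circle_image f (C : set (ext_space R)) : iM_transformation f -> iM_circle C -> iM_circle (f @` C).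
Proof.
move=> [[g fK gK] sf] [S1 [S2 [/sf s1 /sf s2 ne -> inf]]].
have back := cancel_image fK.
exists (f @` S1), (f @` S2); split => //.
- by move=> e; apply: ne; rewrite -[S1]back e back.
- apply/seteqP; split; first by move=> _ [x [x1 x2] <-]; split; exists x.
  move=> y [[x x1 <-] [x' x2 /(can_inj fK) e]]; exists x => //; split => //.
  by rewrite -e.
- by move=> fin; apply: inf; rewrite -(back (S1 `&` S2)); exact: finite_image.
Qed.

Lemma pencil_family_move (D D' : set (R * R)) phi psi act f t0 t1 C A B A' B' U F :
  move D D' phi psi act f -> (forall n, U n `<=` D) ->
  (forall x, top_view x = A -> top_view (f x) = A') ->
  (forall x, top_view x = B -> top_view (f x) = B') ->
  (forall p, D p -> off A B p -> off A' B' (phi p)) ->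
  pencil_family t0 t1 C A B U F ->
  pencil_family t0 t1 (fun t => f @` C t) A' B' (fun n => D' `&` psi @^-1` (U n)) (fun n => act (F n)).
Proof.
move=> mv UD fA fB foff [[t01 circ inj] mt arc]; have iMf := mv_iM mv.
split; first split => //.
- by move=> t tt; apply: iM_circle_image (circ t tt).
- move=> t u tt uu e; apply: inj => //.
  have [[g fK gK] _] := iMf.
  have back := cancel_image fK.
  by rewrite -[C t]back e back.
- move=> t tt; have [[x Cx xA] [y Cy yB]] := mt t tt; split.
    by exists (f x); [exists x|exact: fA].
  by exists (f y); [exists y|exact: fB].
- move=> t tt; have [n an] := arc t tt; exists n.
  apply: (move_arc mv _ _ an) => p [Up op]; first exact: UD Up.
  have [D'p e] := mv_fwd mv (UD n p Up); split; last by apply: foff => //; exact: UD Up.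
  by split => //=; rewrite e.
Qed.

(** The origin is removed from all elements; this keeps them connected and linked. *)
Theorem pencil_canonical_at t0 t1 C U F : sheets U F -> pencil_family t0 t1 C (Some (0, 0)) None U F ->
  exists P, forall n p, U n p -> punctured p -> canonical_at P (F n) p.
Proof.
move=> sh [[t01 circ inj] mt arc]; have [reg _] := sh.
have sh' := sheets_setD1 (0, 0) sh.
have UP n : U n `\ (0, 0) `<=` @punctured R by move=> p [_ p0]; apply/puncturedP.
have [|||||P [n [p [Up gp]]]] := @family_canonical_at R (fun n => U n `\ (0, 0)) F t0 t1 C t01 inj.
- by move=> n; have [[? _ _] _] := proj1 sh' n.
- by move=> n; have [_ ?] := proj1 sh' n.
- exact: UP.
- move=> t tt; have [[[[[x y] z]|u] Cz //= [x0 y0]] [[[[x' y'] z']|u'] Cu //= _]] := mt t tt.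
  apply: circle_over_lineP; [exact: circ|by exists u'|].
  by exists z; rewrite x0 y0 in Cz.
- move=> t tt; have [n an] := arc t tt; exists n; apply: arc_sub an => p [Up [p0 _]].
  by split => // e; apply: p0; rewrite e.
exists P => m q Uq /puncturedP q0.
exact: (canonical_at_sheets sh' UP Up gp (conj Uq q0)).
Qed.

Lemma translation_top v x p : top_view x = Some p ->
  top_view (translation v x) = Some (p.1 - v.1, p.2 - v.2).
Proof. by case: x => [[[x y] z]|//] [<-]. Qed.

Theorem canonical_point_infinity t0 t1 C p U F : sheets U F ->
  pencil_family t0 t1 C (Some p) None U F -> canonical_up_to_iM (surface U F).
Proof.
move=> sh fam; have mv := move_translation p.
have UT n : U n `<=` setT by [].
apply: (canonical_move mv UT); have sh' := move_sheets mv sh UT.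
suff [P gP] : exists P, forall n q, (setT `&` (fun q => (q.1 + p.1, q.2 + p.2)) @^-1` U n) q -> punctured q ->
    canonical_at P (fun q => F n (q.1 + p.1, q.2 + p.2)) q by exact: canonical_at_surface sh' gP.
apply: (pencil_canonical_at sh'); apply: (pencil_family_move mv UT _ _ _ fam).
- by move=> x /(translation_top p) ->; rewrite !subrr.
- by case=> [[[? ?] ?]|].
- move=> [x y] _ [qp _]; split => //= -[/eqP e1 /eqP e2]; apply: qp.
  by move: e1 e2; rewrite !subr_eq0 => /eqP -> /eqP ->; rewrite -surjective_pairing.
Qed.

(** No point of the surface is sent to the ideal line by the inversion, which takes the
    origin to infinity. *)
Theorem canonical_uncovered t0 t1 C w U F : w <> (0, 0) -> sheets U F ->
  pencil_family t0 t1 C (Some (0, 0)) (Some w) U F -> (forall n, ~ U n (0, 0)) ->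
  canonical_up_to_iM (surface U F).
Proof.
move=> w0 sh fam U0; have mv := move_inversion R.
have UP n : U n `<=` @punctured R by move=> p Up; apply/puncturedP => e; apply: (U0 n); rewrite -e.
apply: (canonical_move mv UP); have sh' := move_sheets mv sh UP.
apply: (@canonical_point_infinity t0 t1 (fun t => @inversion R @` C t) (inv_pt w) _ _ sh').
apply: pencil_familyC; apply: (pencil_family_move mv UP _ _ _ fam).
- by case=> [[[x y] z]|//] [-> ->] /=; rewrite eqxx.
- case=> [[[x y] z]|//] [xy] /=; rewrite -xy; case: eqP => [e|//]; by case: w0; rewrite -xy e.
- move=> p p0 [_ pw]; split => //= -[e1 e2]; apply: pw.
  have wp : punctured w by apply/puncturedP.
  have : inv_pt p = inv_pt w by rewrite [LHS]surjective_pairing [RHS]surjective_pairing /= e1 e2.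
  by move=> /(congr1 (@inv_pt R)); rewrite !inv_ptK// => ->.
Qed.

End Assembly.

(** * Pencils with two finite base points *)

Section Final.
Variable R : realType.
Implicit Types (p q v w : R * R) (A B : ext_plane R) (Phi : set (R * R * R)).
Implicit Types (U : nat -> set (R * R)) (F : nat -> R * R -> R).

Lemma is_angle_exists p : exists t : R, is_angle p t.
Proof.
have [->|/eqP p0] := eqVneq p (0, 0); first by exists 0; rewrite /is_angle /= !mul0r.
have [H [T [Hp st]]] := std_exists (proj2 (puncturedP p) p0).
by exists (T p); exact: std_is_angle st _ Hp.
Qed.

Lemma sphere_canonical (a b c d : R) U F :
  (forall n p, U n p -> F n p = a / 2 * (p.1 ^+ 2 + p.2 ^+ 2) + b * p.1 + c * p.2 + d) ->
  canonical_up_to_iM (surface U F).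
Proof.
move=> h; apply: (@canonical_image _ _ (fun x => (x.1, x.2 - (a / 2 * (x.1.1 ^+ 2 + x.1.2 ^+ 2) + b * x.1.1 + c * x.1.2 + d)))
  (shear a b c d) 0 0 0 0 0 0 0); [exact: iM_shear|by move=> [q z]|].
move=> [p z] [n _ [/= Up ->]]; rewrite (h n p Up) subrr.
have [t pt] := is_angle_exists p; case: p {Up} pt => x y pt; exists t; first exact: Arctan_quotientP.
by rewrite /= !(mul0r, addr0).
Qed.

(** The inversion is only used to compute.  After it, w moves to the origin and is still
    covered, so the angular part and the fraction vanish by [smooth_at_origin].  Transformed
    back, c1 y^2 + c2 x y becomes the fraction (c1 y^2 + c2 x y) / (x^2 + y^2) up to terms
    vanishing at the origin; as the origin is covered, continuity along three rays gives
    c1 = c2 = 0, and the surface lies on one i-M-sphere. *)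
Theorem canonical_covered t0 t1 C w U F (N M : nat) : w <> (0, 0) -> sheets U F ->
  pencil_family t0 t1 C (Some (0, 0)) (Some w) U F -> U N (0, 0) -> U M w ->
  canonical_up_to_iM (surface U F).
Proof.
move=> w0 sh fam UN UM; have [reg _] := sh.
have wp : punctured w by apply/puncturedP.
pose Uo n := U n `\ (0, 0).
have sho : sheets Uo F := sheets_setD1 (0, 0) sh.
have famo : pencil_family t0 t1 C (Some (0, 0)) (Some w) Uo F.
  by apply: pencil_family_sub fam => n p [Up [p0 _]]; split => //= e; apply: p0; rewrite e.
have UP n : Uo n `<=` @punctured R by move=> p [_ p0]; apply/puncturedP.
have mv := move_inversion R.
have sh1 := move_sheets mv sho UP.
have fam1 : pencil_family t0 t1 (fun t => @inversion R @` C t) None (Some (inv_pt w))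
    (fun n => @punctured R `&` @inv_pt R @^-1` Uo n) (fun n => kelvin (F n)).
  apply: (pencil_family_move mv UP _ _ _ famo).
  - by case=> [[[x y] z]|//] [-> ->] /=; rewrite eqxx.
  - case=> [[[x y] z]|//] [xy] /=; rewrite -xy; case: eqP => [e|//]; by case: w0; rewrite -xy e.
  - move=> p p0 [_ pw]; split => // /Some_inj /(congr1 (@inv_pt R)).
    by rewrite !inv_ptK// => e; apply: pw; rewrite e.
pose v := inv_pt w; have mt := move_translation v.
pose U2 n := setT `&` (fun q => (q.1 + v.1, q.2 + v.2)) @^-1` (@punctured R `&` @inv_pt R @^-1` Uo n).
pose F2 n q := kelvin (F n) (q.1 + v.1, q.2 + v.2).
have sub1 n : @punctured R `&` @inv_pt R @^-1` Uo n `<=` setT by [].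
have sh2 : sheets U2 F2 := move_sheets mt sh1 sub1.
have fam2 : pencil_family t0 t1 (fun t => translation v @` (@inversion R @` C t)) None (Some (0, 0)) U2 F2.
  apply: (pencil_family_move mt sub1 _ _ _ fam1).
  - by case=> [[[? ?] ?]|].
  - by move=> x /(translation_top v) ->; rewrite !subrr.
  - move=> p _ [_ pv]; split => // -[/eqP e1 /eqP e2]; apply: pv.
    by move: e1 e2; rewrite !subr_eq0 => /eqP e1 /eqP e2; congr Some; rewrite [LHS]surjective_pairing [RHS]surjective_pairing e1 e2.
have [P gP] := pencil_canonical_at sh2 (pencil_familyC fam2).
have vp : punctured v := punctured_inv_pt wp.
have vw : inv_pt v = w by exact: inv_ptK.
clearbody v.
have smooth n : U2 n (0, 0) -> [/\ [/\ pa1 P = 0, pa2 P = 0, pa2' P = 0 & pa3 P = 0],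
     pb1 P = 0, pb2 P = 0 & F2 n (0, 0) = ph P].
  have [[opU _ _] biU] := proj1 sh2 n.
  by move=> h; exact: smooth_at_origin opU biU h (gP n).
have [[a1 a2 a2' a3] b1 b2 _] : [/\ [/\ pa1 P = 0, pa2 P = 0, pa2' P = 0 & pa3 P = 0],
     pb1 P = 0, pb2 P = 0 & F2 M (0, 0) = ph P].
  apply: smooth; split => //=; rewrite !add0r -surjective_pairing; split => //=.
  by rewrite vw.
(* the canonical function, without its angular part and its fraction *)
pose K q := pc1 P * q.2 ^+ 2 + pc2 P * q.1 * q.2 + (pe P * norm2 q + pf P * q.1 + pg P * q.2 + ph P).
have F2K n q : U2 n q -> F2 n q = K q.
  move=> Uq; have [q0|/eqP/puncturedP q0] := eqVneq q (0, 0).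
    rewrite q0 in Uq *; have [_ _ _ ->] := smooth n Uq.
    by rewrite /K /norm2 /=; ring.
  have [T _ /nbhs_singleton [_ ->]] := gP n q Uq q0.
  by rewrite /canonical_fun /angular_part /K a1 a2 a2' a3 b1 b2 !mul0r !addr0 !mul0r !add0r.
have FK n p : U n p -> punctured p ->
    F n p = norm2 p * K ((inv_pt p).1 - v.1, (inv_pt p).2 - v.2).
  move=> Up p0; have n0 : norm2 p != 0 by rewrite gt_eqF.
  have rp := punctured_inv_pt p0; have rK := inv_ptK p0; have nr := norm2_inv_pt p0.
  move: (inv_pt p) rp rK nr => r rp rK nr.
  rewrite -(F2K n); last first.
    split => //=; rewrite !subrK -surjective_pairing; split => //=.
    by rewrite rK; split => //; exact/puncturedP.
  by rewrite /F2 /= !subrK -surjective_pairing /kelvin rK nr mulrA divff// mul1r.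
clear -FK reg UN.
have ray n (x y : R) : `|x| <= 1 -> `|y| <= 1 -> 0 < x ^+ 2 + y ^+ 2 -> U n (0, 0) ->
    F n (0, 0) = (pc1 P * y ^+ 2 + pc2 P * x * y) / (x ^+ 2 + y ^+ 2) + pe P.
  move=> x1 y1 xy U0; have [[oU _ _] [CF _]] := reg n.
  have cF : {for (0, 0), continuous (F n)} by exact: (class_C_cont CF U0).
  have [r r0 sub] := open_ball oU U0; pose N2 := x ^+ 2 + y ^+ 2.
  have n1 : x ^+ 2 + y ^+ 2 != 0 by rewrite gt_eqF.
  apply: (@ray_limit R (F n) x y
   (- (2 * pc1 P * y * v.2 + pc2 P * (x * v.2 + y * v.1)) - 2 * pe P * (x * v.1 + y * v.2) + pf P * x + pg P * y)
   (N2 * (pc1 P * v.2 ^+ 2 + pc2 P * v.1 * v.2 + pe P * norm2 v - pf P * v.1 - pg P * v.2 + ph P))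
   _ r cF r0) => s /andP[s0 sr].
  have n0 : norm2 (s * x, s * y) = s ^+ 2 * (x ^+ 2 + y ^+ 2) by rewrite /norm2 /=; ring.
  have bs : ball ((0, 0) : R * R) r (s * x, s * y).
    by apply/ball_square; rewrite /= !subr0 !normrM gtr0_norm//; split;
      apply: le_lt_trans sr; rewrite ger_pMr.
  have ps : punctured (s * x, s * y) by rewrite /punctured /= n0 mulr_gt0// exprn_gt0.
  rewrite (FK n _ (sub _ bs) ps) inv_ptE n0 /K /norm2 /N2 /=.
  have s1 : s != 0 by rewrite gt_eqF.
  clear -s1 n1; move: (v.1) (v.2) => v1 v2.
  by field; rewrite n1 s1.
have N0 : `|0 : R| <= 1 by rewrite normr0.
have N1 : `|1 : R| <= 1 by rewrite normr1.
have r10 n := ray n 1 0 N1 N0; have r01 n := ray n 0 1 N0 N1; have r11 n := ray n 1 1 N1 N1.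
rewrite !expr0n !expr1n /= !(mulr1, mulr0, mul0r, addr0, add0r, divr1) in r10 r01 r11.
have {}r10 n := r10 n ltr01; have {}r01 := r01 N ltr01 UN; have {}r11 := r11 N (ltr0Sn _ 1) UN.
rewrite (_ : 1 + 1 = 2 :> R)// in r11.
have c1 : pc1 P = 0 by have := r10 N UN; lra.
have c2 : pc2 P = 0 by have := r10 N UN; lra.
apply: (@sphere_canonical (2 * (pe P * norm2 v - pf P * v.1 - pg P * v.2 + ph P))
  (pf P - 2 * pe P * v.1) (pg P - 2 * pe P * v.2) (pe P)) => n p Up.
have [p0|/eqP/puncturedP p0] := eqVneq p (0, 0).
  by rewrite p0 in Up *; rewrite r10// expr0n /=; ring.
rewrite (FK n p Up p0) inv_ptE /K c1 c2 /norm2 /=.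
have : p.1 * p.1 + p.2 * p.2 != 0 by rewrite -[X in X != 0]/(norm2 p) gt_eqF.
by move: p.1 p.2 v.1 v.2 => x y v1 v2 xy; field.
Qed.

Theorem canonical_two_points t0 t1 C p q U F : p <> q -> sheets U F ->
  pencil_family t0 t1 C (Some p) (Some q) U F -> canonical_up_to_iM (surface U F).
Proof.
move=> pq; wlog p0 : C p q U F pq / p = (0, 0).
  move=> hw sh fam; have mt := move_translation p.
  have UT n : U n `<=` setT by [].
  apply: (canonical_move mt UT); have sh' := move_sheets mt sh UT.
  have inj r r' : (r.1 - p.1, r.2 - p.2) = (r'.1 - p.1, r'.2 - p.2) -> r = r'.
    by move=> [/addIr e1 /addIr e2]; rewrite [r]surjective_pairing e1 e2 -surjective_pairing.
  apply: (hw (fun t => translation p @` C t) (0, 0) (q.1 - p.1, q.2 - p.2) _ _ _ erefl sh').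
    by move=> e; apply: pq; apply: inj; rewrite !subrr.
  apply: (pencil_family_move mt UT _ _ _ fam).
  - by move=> x /(translation_top p) ->; rewrite !subrr.
  - by move=> x /(translation_top p) ->.
  - move=> r _ [rp rq]; split => -[]; last by move=> e1 e2; apply: rq; congr Some; apply: inj; rewrite e1 e2.
    by move=> e1 e2; apply: rp; congr Some; apply: inj; rewrite e1 e2 !subrr.
subst p; move=> sh fam.
have [[N UN]|/forallNP U0] := pselect (exists n, U n (0, 0)); last first.
  exact: canonical_uncovered (nesym pq) sh fam U0.
have [[M UM]|/forallNP Uq] := pselect (exists n, U n q).
  exact: canonical_covered (nesym pq) sh fam UN UM.
have mt := move_translation q.
have UT n : U n `<=` setT by [].
apply: (canonical_move mt UT); have sh' := move_sheets mt sh UT.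
have inj r r' : (r.1 - q.1, r.2 - q.2) = (r'.1 - q.1, r'.2 - q.2) -> r = r'.
  by move=> [/addIr e1 /addIr e2]; rewrite [r]surjective_pairing e1 e2 -surjective_pairing.
apply: (@canonical_uncovered R t0 t1 (fun t => translation q @` C t) (0 - q.1, 0 - q.2) _ _ _ sh').
- by move=> e; apply: pq; apply: inj; rewrite /= e !subrr.
- apply: pencil_familyC; apply: (pencil_family_move mt UT _ _ _ fam).
  + by move=> x /(translation_top q) ->.
  + by move=> x /(translation_top q) ->; rewrite !subrr.
  + move=> r _ [rp rq]; split => -[]; first by move=> e1 e2; apply: rp; congr Some; apply: inj; rewrite /= e1 e2.
    by move=> e1 e2; apply: rq; congr Some; apply: inj; rewrite e1 e2 !subrr.
- by move=> n [_ /=]; rewrite !add0r -surjective_pairing; exact: Uq.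
Qed.

End Final.

Theorem theorem5 (R : realType) (Phi : set (R * R * R))
    (t0 t1 : R) (C : R -> set (ext_space R))
    (E : set (set (ext_plane R))) :
  i_Willmore Phi ->
  iM_circle_family t0 t1 C ->
  carries_family Phi t0 t1 C ->
  elliptic_pencil E ->
  top_view_in t0 t1 C E ->
  exists (a1 a2 a3 b1 b2 c1 c2 : R) (Psi : set (R * R * R)),
    Psi `<=` canonical_surface a1 a2 a3 b1 b2 c1 c2 /\
    iM_equivalent (embed Phi) (embed Psi).
Proof.
move=> [U [F [reg cont PhiE]]] circ carries [A [B [AB ->]]] tv.
rewrite PhiE -[X in exists _ _ _ _ _ _ _ _, _ /\ iM_equivalent (embed X) _]/(surface U F).
suff : canonical_up_to_iM (surface U F) by [].
have sh : sheets U F by split.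
have oU n : open (U n) by have [[]] := reg n.
have fam : pencil_family t0 t1 C A B U F.
  split => // t tt.
    have [_ [x Cx xA] [y Cy yB]] := tv t tt.
    by split; [exists x|exists y].
  have [|n an] := @arc_sheet R U F (odflt (0, 0) A) (odflt (0, 0) B) Phi (C t) oU _ PhiE (carries t tt).
    by move=> n p Up; have [_ [CF _]] := reg n; exact: (class_C_cont CF Up).
  exists n; apply: arc_sub an => p [[Up pA] pB]; split => //.
  by split => e; [apply: pA; rewrite -e|apply: pB; rewrite -e].
case: A B AB fam {tv} => [p|] [q|] AB fam.
- by apply: canonical_two_points sh fam => e; apply: AB; rewrite e.
- exact: canonical_point_infinity sh fam.
- exact: canonical_point_infinity sh (pencil_familyC fam).
- by case: AB.
Qed.
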